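(* Let $f:I\to E$ be a $\lambda$-measurable mapping such that $\|f(t)\|\le M$ for all $t\in I$, for some nonnegative real constant $M$. For every $t\in I$ let $A(t):D(A(t))\subset E\rightrightarrows E$ be a maximal monotone operator, and assume: (H1) there is a function $r:I\to[0,+\infty[$, right continuous on $[0,T[$ and nondecreasing, with $r(0)=0$ and $r(T)<+\infty$, such that $dis(A(t),A(s))\le dr(]s,t])=r(t)-r(s)$ for $0\le s\le t\le T$; (H2) there is a nonnegative real constant $c$ such that $\|A^0(t,x)\|\le c(1+\|x\|)$ for all $t\in I$, $x\in D(A(t))$; (H3) $\bigcup_{t\in I}D(A(t))$ is ball-compact, i.e. its intersection with any closed ball of $E$ is compact. Then for any $x_0\in E$ and $u_0\in D(A(0))$ there exists a unique BVRC solution $(x,u):I\to E\times E$ to the problem $$\begin{cases}x(t)=x_0+\int_{]0,t]}u(s)\,d\nu(s)\quad\forall t\in I;\\ u(0)=u_0;\\ u(t)\in D(A(t))\quad\forall t\in I;\\ -\frac{du}{d\nu}(t)\in A(t)u(t)+f(t)\frac{d\lambda}{d\nu}(t)\quad \nu\text{-a.e. }t\in I,\end{cases}$$ with the estimate $\frac{du}{d\nu}(t)\in K\overline B_E$ for $\nu$-a.e. $t$, where $K$ is a positive constant.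
   Context: $E$ is a separable real Hilbert space with inner product $\langle\cdot,\cdot\rangle$ and norm $\|\cdot\|$; $\overline B_E$ is its closed unit ball; $I=[0,T]$ with $T>0$; $\lambda$ is Lebesgue measure on $I$. For a maximal monotone operator $A(t)$, $D(A(t))$ is its domain and $A^0(t,x)$ is the projection of the origin on the closed convex set $A(t)x$. The pseudo-distance between maximal monotone operators $A,B$ is $$dis(A,B)=\sup\Big\{\frac{\langle y-y',x'-x\rangle}{1+\|y\|+\|y'\|}:\ x\in D(A),\,y\in Ax,\,x'\in D(B),\,y'\in Bx'\Big\}.$$ $dr$ is the Stieltjes measure on $I$ associated with $r$ (so $dr(]s,t])=r(t)-r(s)$), $\nu:=\lambda+dr$, and $\frac{d\lambda}{d\nu}$ is the density of $\lambda$ with respect to $\nu$. A mapping $u:I\to E$ is BVRC if it is of bounded variation and right continuous. $\frac{du}{d\nu}$ denotes the density with respect to $\nu$ of the differential measure $du$ of $u$ ($du(]s,t])=u(t)-u(s)$), i.e. $u(t)=u(0)+\int_{]0,t]}\frac{du}{d\nu}\,d\nu$; being a solution includes the existence of this density. *)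

(* Defs.v *)
From HB Require Import structures.
From mathcomp Require Import all_boot all_order all_algebra.
From mathcomp Require Import all_classical all_reals all_analysis.

Set Implicit Arguments.
Unset Strict Implicit.
Unset Printing Implicit Defensive.

Import Order.TTheory GRing.Theory Num.Theory.
Import numFieldNormedType.Exports.

Local Open Scope classical_set_scope.
Local Open Scope ring_scope.

(* A real Hilbert space is a complete normed module [E] with a symmetric
   positive definite form [dot : {dot E for idfun}] inducing its norm. *)

Definition norm_of_dot (R : realType) (E : normedModType R)
    (dot : {dot E for idfun}) : Prop :=
  forall x : E, `|x| = Num.sqrt (dot x x).

Definition separable (E : topologicalType) : Prop :=
  exists2 S : set E, countable S & dense S.

Definition dom (E : Type) (A : E -> set E) : set E := [set x | A x !=set0].

Definition monotone (R : realType) (E : normedModType R)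
    (dot : {dot E for idfun}) (A : E -> set E) : Prop :=
  forall x y x' y', A x y -> A x' y' -> 0 <= dot (y - y') (x - x').

Definition maximal_monotone (R : realType) (E : normedModType R)
    (dot : {dot E for idfun}) (A : E -> set E) : Prop :=
  monotone dot A /\
  forall B : E -> set E, monotone dot B ->
    (forall x, A x `<=` B x) -> (forall x, B x `<=` A x).

(* The supremum is taken in [\bar R]: it may be [+oo]. *)
Definition dis (R : realType) (E : normedModType R)
    (dot : {dot E for idfun}) (A B : E -> set E) : \bar R :=
  ereal_sup [set z | exists x y x' y', [/\ A x y, B x' y' &
    z = (dot (y - y') (x' - x) / (1 + `|y| + `|y'|))%:E]].

Definition is_proj (R : realType) (E : normedModType R)
    (C : set E) (x p : E) : Prop :=
  C p /\ forall q, C q -> `|x - p| <= `|x - q|.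

(* The values of a maximal monotone operator are closed and convex, so at a
   point of its domain the projection exists and is unique; the default [0]
   is only reached outside the domain. *)
Definition min_section (R : realType) (E : normedModType R)
    (A : E -> set E) (x : E) : E :=
  xget 0 [set p | is_proj (A x) 0 p].

Definition ball_compact (R : realType) (E : normedModType R)
    (S : set E) : Prop :=
  forall (a : E) (rho : R), compact (S `&` closed_ball a rho).

(* [variation] and [bounded_variation] of [numfun], for vector values. *)
Definition vvariation (R : realType) (V : normedModType R)
    (a b : R) (u : R -> V) (s : seq R) : R :=
  let F := u \o nth b (a :: s) in
  \sum_(0 <= n < size s) `|F n.+1 - F n|.

Definition vbounded_variation (R : realType) (V : normedModType R)
    (a b : R) (u : R -> V) : Prop :=
  has_ubound [set vvariation a b u s | s in itv_partition a b].

(* A map on [[0, T]] is represented by a map on [R] whose values outside of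
   [[0, T]] are ignored. *)
Definition bvrc (R : realType) (V : normedModType R)
    (T : R) (u : R -> V) : Prop :=
  vbounded_variation 0 T u /\
  forall t, 0 <= t < T -> u s @[s --> t^'+] --> u t.

Definition simple_map d (X : measurableType d) (V : Type)
    (s : X -> V) : Prop :=
  finite_set (range s) /\ forall y, measurable (s @^-1` [set y]).

Definition strongly_measurable d (X : measurableType d) (R : realType)
    (mu : {measure set X -> \bar R}) (V : normedModType R)
    (D : set X) (g : X -> V) : Prop :=
  exists s : nat -> X -> V, (forall n, simple_map (s n)) /\
    {ae mu, forall x, D x -> s n x @[n --> \oo] --> g x}.

Definition integrable_simple_map d (X : measurableType d) (R : realType)
    (mu : {measure set X -> \bar R}) (V : normedModType R)
    (D : set X) (s : X -> V) : Prop :=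
  simple_map s /\
  forall y, y != 0 -> (mu (D `&` s @^-1` [set y]) < +oo)%E.

Definition simple_integral d (X : measurableType d) (R : realType)
    (mu : {measure set X -> \bar R}) (V : normedModType R)
    (D : set X) (s : X -> V) : V :=
  \sum_(y \in range s) fine (mu (D `&` s @^-1` [set y])) *: y.

(* [g] is Bochner integrable over [D] and its integral is [v]. Strong
   measurability makes [g - s n] agree almost everywhere with a measurable map,
   so the library integral of its norm (defined for any function as a lower
   integral) is the usual one. *)
Definition is_bochner_integral d (X : measurableType d) (R : realType)
    (mu : {measure set X -> \bar R}) (V : normedModType R)
    (D : set X) (g : X -> V) (v : V) : Prop :=
  strongly_measurable mu D g /\
  exists s : nat -> X -> V,
    [/\ forall n, integrable_simple_map mu D (s n),
        (\int[mu]_(x in D) `|g x - s n x|%:E)%E @[n --> \oo] --> 0%E &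
        simple_integral mu D (s n) @[n --> \oo] --> v].

Definition stieltjes_function (R : realType) (T : R) (r : R -> R) : Prop :=
  [/\ r 0 = 0,
      forall t, 0 <= t <= T -> 0 <= r t,
      forall s t, 0 <= s -> s <= t -> t <= T -> r s <= r t &
      forall t, 0 <= t < T -> r s @[s --> t^'+] --> r t].

(* [r] extended by [r 0] before [0] and by [r T] after [T], so that its
   Stieltjes measure has no atom at [0], and has at [T] the atom
   [r T - lim r(T-)]. *)
Definition clamp (R : realType) (T t : R) : R := Num.max 0 (Num.min t T).

Definition extend (R : realType) (T : R) (r : R -> R)
    (T0 : 0 < T) (hr : stieltjes_function T r) : R -> R :=
  fun t => r (clamp T t).

Lemma clamp_itv (R : realType) (T : R) (t : R) :
  0 < T -> 0 <= clamp T t <= T.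
Proof.
move=> T0; rewrite /clamp le_max lexx/= ge_max (ltW T0)/= ge_min lexx orbT//.
Qed.

Lemma clamp_id (R : realType) (T : R) (t : R) : 0 <= t <= T -> clamp T t = t.
Proof. by move=> /andP[t0 tT]; rewrite /clamp (min_idPl tT) (max_idPr t0). Qed.

Lemma clamp_le (R : realType) (T s t : R) : s <= t -> clamp T s <= clamp T t.
Proof.
move=> st; rewrite /clamp ge_max !le_max lexx/= le_min !ge_min st lexx/=.
by rewrite !orbT.
Qed.

Lemma extend_nondecreasing (R : realType) (T : R) (r : R -> R)
  (T0 : 0 < T) (hr : stieltjes_function T r) :
  {homo extend T0 hr : x y / x <= y}.
Proof.
move=> x y xy; have [_ _ ndr _] := hr; rewrite /extend.
have /andP[cx0 _] := clamp_itv x T0; have /andP[_ cyT] := clamp_itv y T0.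
by apply: ndr => //; exact: clamp_le.
Qed.

Lemma extend_right_continuous (R : realType) (T : R) (r : R -> R)
  (T0 : 0 < T) (hr : stieltjes_function T r) (t : R) :
  extend T0 hr s @[s --> t^'+] --> extend T0 hr t.
Proof.
have [_ _ _ rcr] := hr.
have [t0|t0] := ltP t 0.
  apply: cvg_near_cst; near=> s; rewrite /extend.
  have s0 : s < 0 by near: s; exact: nbhs_right_lt.
  rewrite /clamp !(max_idPl _)// ge_min ?(ltW t0)// ?(ltW s0)//.
have [Tt|tT] := leP T t.
  apply: cvg_near_cst; near=> s; rewrite /extend.
  have ts : t < s by near: s; exact: nbhs_right_gt.
  by rewrite /clamp !(min_idPr _)// ltW// (le_lt_trans Tt).
rewrite {2}/extend clamp_id ?t0 ?(ltW tT)//.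
apply: cvg_trans (rcr t _); last by rewrite t0 tT.
apply: near_eq_cvg; near=> s; rewrite /extend clamp_id//.
have ts : t < s by near: s; exact: nbhs_right_gt.
have sT : s < T by near: s; exact: nbhs_right_lt.
by rewrite (le_trans t0 (ltW ts)) (ltW sT).
Unshelve. all: by end_near. Qed.

HB.instance Definition _ (R : realType) (T : R) (r : R -> R)
    (T0 : 0 < T) (hr : stieltjes_function T r) :=
  isCumulative.Build R _ R (extend T0 hr)
    (@extend_nondecreasing R T r T0 hr) (@extend_right_continuous R T r T0 hr).

Lemma measurable_I (R : realType) (T : R) :
  measurable (`[0, T] : set (measurableTypeR R)).
Proof. exact: (@measurable_itv R `[0, T]). Qed.

Lemma stieltjes_I_fin (R : realType) (F : cumulative R R) (T : R) :
  (lebesgue_stieltjes_measure F (`[0%R, T] : set (measurableTypeR R)) < +oo)%E.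
Proof.
have mB : measurable (`](-1)%R, T] : set (measurableTypeR R)).
  by exact: (@measurable_itv R `](-1)%R, T]).
apply: (@le_lt_trans _ _
    (lebesgue_stieltjes_measure F (`](-1)%R, T] : set (measurableTypeR R)))).
  apply: le_measure; rewrite ?inE//.
  by apply: subset_itvr; rewrite bnd_simp/= ltrN10.
rewrite /lebesgue_stieltjes_measure /measure_extension measurable_mu_extE/=; last exact: is_ocitv.
by rewrite wlength_itv; case: ifP => //=; rewrite -EFinB ltry.
Qed.

(* The measures on [[0, T]] are represented by Borel measures on [R] which are
   null outside of [[0, T]]. *)
Definition lambda_I (R : realType) (T : R) :
    set (measurableTypeR R) -> \bar R :=
  mfrestr (measurable_I T) (stieltjes_I_fin idfun T).
HB.instance Definition _ (R : realType) (T : R) :=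
  FiniteMeasure.on (lambda_I T).

Definition dr_I (R : realType) (T : R) (r : R -> R)
    (T0 : 0 < T) (hr : stieltjes_function T r) :
    set (measurableTypeR R) -> \bar R :=
  mfrestr (measurable_I T) (stieltjes_I_fin (extend T0 hr) T).
HB.instance Definition _ (R : realType) (T : R) (r : R -> R)
    (T0 : 0 < T) (hr : stieltjes_function T r) :=
  FiniteMeasure.on (dr_I T0 hr).

Definition nu_I (R : realType) (T : R) (r : R -> R)
    (T0 : 0 < T) (hr : stieltjes_function T r) :
    set (measurableTypeR R) -> \bar R :=
  measure_add (lambda_I T) (dr_I T0 hr).
HB.instance Definition _ (R : realType) (T : R) (r : R -> R)
    (T0 : 0 < T) (hr : stieltjes_function T r) :=
  Measure.on (nu_I T0 hr).

Lemma nu_I_fin (R : realType) (T : R) (r : R -> R)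
  (T0 : 0 < T) (hr : stieltjes_function T r) : fin_num_fun (nu_I T0 hr).
Proof.
by move=> A mA; rewrite /nu_I measure_addE fin_numD !fin_num_measure.
Qed.

HB.instance Definition _ (R : realType) (T : R) (r : R -> R)
    (T0 : 0 < T) (hr : stieltjes_function T r) :=
  Measure_isFinite.Build _ _ _ (nu_I T0 hr) (@nu_I_fin R T r T0 hr).

Lemma dr_I_itv (R : realType) (T : R) (r : R -> R)
    (T0 : 0 < T) (hr : stieltjes_function T r) (s t : R) :
  0 <= s -> s <= t -> t <= T -> dr_I T0 hr `]s, t] = (r t - r s)%:E.
Proof.
move=> s0 st tT; rewrite /dr_I /mfrestr /mrestr setIidl; last first.
  by apply: subset_itv; rewrite bnd_simp.
rewrite /lebesgue_stieltjes_measure /measure_extension measurable_mu_extE/=.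
  rewrite wlength_itv_bnd//= /extend !clamp_id ?s0 ?(le_trans st)//.
  by rewrite (le_trans s0 st) tT.
exact: is_ocitv.
Qed.

Lemma dr_I_set0 (R : realType) (T : R) (r : R -> R)
    (T0 : 0 < T) (hr : stieltjes_function T r) : dr_I T0 hr [set 0] = 0%E.
Proof.
apply/eqP; rewrite eq_le measure_ge0 andbT.
apply: (@le_trans _ _
    (lebesgue_stieltjes_measure (extend T0 hr)
      (`](-1)%R, 0%R] : set (measurableTypeR R)))).
  apply: le_measure; rewrite ?inE//.
    by apply: measurableI => //; exact: (measurable_I T).
  by move=> x [-> _] /=; rewrite in_itv/= lexx andbT ltrN10.
rewrite /lebesgue_stieltjes_measure /measure_extension measurable_mu_extE/=.
  rewrite wlength_itv_bnd//= /extend /clamp.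
  by rewrite !(max_idPl _) ?subrr// ge_min ?lexx ?lerN10.
exact: is_ocitv.
Qed.

Lemma lambda_dominates (R : realType) (T : R) (r : R -> R)
    (T0 : 0 < T) (hr : stieltjes_function T r) : lambda_I T `<< nu_I T0 hr.
Proof.
apply/null_content_dominatesP => X mX nuX0.
have : (lambda_I T X + dr_I T0 hr X = 0)%E.
  by rewrite -measure_addE; exact: nuX0.
by move=> /eqP; rewrite padde_eq0 ?measure_ge0// => /andP[/eqP-> _].
Qed.

(* A version of the density of [lambda] with respect to [nu]; it is finite
   everywhere since [lambda_I T `<< nu_I T0 hr]. *)
Definition density_lambda (R : realType) (T : R) (r : R -> R)
    (T0 : 0 < T) (hr : stieltjes_function T r) : R -> R :=
  fun t => fine (Radon_Nikodym (charge_of_finite_measure (lambda_I T))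
                          (nu_I T0 hr) t).

(* [g] is a version of the density [du/dnu] of the differential measure of
   [u]. *)
Definition is_density (R : realType) (E : normedModType R)
    (T : R) (nu : {measure set (measurableTypeR R) -> \bar R})
    (u g : R -> E) : Prop :=
  forall t, 0 <= t <= T -> is_bochner_integral nu `]0, t] g (u t - u 0).

(* [(x, u)] is a BVRC solution on [[0, T]], and [g] is the density [du/dnu]
   occurring in the inclusion [- du/dnu(t) \in A(t) u(t) + f(t) p(t)], where
   [p] is the density of [lambda]. *)
Definition is_solution (R : realType) (E : normedModType R)
    (T : R) (nu : {measure set (measurableTypeR R) -> \bar R}) (p : R -> R)
    (A : R -> E -> set E) (f : R -> E) (x0 u0 : E) (x u g : R -> E) : Prop :=
  [/\ bvrc T (fun t => (x t, u t)),
      forall t, 0 <= t <= T -> is_bochner_integral nu `]0, t] u (x t - x0),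
      u 0 = u0,
      forall t, 0 <= t <= T -> dom (A t) (u t) &
      is_density T nu u g /\
      {ae nu, forall t, 0 <= t <= T ->
        [set a + p t *: f t | a in A t (u t)] (- g t)}].

(* Main.v *)
Require Import Defs.
From HB Require Import structures.
From mathcomp Require Import all_boot all_order all_algebra finmap.
From mathcomp Require Import all_classical all_reals all_analysis measurable_realfun.
From mathcomp Require Import ring lra.

Set Implicit Arguments.
Unset Strict Implicit.
Unset Printing Implicit Defensive.

Import Order.TTheory GRing.Theory Num.Theory.
Import numFieldNormedType.Exports.

Local Open Scope classical_set_scope.
Local Open Scope ring_scope.

(** Implicit Euler scheme on the dyadic partitions of [[0, T]].

    With [t_k = k T / 2^n], [delta = nu ]t_k, t_(k+1)]] and [z] a step
    approximation of [h = (dlambda/dnu) f], let [u_(k+1)] be the resolvent of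
    [delta A(t_(k+1))] at [u_k - delta z].  The pseudo-distance bound (H1) and
    the growth bound (H2) give [|u_(k+1) - u_k| <= K delta] by a discrete
    Gronwall argument.  By (H3) the step maps [v_n] converge pointwise along an
    ultrafilter, and since the partitions are nested and [v_n] is
    nu-Lipschitz, a subsequence converges everywhere to some [u].  The atoms of
    [nu] need no special treatment: [v_n(t)] satisfies the inclusion at the
    node following [t], and these nodes decrease to [t], where [r] is right
    continuous.

    The discrete densities [g_n] converge only weakly, but suitable convex
    combinations of their tails converge almost everywhere (Mazur).  Testing
    the discrete inclusions against a point [(a, b)] of the graph of [A(t)]
    gives inequalities that are affine in [g_n], hence stable under convex
    combinations, and maximality of [A(t)] yields the inclusion for the limit.
    The resolvents exist by Minty's theorem, obtained by minimising the
    Fitzpatrick function plus half the squared norm; [u(t)] lies in the domain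
    because the Yosida approximations of [A(t)] at [u(t)] stay bounded.

    Uniqueness: for the difference [w] of two solutions,
    [|w(t)|^2 <= 2 int_{]0,t]} <w, dw/dnu> dnu <= 0]. *)

(** * Maximal monotone operators on a Hilbert space *)

(** The inclusion does not mention [x], so [u] is built first and [x] is then its primitive;
    uniqueness follows the same order. The choice of [nu] drives the estimates: [nu] of a cell is
    positive because of [lambda] and dominates the increment of [r] because of [dr], so the factor
    [r t - r s] given by (H1) is divided out against the step and difference quotients stay bounded
    across the jumps of [r]. No weak topology appears: the minimiser behind Minty's theorem, the
    element of least norm in [A(t) x] and the convex combinations of Mazur's lemma all come from one
    lemma on minimising sequences, where a parallelogram inequality turns near-minimality into a
    Cauchy estimate. Two measurability issues shape the rest. The map [f] is controlled only
    [lambda]-almost everywhere while [nu] may charge [lambda]-null sets; the density vanishes there.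
    Bochner integrable maps are only almost everywhere limits of simple maps; they are replaced by
    everywhere limits before integrals are added or compared. *)

Lemma minimizing_seq (R : realType) (V : Type) (C : nat -> set V)
    (mid : V -> V -> V) (phi : V -> R) (d : V -> V -> R) (L B : R)
    (e : nat -> R) :
  (forall n k, (n <= k)%N -> C k `<=` C n) ->
  (forall n, exists2 z, C n z & phi z <= B) ->
  (forall z, C 0%N z -> L <= phi z) ->
  (forall n z z', C n z -> C n z' -> C n (mid z z')) ->
  (forall z z', C 0%N z -> C 0%N z' ->
    phi (mid z z') + d z z' <= (phi z + phi z') / 2) ->
  (forall n, 0 < e n) -> (forall n k, (n <= k)%N -> e k <= e n) ->
  exists z : nat -> V, [/\ forall n, C n (z n),
    forall n k, (n <= k)%N -> d (z n) (z k) <= 2 * e n &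
    forall n z', (forall k, C k z') -> phi (z n) <= phi z' + e n].
Proof.
move=> Cn CB CL Cmid dmid e0 en.
(* As [C n] shrinks, the infima [m n] increase to their supremum. Each [z n] is chosen in a
   [C (N n)] whose infimum is within [e n] of that supremum, and within [e n] of that infimum. *)
pose m n := inf (phi @` C n).
have Cinf n : has_inf (phi @` C n).
  split; first by have [z Cz _] := CB n; exists (phi z), z.
  by exists L => _ [z Cz <-]; apply: CL; exact: Cn Cz.
have mle n z : C n z -> m n <= phi z.
  by move=> Cz; apply: ge_inf; [exact: (Cinf n).2|exists z].
have mB : has_sup (range m).
  split; first by exists (m 0%N), 0%N.
  by exists B => _ [n _ <-]; have [z Cz zB] := CB n; rewrite (le_trans (mle _ _ Cz)).
have H n : exists N, (n <= N)%N /\ sup (range m) - e n < m N.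
  have [_ [k _ <-] mk] := sup_adherent (e0 n) mB.
  exists (maxn n k); rewrite leq_maxl; split=> //; apply: (lt_le_trans mk).
  apply: lb_le_inf; first exact: (Cinf _).1.
  by move=> _ [z Cz <-]; apply: mle; apply: Cn Cz; rewrite leq_maxr.
have [N HN] := choice H.
have H' n : exists z, C (N n) z /\ phi z < m (N n) + e n.
  by have [_ [z Cz <-] zm] := inf_adherent (e0 n) (Cinf (N n)); exists z.
have [z Hz] := choice H'.
have mS n : m n <= sup (range m) by apply: sup_upper_bound => //; exists n.
(* Here [p] is the smaller of [N n] and [N k], so that both points and their midpoint lie in [C p].
   The midpoint value is at least [sup - e n] and the average of the two values at most [sup + e n],
   whence the factor 2. *)
have key n k p : (n <= k)%N -> sup (range m) - e n < m p ->
    C p (z n) -> C p (z k) -> d (z n) (z k) <= 2 * e n.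
  move=> nk hp Cn' Ck'.
  have := mle _ _ (Cmid _ _ _ Cn' Ck').
  have := dmid _ _ (Cn _ _ (leq0n _) _ Cn') (Cn _ _ (leq0n _) _ Ck').
  have := mS (N n); have := mS (N k); have := (Hz n).2; have := (Hz k).2.
  have := en _ _ nk; lra.
exists z; split=> [n|n k nk|n z' Cz'].
- exact: Cn (HN n).1 _ (Hz n).1.
- have [NN|/ltnW NN] := leqP (N n) (N k).
    apply: (key _ _ (N n)) => //; [exact: (HN n).2|exact: (Hz n).1|].
    exact: Cn NN _ (Hz k).1.
  apply: (key _ _ (N k)) => //; last exact: (Hz k).1.
    by apply: le_lt_trans (HN k).2; rewrite lerB// en.
  exact: Cn NN _ (Hz n).1.
- by have := mle _ _ (Cz' (N n)); have := (Hz n).2; lra.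
Qed.

Lemma cauchy_seq_cvg (R : realType) (E : completeNormedModType R)
    (u : nat -> E) (e : nat -> R) :
  e n @[n --> \oo] --> (0 : R) ->
  (forall n k, (n <= k)%N -> `|u n - u k| <= e n) -> cvgn u.
Proof.
move=> e0 ue; apply/cauchy_cvgP/cauchy_exP => eps eps0.
have /cvgrPdist_lt/(_ _ eps0)[N _ HN] := e0.
exists (u N), N => // k /= Nk; rewrite -ball_normE/=.
apply: le_lt_trans (ue _ _ Nk) _; have := HN N (leqnn N).
by rewrite /= sub0r normrN; apply: le_lt_trans; exact: ler_norm.
Qed.

Section dot.
Context (R : realType) (E : normedModType R) (dot : {dot E for idfun}).

Lemma dotC x y : dot x y = dot y x.
Proof. by rewrite hermC/= expr0 mul1r. Qed.

Lemma dotDl x y z : dot (x + y) z = dot x z + dot y z.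
Proof. by rewrite linearDl. Qed.

Lemma dotBl x y z : dot (x - y) z = dot x z - dot y z.
Proof. by rewrite linearBl. Qed.

Lemma dotZl a x z : dot (a *: x) z = a * dot x z.
Proof. by rewrite linearZl_LR. Qed.

Lemma dotDr x y z : dot z (x + y) = dot z x + dot z y.
Proof. by rewrite linearDr. Qed.

Lemma dotBr x y z : dot z (x - y) = dot z x - dot z y.
Proof. by rewrite linearBr. Qed.

Lemma dotZr a x z : dot z (a *: x) = a * dot z x.
Proof. by rewrite linearZr_LR. Qed.

Lemma dotNl x z : dot (- x) z = - dot x z.
Proof. by rewrite linearNl. Qed.

Lemma dotNr x z : dot z (- x) = - dot z x.
Proof. by rewrite linearNr. Qed.

Lemma dot0l z : dot 0 z = 0.
Proof. by rewrite linear0l. Qed.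

Lemma dot0r z : dot z 0 = 0.
Proof. by rewrite linear0r. Qed.

Definition dotE := (dotDl, dotBl, dotZl, dotNl, dotDr, dotBr, dotZr, dotNr, dot0l, dot0r).

Lemma dot_ge0 x : 0 <= dot x x.
Proof.
by have [->|x0] := eqVneq x 0; [rewrite dot0l|exact/ltW/neq0_dnorm_gt0].
Qed.

Hypothesis hdot : norm_of_dot dot.

Lemma normsq x : `|x| ^+ 2 = dot x x.
Proof. by rewrite hdot sqr_sqrtr// dot_ge0. Qed.

Lemma dot_le x y : dot x y <= `|x| * `|y|.
Proof.
have [->|x0] := eqVneq x 0; first by rewrite dot0l normr0 mul0r.
have [->|y0] := eqVneq y 0; first by rewrite dot0r normr0 mulr0.
have := dot_ge0 (`|y| *: x - `|x| *: y); rewrite !dotE -!normsq (dotC y x).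
have nx : 0 < `|x| by rewrite normr_gt0.
have ny : 0 < `|y| by rewrite normr_gt0.
have h : 0 < `|x| * `|y| by rewrite mulr_gt0.
by rewrite -(ler_pM2l h); nra.
Qed.

Lemma normr_dot_le x y : `|dot x y| <= `|x| * `|y|.
Proof.
rewrite ler_norml dot_le andbT lerNl -dotNl -(normrN x); exact: dot_le.
Qed.
End dot.

Section monotone.
Context (R : realType) (E : completeNormedModType R) (dot : {dot E for idfun}).
Hypothesis hdot : norm_of_dot dot.
Implicit Types A : E -> set E.

Lemma cvg_dot (u v : nat -> E) (x y : E) :
  u n @[n --> \oo] --> x -> v n @[n --> \oo] --> y ->
  dot (u n) (v n) @[n --> \oo] --> dot x y.
Proof.
move=> ux vy.
suff : (fun n => dot (u n) (v n) - dot x y) n @[n --> \oo] --> (0 : R).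
  by move/subr_cvg0.
have h : `|u n| * `|v n - y| + `|u n - x| * `|y| @[n --> \oo] --> (0 : R).
  have -> : (0 : R) = `|x| * `|y - y| + `|x - x| * `|y|.
    by rewrite !subrr !normr0 mulr0 mul0r addr0.
  apply: cvgD; apply: cvgM.
  - exact: cvg_norm.
  - by apply: cvg_norm; apply: cvgB => //; exact: cvg_cst.
  - by apply: cvg_norm; apply: cvgB => //; exact: cvg_cst.
  - exact: cvg_cst.
apply: (@squeeze_cvgr _ _ _ _ (fun n => - (`|u n| * `|v n - y| + `|u n - x| * `|y|))
   (fun n => `|u n| * `|v n - y| + `|u n - x| * `|y|)) => //.
- near=> n; rewrite -ler_norml.
  have -> : dot (u n) (v n) - dot x y = dot (u n) (v n - y) + dot (u n - x) y.
    by rewrite !dotE; ring.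
  by rewrite (le_trans (ler_normD _ _))// lerD// normr_dot_le.
- by rewrite -[X in _ --> X]oppr0; exact: cvgN.
Unshelve. all: by end_near. Qed.

Lemma cvg_ge0 (u : nat -> R) (l : R) :
  u n @[n --> \oo] --> l -> (forall n, 0 <= u n) -> 0 <= l.
Proof.
move=> ul u0; rewrite -(cvg_lim _ ul)//; apply: limr_ge; first by apply/cvg_ex; exists l.
by near=> n.
Unshelve. all: by end_near. Qed.

(** Adjoining [(x, y)] to the graph keeps it monotone, so maximality forces the pair to be there
    already. *)
Lemma maximal_monotoneP A x y : maximal_monotone dot A ->
  (forall a b, A a b -> 0 <= dot (y - b) (x - a)) -> A x y.
Proof.
move=> [mA maxA] H.
apply: (maxA (fun a b => A a b \/ (a = x /\ b = y))); last by right.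
  move=> a b a' b' [Aab|[-> ->]] [Aab'|[-> ->]].
  - exact: mA.
  - by rewrite -(opprB y) -(opprB x) dotNl dotNr opprK; exact: H.
  - exact: H.
  - by rewrite !subrr dot0l.
by move=> a b ?; left.
Qed.

Lemma maximal_monotone_closed A (u v : nat -> E) x y :
  maximal_monotone dot A ->
  u n @[n --> \oo] --> x -> v n @[n --> \oo] --> y ->
  (forall n, A (u n) (v n)) -> A x y.
Proof.
move=> mA ux vy uv; apply: maximal_monotoneP => // a b Aab.
have h : dot (v n - b) (u n - a) @[n --> \oo] --> dot (y - b) (x - a).
  by apply: cvg_dot; apply: cvgB => //; exact: cvg_cst.
by apply: (cvg_ge0 h) => n; exact: mA.1.
Qed.

(** If the graph were empty, [(0, 0)] would vacuously be monotonically related to it. *)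
Lemma maximal_monotone_ex A : maximal_monotone dot A -> exists a b, A a b.
Proof.
move=> mA; apply: contrapT => nA; apply: (nA); exists 0, 0.
by apply: maximal_monotoneP => // a b Aab; exfalso; apply: nA; exists a, b.
Qed.

Lemma half_expn_cvg0 : (2^-1 : R) ^+ n @[n --> \oo] --> (0 : R).
Proof. by apply: cvg_expr; rewrite ger0_norm// invf_lt1// ltr1n. Qed.

Lemma half_expn_gt0 n : 0 < (2^-1 : R) ^+ n.
Proof. by rewrite exprn_gt0. Qed.

Lemma half_expn_le n k : (n <= k)%N -> (2^-1 : R) ^+ k <= 2^-1 ^+ n.
Proof. by move=> nk; apply: ler_wiXn2l => //; rewrite invf_le1// ler1n. Qed.

Lemma norm_le_sqrt_expn (a : E) n :
  dot a a <= 16 * (2^-1 : R) ^+ (n * 2) -> `|a| <= 4 * 2^-1 ^+ n.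
Proof.
move=> h; rewrite -(@ler_pXn2r _ 2%N)// ?nnegrE// ?mulr_ge0 ?exprn_ge0//.
by rewrite (normsq hdot) exprMn -exprM (le_trans h)// ler_wpM2r ?exprn_ge0// -natrX.
Qed.

Lemma cvg_4half : 4 * (2^-1 : R) ^+ n @[n --> \oo] --> (0 : R).
Proof. by rewrite -[X in _ --> X](mulr0 4); apply: cvgM;
  [exact: cvg_cst|exact: half_expn_cvg0]. Qed.

(* Minimise s + |x|^2/2 + |y|^2/2 over the epigraph of the Fitzpatrick function
   of A; the minimiser has the form (x, -x) with (x, -x) in the graph. *)
Lemma maximal_monotone_surj0 A : maximal_monotone dot A ->
  exists x, A x (- x).
Proof.
move=> mA.
have [a0 [b0 Aab0]] := maximal_monotone_ex mA.
(* The third component stands for a value above the Fitzpatrick function, so that an infinite value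
   of that function never has to be handled. *)
pose C (_ : nat) := [set z : E * E * R | forall a b, A a b ->
  dot z.1.1 b + dot a z.1.2 - dot a b <= z.2].
pose mid (z z' : E * E * R) := (2^-1 *: (z.1.1 + z'.1.1), 2^-1 *: (z.1.2 + z'.1.2),
   2^-1 * (z.2 + z'.2)).
pose phi (z : E * E * R) := z.2 + dot z.1.1 z.1.1 / 2 + dot z.1.2 z.1.2 / 2.
pose d (z z' : E * E * R) := 8^-1 * (dot (z.1.1 - z'.1.1) (z.1.1 - z'.1.1) +
  dot (z.1.2 - z'.1.2) (z.1.2 - z'.1.2)).
(* The Fitzpatrick function dominates the duality product: a point violating this would be
   monotonically related to the whole graph, hence belong to it, and the epigraph inequality tested
   at the point itself gives a contradiction. *)
have Cdot z n : C n z -> dot z.1.1 z.1.2 <= z.2.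
  move=> Cz; rewrite leNgt; apply/negP => zlt.
  have /Cz : A z.1.1 z.1.2.
    apply: maximal_monotoneP => // a b Aab; have := Cz _ _ Aab.
    by rewrite !dotE (dotC dot b a) (dotC dot b z.1.1) (dotC dot z.1.2 z.1.1)
      (dotC dot z.1.2 a); lra.
  by rewrite -addrA subrr addr0 leNgt zlt.
have [] := @minimizing_seq R _ C mid phi d 0 (phi (a0, b0, dot a0 b0))
  (fun n => 2^-1 ^+ (n * 2)).
- by move=> n k _ z.
- move=> n; exists (a0, b0, dot a0 b0) => // a b Aab /=.
  by have := mA.1 _ _ _ _ Aab Aab0; rewrite !dotE (dotC dot b a) (dotC dot b a0)
    (dotC dot b0 a0) (dotC dot b0 a); lra.
- move=> z /Cdot; rewrite /phi => h; have := dot_ge0 dot (z.1.1 + z.1.2).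
  by rewrite !dotE (dotC _ z.1.2 z.1.1); lra.
- move=> n z z' Cz Cz' a b Aab /=; have := Cz _ _ Aab; have := Cz' _ _ Aab.
  by rewrite !dotE; lra.
- move=> z z' _ _; rewrite /phi /mid /d /= !dotE (dotC _ z'.1.1 z.1.1)
  (dotC _ z'.1.2 z.1.2).
  lra.
- by move=> n; exact: half_expn_gt0.
- by move=> n k nk; apply: half_expn_le; rewrite leq_mul2r nk orbT.
move=> z [Cz dz phiz].
have dd n k : (n <= k)%N -> dot ((z n).1.1 - (z k).1.1) ((z n).1.1 - (z k).1.1) +
  dot ((z n).1.2 - (z k).1.2) ((z n).1.2 - (z k).1.2) <= 16 * (2^-1 : R) ^+ (n * 2).
  by move=> /dz; rewrite /d; lra.
have cx : cvgn (fun n => (z n).1.1).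
  apply: (cauchy_seq_cvg cvg_4half) => n k nk; apply: norm_le_sqrt_expn.
  by apply: le_trans (dd _ _ nk); rewrite lerDl dot_ge0.
have cy : cvgn (fun n => (z n).1.2).
  apply: (cauchy_seq_cvg cvg_4half) => n k nk; apply: norm_le_sqrt_expn.
  by apply: le_trans (dd _ _ nk); rewrite lerDr dot_ge0.
move: cx cy => /cvg_ex[x cx] /cvg_ex[y cy].
(* First-order optimality at the minimiser, in the direction of the graph point [(a, b)], combined
   with [Cdot]. *)
have key a b : A a b -> dot (x + y) (x + y) <= dot (a + y) (b + x).
  move=> Aab; rewrite -subr_ge0.
  pose F n := dot (a + (z n).1.2) (b + (z n).1.1) - dot ((z n).1.1 + (z n).1.2)
    ((z n).1.1 + (z n).1.2)
     + 2^-1 ^+ n * (1 + (dot (a - (z n).1.1) (a - (z n).1.1) +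
       dot (b - (z n).1.2) (b - (z n).1.2)) / 2).
  apply: (@cvg_ge0 F).
    rewrite -[X in _ --> X]addr0 -(mul0r (1 +
      (dot (a - x) (a - x) + dot (b - y) (b - y)) / 2)).
    apply: cvgD; first by apply: cvgB; apply: cvg_dot; apply: cvgD => //; exact: cvg_cst.
    apply: cvgM; first exact: half_expn_cvg0.
    apply: cvgD; first exact: cvg_cst.
    apply: cvgM; last exact: cvg_cst.
    by apply: cvgD; apply: cvg_dot; apply: cvgB => //; exact: cvg_cst.
  move=> n; rewrite /F.
  have l0 := half_expn_gt0 n.
  have l1 : 2^-1 ^+ n <= 1 :> R by rewrite exprn_ile1// invf_le1// ler1n.
  (* The competitor moves from [z n] towards [(a, b, dot a b)] by [2^-1 ^+ n]. The tolerance of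
     [z n] is the square of this step, so it still vanishes after division by the step. *)
  pose w := ((1 - 2^-1 ^+ n) *: (z n).1.1 + 2^-1 ^+ n *: a,
      (1 - 2^-1 ^+ n) *: (z n).1.2 + 2^-1 ^+ n *: b,
      (1 - 2^-1 ^+ n) * (z n).2 + 2^-1 ^+ n * dot a b).
  have := phiz n w; rewrite {}/w.
  have Cab : C 0%N (a, b, dot a b).
    move=> a' b' Aab' /=.
    by have := mA.1 _ _ _ _ Aab Aab'; rewrite !dotE (dotC dot b a) (dotC dot b' a)
      (dotC dot b' a') (dotC dot b a'); lra.
  have Czn := Cz n; have zdot := Cdot _ _ (Cz n); rewrite exprM.
  move: l0 l1 Czn zdot; set l := 2^-1 ^+ n; case: (z n) => [[xn yn] sn] /= l0 l1 Czn zdot.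
  rewrite {1}/phi /=.
  match goal with |- (?P -> _) -> _ => have Cw : P end.
    move=> _ a' b' Aab' /=; have := Czn _ _ Aab'; have := Cab _ _ Aab' => /=.
    rewrite !dotE => h1 h2.
    have := ler_wpM2l (ltW l0) h1; have := ler_wpM2l _ h2 => /(_ (1 - l)).
    by rewrite subr_ge0 => /(_ l1); lra.
  rewrite /phi /= !dotE ?(dotC dot b a) ?(dotC dot a xn) ?(dotC dot b xn) ?(dotC dot b yn)
    ?(dotC dot yn xn) ?(dotC dot yn a) => /(_ Cw) h.
  rewrite -(ler_pM2l l0) mulr0.
  have h' := ler_wpM2l (ltW l0) zdot.
  nra.
(* By [key] the pair [(- y, - x)] is monotonically related to the graph. Testing [key] at this very
   pair annihilates [a + y] and leaves [x + y = 0]. *)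
have Ayx : A (- y) (- x).
  apply: maximal_monotoneP => // a b /key; have := dot_ge0 dot (x + y).
  rewrite !dotE (dotC _ y b) (dotC _ y x) (dotC _ x a) (dotC _ b a). lra.
have := key _ _ Ayx; rewrite addNr dot0l => h.
have /eqP : x + y == 0.
  by rewrite -normr_eq0 -sqrf_eq0 (normsq hdot) eq_le h dot_ge0.
move=> /eqP; rewrite addr_eq0 => /eqP xy.
by exists (- y); move: Ayx; rewrite xy.
Qed.

(** The operator [l A - z] is again maximal monotone, and a point where it contains [- x] is the
    resolvent of [l A] at [z]. *)
Lemma resolvent_ex A (l : R) (z : E) : maximal_monotone dot A -> 0 < l ->
  exists x, A x (l^-1 *: (z - x)).
Proof.
move=> mA l0; have l0' : l != 0 by rewrite gt_eqF.
have [] := @maximal_monotone_surj0 (fun x w => A x (l^-1 *: (w + z))).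
  split.
    move=> x y x' y' /mA.1 + /[dup] H => /[apply].
    rewrite -scalerBr dotZl pmulr_rge0 ?invr_gt0//.
    by rewrite opprD addrACA subrr addr0.
  move=> B mB AB x y Bxy.
  apply: (mA.2 (fun x v => B x (l *: v - z))).
  - move=> a b a' b' Bab Bab'; have := mB _ _ _ _ Bab Bab'.
    by rewrite opprB addrA subrK -scalerBr dotZl pmulr_rge0.
  - by move=> a b Aab; apply: AB; rewrite subrK scalerA mulVf// scale1r.
  - by rewrite /= scalerA divff// scale1r addrK.
by move=> x; exists x; rewrite addrC.
Qed.

(** Guarantees that [xget] does not fall back on its default. Convexity and closedness of [A x] come
    from maximality, and a minimising sequence for the squared norm is Cauchy by the parallelogram
    identity. *)
Lemma min_section_in A x : maximal_monotone dot A -> dom A x ->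
  A x (min_section A x).
Proof.
move=> mA [y0 Ay0].
suff [p pp] : exists p, is_proj (A x) 0 p.
  rewrite /min_section; case: xgetP => [q _ []//|/(_ p)].
  by rewrite /= => /(_ pp).
have [] := @minimizing_seq R _ (fun _ => A x) (fun v w => 2^-1 *: (v + w))
  (fun v => dot v v)
  (fun v w => 4^-1 * dot (v - w) (v - w)) 0 (dot y0 y0) (fun n => 2^-1 ^+ (n * 2)).
- by move=> n k _ z.
- by move=> _; exists y0.
- by move=> z _; exact: dot_ge0.
- move=> _ v w Av Aw; apply: maximal_monotoneP => // a b Aab.
  have := mA.1 _ _ _ _ Av Aab; have := mA.1 _ _ _ _ Aw Aab.
  by rewrite !dotE; lra.
- by move=> v w _ _; rewrite !dotE (dotC _ w v); lra.
- by move=> n; exact: half_expn_gt0.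
- by move=> n k nk; apply: half_expn_le; rewrite leq_mul2r nk orbT.
move=> z [Az dz phiz].
have /cvg_ex[p cp] : cvgn z.
  apply: (cauchy_seq_cvg cvg_4half) => n k nk; apply: norm_le_sqrt_expn.
  have := dz _ _ nk; have := half_expn_gt0 (n * 2); lra.
exists p; split.
  by apply: (maximal_monotone_closed mA (cvg_cst x) cp).
move=> q Aq; rewrite !sub0r !normrN -(@ler_pXn2r _ 2%N)// ?nnegrE// !(normsq hdot).
rewrite -subr_ge0.
apply: (@cvg_ge0 (fun n => dot q q - dot (z n) (z n) + 2^-1 ^+ n * 2^-1 ^+ n)).
  rewrite (_ : dot q q - dot p p = dot q q - dot p p + 0 * 0);
    last by rewrite mulr0 addr0.
  apply: cvgD.
    by apply: cvgB; [exact: cvg_cst|exact: cvg_dot].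
  by apply: cvgM; exact: half_expn_cvg0.
by move=> n; have := phiz n q (fun _ => Aq); rewrite -expr2 -exprM; lra.
Qed.

(* The Yosida approximations of A at x increase in norm as l decreases, so they
   converge once they are bounded. *)
Lemma dom_of_yosida_bounded A x (L : R) : maximal_monotone dot A ->
  (forall l z, 0 < l -> A z (l^-1 *: (x - z)) -> `|l^-1 *: (x - z)| <= L) ->
  dom A x.
Proof.
move=> mA HL.
have /choice[z Hz] : forall n, exists z, A z ((2^-1 ^+ n)^-1 *: (x - z)).
  by move=> n; apply: resolvent_ex => //; exact: half_expn_gt0.
pose b n := (2^-1 ^+ n)^-1 *: (x - z n).
have zE n : z n = x - 2^-1 ^+ n *: b n.
  by rewrite /b scalerA divff ?gt_eqF ?half_expn_gt0// scale1r subKr.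
have Ab n : A (z n) (b n) by exact: Hz.
have bL n : `|b n| <= L by apply: HL (Hz n); exact: half_expn_gt0.
have L0 : 0 <= L by apply: le_trans (bL 0%N).
(* With [l] and [m] the parameters of [b n] and [b k], write [l b n - m b k = (l - m) b n + m (b n -
   b k)] in the monotonicity inequality. It yields [dot (b n - b k) (b n) <= 0], which is the claim
   once the square is expanded. *)
have key n k : (n < k)%N -> dot (b n - b k) (b n - b k) <=
  dot (b k) (b k) - dot (b n) (b n).
  move=> nk; have := mA.1 _ _ _ _ (Ab n) (Ab k).
  have : 2^-1 ^+ k < 2^-1 ^+ n :> R.
    by rewrite ltr_iXn2l// ?invr_gt0// invf_lt1// ltr1n.
  have := half_expn_gt0 n; have := half_expn_gt0 k.
  rewrite (zE n) (zE k); move: (2^-1 ^+ n) (2^-1 ^+ k) (b n) (b k) => l m bn bk m0 l0 lm.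
  rewrite !dotE (dotC _ bk bn) => h.
  have : 0 <= dot (bn - bk) (bn - bk) by exact: dot_ge0.
  rewrite !dotE (dotC _ bk bn) => h2.
  have lm0 : 0 < l - m by lra.
  rewrite -(ler_pM2l lm0).
  nra.
have b2 n : dot (b n) (b n) <= L ^+ 2.
  by rewrite -(normsq hdot) ler_pXn2r// nnegrE.
have nd : nondecreasing_seq (fun n => dot (b n) (b n)).
  move=> n k; rewrite leq_eqVlt => /predU1P[->//|/key].
  by have := dot_ge0 dot (b n - b k); lra.
have [l bl] : exists l : R, dot (b n) (b n) @[n --> \oo] --> l.
  exists (sup (range (fun n => dot (b n) (b n)))); apply: nondecreasing_cvgn => //.
  by exists (L ^+ 2) => _ [n _ <-].
have lb n : dot (b n) (b n) <= l.
  by rewrite -(cvg_lim _ bl)//; apply: nondecreasing_cvgn_le => //; apply/cvg_ex;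
    exists l.
have /cvg_ex[y cy] : cvgn b.
  apply: (@cauchy_seq_cvg _ _ _ (fun n => Num.sqrt (l - dot (b n) (b n)))).
    rewrite -[X in _ --> X](@sqrtr0 R) -[X in Num.sqrt X](subrr l).
    apply: continuous_cvg; first exact: sqrt_continuous.
    by apply: cvgB => //; exact: cvg_cst.
  move=> n k; rewrite leq_eqVlt => /predU1P[->|nk].
    by rewrite subrr normr0 sqrtr_ge0.
  rewrite hdot ler_wsqrtr// (le_trans (key _ _ nk))//.
  by rewrite lerB.
have cz : z n @[n --> \oo] --> x.
  rewrite (_ : z = fun n => x - 2^-1 ^+ n *: b n); last by apply/funext => n; exact: zE.
  rewrite -[X in _ --> X]subr0 -(scale0r y); apply: cvgB; first exact: cvg_cst.
  by apply: cvgZ => //; exact: half_expn_cvg0.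
by exists y; apply: (maximal_monotone_closed mA cz cy).
Qed.
End monotone.

(** * Bochner integrals *)

Section simple_map.
Context d (X : measurableType d).

Lemma simple_map_preimage (V : Type) (s : X -> V) (B : set V) :
  simple_map s -> measurable (s @^-1` B).
Proof.
move=> [fs ms]; rewrite (_ : s @^-1` B = \bigcup_(y in range s `&` B) s @^-1` [set y]).
  by apply: fin_bigcup_measurable => //; exact: finite_setIl.
by apply/seteqP; split=> [x Bx|x [y [_ By] /= ->//]]; exists (s x).
Qed.

Lemma simple_map_comp (V W : Type) (s : X -> V) (phi : V -> W) :
  simple_map s -> simple_map (phi \o s).
Proof.
move=> ss; split=> [|y]; last first.
  by rewrite comp_preimage; exact: simple_map_preimage.
by rewrite -(image_comp s phi); apply: finite_image; case: ss.
Qed.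

Lemma simple_map_pair (V W : Type) (s : X -> V) (s' : X -> W) :
  simple_map s -> simple_map s' -> simple_map (fun x => (s x, s' x)).
Proof.
move=> ss ss'; split=> [|[y y']].
  by apply: sub_finite_set (finite_setX ss.1 ss'.1) => _ [x _ <-]; split=> /=; exists x.
rewrite (_ : _ @^-1` _ = s @^-1` [set y] `&` s' @^-1` [set y']).
  by apply: measurableI; [exact: ss.2|exact: ss'.2].
by apply/seteqP; split=> x; [case=> [? ?]; split|case=> [e1 e2]; congr pair].
Qed.

Lemma simple_map_comp2 (V W Z : Type) (phi : V -> W -> Z) (s : X -> V) (s' : X -> W) :
  simple_map s -> simple_map s' -> simple_map (fun x => phi (s x) (s' x)).
Proof.
by move=> ss ss'; exact: (simple_map_comp (fun p => phi p.1 p.2)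
  (simple_map_pair ss ss')).
Qed.

Lemma simple_map_cst (V : Type) (v : V) : simple_map (fun _ : X => v).
Proof.
split=> [|y]; first by apply: sub_finite_set (finite_set1 v) => _ [x _ <-].
by rewrite preimage_cst; case: ifP.
Qed.

Lemma simple_map_set (B : set X) : measurable B -> simple_map (fun x => x \in B).
Proof.
move=> mB; split.
  exact: finite_finset.
move=> [|].
  by rewrite (_ : _ @^-1` _ = B)//; apply/seteqP; split=> x;
    [exact: set_mem|exact: mem_set].
rewrite (_ : _ @^-1` _ = ~` B); first exact: measurableC.
by apply/seteqP; split=> x; [move=> /= h /mem_set; rewrite h|exact: memNset].
Qed.

Context (R : realType).

Lemma simple_map_bounded (s : X -> R) : simple_map s -> exists K, forall x, `|s x| <= K.
Proof.
move=> [fs _].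
have [K [_ HK]] := compact_bounded (finite_compact fs).
by exists (K + 1) => x; apply: (HK (K + 1)); [rewrite ltrDl|exists x].
Qed.

Lemma simple_map_measurable (s : X -> R) D : simple_map s -> measurable_fun D s.
Proof.
by move=> ss mD B mB; apply: measurableI => //; exact: simple_map_preimage.
Qed.

Lemma bounded_integrable (mu : {finite_measure set X -> \bar R}) (s : X -> R) D K :
  measurable D -> measurable_fun D s -> (forall x, D x -> `|s x| <= K) ->
    mu.-integrable D (EFin \o s).
Proof.
move=> mD ms sK; apply: measurable_bounded_integrable => //.
  by rewrite -ge0_fin_numE// fin_num_measure.
exists K; split; rewrite ?num_real// => M KM x Dx.
exact: le_trans (sK x Dx) (ltW KM).
Qed.

Lemma simple_map_integrable (mu : {finite_measure set X -> \bar R}) (s : X -> R) D :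
  measurable D -> simple_map s -> mu.-integrable D (EFin \o s).
Proof.
move=> mD ss; have [K sK] := simple_map_bounded ss.
by apply: (@bounded_integrable _ _ _ K) => //; exact: simple_map_measurable.
Qed.

Lemma Rintegral_simple_map (mu : {finite_measure set X -> \bar R}) (V : choiceType)
  (s : X -> V) (phi : V -> R) D : measurable D -> simple_map s ->
  \int[mu]_(x in D) phi (s x) =
    \sum_(y \in range s) fine (mu (D `&` s @^-1` [set y])) * phi y.
Proof.
move=> mD ss; have fs : finite_set (range s) by case: ss.
rewrite fsbig_finite//=.
have DE : D = D `&` s @^-1` [set` (enum_fset (fset_set (range s)))].
  apply/seteqP; split=> [x Dx|x []//]; split=> //=.
  by rewrite in_fset_set//; apply: mem_set; exists x.
rewrite {1}DE {DE}.
have : uniq (enum_fset (fset_set (range s))) by exact: fset_uniq.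
have mp B : measurable (D `&` s @^-1` B).
  by apply: measurableI => //; exact: simple_map_preimage.
elim: (enum_fset (fset_set (range s))) => [_|y l IH /= /andP[yl ul]].
  rewrite big_nil (_ : _ `&` _ = set0) ?Rintegral_set0//.
  by apply/seteqP; split=> x // [].
rewrite big_cons (_ : D `&` s @^-1` _ = (D `&` s @^-1` [set y]) `|`
  (D `&` s @^-1` [set` l])); last first.
  apply/seteqP; split=> x /=.
    by rewrite inE => -[Dx /orP[/eqP|]]; [left|right].
  by rewrite inE => -[[Dx ->]|[Dx ->]]; rewrite ?eqxx ?orbT.
rewrite Rintegral_setU//; last 2 first.
- by apply: simple_map_integrable; [exact: measurableU|exact: simple_map_comp].
- apply/disj_setPS => x [] [_ /= ->] [_] yl'; by rewrite yl' in yl.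
congr (_ + _).
  rewrite (@eq_Rintegral _ _ _ _ _ (fun=> phi y)); last first.
    by move=> x /set_mem[_ ->].
  by rewrite Rintegral_cst// mulrC.
exact: IH.
Qed.
End simple_map.

Section lower_integral.
Context d (X : measurableType d) (R : realType) (mu : {measure set X -> \bar R}).
Local Open Scope ereal_scope.
Import HBSimple HBNNSimple.

(* The library integral of a nonnegative map is a lower integral, whether or not
   the map is measurable. *)
Lemma ge0_le_lower_integral (f g : X -> \bar R) :
  (forall x, 0 <= f x) -> (forall x, f x <= g x) ->
  \int[mu]_x f x <= \int[mu]_x g x.
Proof.
move=> f0 fg; rewrite !ge0_integralTE//; last first.
  by move=> x; exact: le_trans (fg x).
by apply: le_ereal_sup => _ [h hf <-]; exists h => // x; exact: le_trans (fg x).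
Qed.

(** Only [g] is measurable: this is what allows a strongly measurable map to be changed on a null
    set. Each simple minorant of [f] is compared with [g] almost everywhere; conversely [N] is
    removed from the integral of [g], after which monotonicity of the lower integral applies. *)
Lemma ae_eq_lower_integral (D N : set X) (f g : X -> \bar R) :
  measurable D -> measurable N -> mu N = 0 ->
  (forall x, 0 <= f x) -> (forall x, 0 <= g x) -> measurable_fun setT g ->
  (forall x, D x -> ~ N x -> f x = g x) ->
  \int[mu]_(x in D) f x = \int[mu]_(x in D) g x.
Proof.
move=> mD mN N0 f0 g0 mg fg; rewrite (integral_mkcond D f) (integral_mkcond D g).
have mgD : measurable_fun setT (g \_ D).
  by apply/(measurable_restrictT _ _).1 => //; exact: measurable_funS mg.
have fD0 x : 0 <= (f \_ D) x by apply: erestrict_ge0.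
have gD0 x : 0 <= (g \_ D) x by apply: erestrict_ge0.
have fgD x : ~ N x -> (f \_ D) x = (g \_ D) x.
  by move=> Nx; rewrite /patch; case: ifPn => // /set_mem Dx; exact: fg.
apply/eqP; rewrite eq_le; apply/andP; split.
  rewrite [leLHS]ge0_integralTE//; apply: ub_ereal_sup => _ [h hf <-].
  rewrite -integralT_nnsfun; apply: ae_ge0_le_integral => //.
  - by move=> x _; rewrite lee_fin.
  - exact/measurable_EFinP.
  - exists N; split=> // x /= hx; apply: contrapT => Nx; apply: hx => _.
    by rewrite -fgD.
rewrite (ge0_negligible_integral mN)// integral_mkcond.
apply: ge0_le_lower_integral => x; first exact: erestrict_ge0.
by rewrite {1}/patch; case: ifPn => // /set_mem[_ Nx]; rewrite fgD.
Qed.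

End lower_integral.

Section bochner.
Context d (X : measurableType d) (R : realType) (E : completeNormedModType R)
  (dot : {dot E for idfun}) (hdot : norm_of_dot dot)
  (mu : {finite_measure set X -> \bar R}).

(** Identities between vector integrals are tested against every [e], which reduces them to
    identities between real integrals. *)
Lemma dot_inj (x y : E) : (forall e, dot x e = dot y e) -> x = y.
Proof.
move=> xy; apply/eqP; rewrite -subr_eq0 -normr_eq0 -sqrf_eq0 (normsq hdot).
by rewrite dotBl xy subrr.
Qed.

Lemma dot_simple_integral D (s : X -> E) e : measurable D -> simple_map s ->
  dot (simple_integral mu D s) e = \int[mu]_(x in D) dot (s x) e.
Proof.
move=> mD ss; rewrite (Rintegral_simple_map mu (dot^~ e))// /simple_integral.
have fs : finite_set (range s) by case: ss.
rewrite !fsbig_finite//= (big_morph (dot^~ e) (id1 := 0) (op1 := +%R)).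
- by apply: eq_bigr => y _; rewrite dotZl.
- by move=> y z; rewrite dotDl.
- by rewrite dot0l.
Qed.

Lemma simple_integral_lin D (s s' : X -> E) a b : measurable D ->
  simple_map s -> simple_map s' ->
  simple_integral mu D (fun x => a *: s x + b *: s' x) =
  a *: simple_integral mu D s + b *: simple_integral mu D s'.
Proof.
move=> mD ss ss'; apply: dot_inj => e; rewrite dotDl !dotZl.
rewrite !dot_simple_integral//; last first.
  exact: (simple_map_comp2 (fun u v => a *: u + b *: v)).
have i1 : mu.-integrable D (EFin \o (fun x => dot (s x) e)).
  by apply: simple_map_integrable => //; exact: (simple_map_comp (dot^~ e)).
have i2 : mu.-integrable D (EFin \o (fun x => dot (s' x) e)).
  by apply: simple_map_integrable => //; exact: (simple_map_comp (dot^~ e)).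
rewrite -!RintegralZl// -RintegralD//; last 2 first.
- by apply: simple_map_integrable => //; exact: (simple_map_comp (fun y => a * dot y e)).
- by apply: simple_map_integrable => //; exact: (simple_map_comp (fun y => b * dot y e)).
by apply: eq_Rintegral => x _; rewrite dotDl !dotZl.
Qed.

Lemma simple_integralB D (s s' : X -> E) : measurable D ->
  simple_map s -> simple_map s' ->
  simple_integral mu D (fun x => s x - s' x) =
  simple_integral mu D s - simple_integral mu D s'.
Proof.
move=> mD ss ss'; rewrite -[simple_integral mu D s]scale1r -scaleN1r.
rewrite -simple_integral_lin//; congr simple_integral; apply/funext => x.
by rewrite scale1r scaleN1r.
Qed.

(** Testing the integral [v] against itself gives [|v|^2], the integral of [dot (s x) v], which is
    at most [|v|] times that of [|s x|]. *)
Lemma simple_integral_le D (s : X -> E) : measurable D -> simple_map s ->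
  `|simple_integral mu D s| <= \int[mu]_(x in D) `|s x|.
Proof.
move=> mD ss; set v := simple_integral mu D s.
have [->|v0] := eqVneq v 0; first by rewrite normr0 Rintegral_ge0.
have v0' : 0 < `|v| by rewrite normr_gt0.
rewrite -(ler_pM2l v0') -expr2 (normsq hdot) dot_simple_integral// -RintegralZl//;
  last first.
  by apply: simple_map_integrable => //; exact: (simple_map_comp (fun y => `|y|)).
apply: le_Rintegral => //.
- by apply: simple_map_integrable => //; exact: (simple_map_comp (dot^~ v)).
- by apply: simple_map_integrable => //; exact: (simple_map_comp (fun y => `|v| * `|y|)).
- by move=> x _; rewrite mulrC; exact: dot_le.
Qed.

Lemma simple_integral_setU A B (s : X -> E) : measurable A -> measurable B ->
  simple_map s -> [disjoint A & B] ->
  simple_integral mu (A `|` B) s = simple_integral mu A s + simple_integral mu B s.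
Proof.
move=> mA mB ss AB; apply: dot_inj => e; rewrite dotDl !dot_simple_integral//; last first.
  exact: measurableU.
rewrite Rintegral_setU//; apply: simple_map_integrable; first exact: measurableU.
exact: (simple_map_comp (dot^~ e)).
Qed.

Lemma simple_integral_cst_on D (s : X -> E) v : measurable D -> simple_map s ->
  (forall x, D x -> s x = v) -> simple_integral mu D s = fine (mu D) *: v.
Proof.
move=> mD ss sv; apply: dot_inj => e; rewrite dot_simple_integral// dotZl mulrC.
rewrite -Rintegral_cst//; apply: eq_Rintegral => x /set_mem Dx.
by rewrite sv.
Qed.

Lemma simple_integral_le_cst D (s : X -> E) K : measurable D -> simple_map s ->
  (forall x, D x -> `|s x| <= K) -> `|simple_integral mu D s| <= K * fine (mu D).
Proof.
move=> mD ss sK; rewrite (le_trans (simple_integral_le mD ss))// -Rintegral_cst//.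
apply: le_Rintegral => //.
  by apply: simple_map_integrable => //; exact: (simple_map_comp (fun y => `|y|)).
by apply: simple_map_integrable => //; exact: simple_map_cst.
Qed.

(** Convergence is required everywhere, unlike in [strongly_measurable], so that norms of such maps
    are measurable without completing the measure. *)
Definition limit_map (V : normedModType R) (g : X -> V) : Prop :=
  exists s : nat -> X -> V, (forall n, simple_map (s n)) /\
    forall x, s n x @[n --> \oo] --> g x.

Lemma limit_map_measurable (g : X -> R) : limit_map g -> measurable_fun setT g.
Proof.
move=> [s [ss sg]]; apply: (measurable_fun_cvg (h := s)) => // n.
exact: simple_map_measurable.
Qed.

Lemma limit_map_simple (V : normedModType R) (s : X -> V) : simple_map s -> limit_map s.
Proof. by move=> ss; exists (fun=> s); split=> // x; exact: cvg_cst. Qed.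

Lemma limit_map_norm (V : normedModType R) (g : X -> V) : limit_map g ->
  limit_map (fun x => `|g x|).
Proof.
move=> [s [ss sg]]; exists (fun n x => `|s n x|); split=> [n|x].
  exact: (simple_map_comp (fun y => `|y|)).
exact: cvg_norm.
Qed.

Lemma limit_mapB (V : normedModType R) (g h : X -> V) : limit_map g -> limit_map h ->
  limit_map (fun x => g x - h x).
Proof.
move=> [s [ss sg]] [s' [ss' sh]]; exists (fun n x => s n x - s' n x); split=> [n|x].
  exact: (simple_map_comp2 (fun u v => u - v)).
exact: cvgB.
Qed.

Lemma limit_map_rep (D : set X) (V : normedModType R) (g : X -> V) (s : nat -> X -> V) :
  measurable D -> (forall n, simple_map (s n)) ->
  {ae mu, forall x, D x -> s n x @[n --> \oo] --> g x} ->
  exists N, [/\ measurable N, mu N = 0%E & exists g', [/\ limit_map g',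
    forall x, D x -> ~ N x -> s n x @[n --> \oo] --> g x &
    forall x, D x -> ~ N x -> g x = g' x]].
Proof.
move=> mD ss [N [mN N0 DN]]; exists N; split=> //.
have cvN x : D x -> ~ N x -> s n x @[n --> \oo] --> g x.
  by move=> Dx Nx; apply: contrapT => h; apply: Nx; apply: DN => /= /(_ Dx).
exists (fun x => if x \in D `\` N then g x else 0); split=> //.
  exists (fun n x => if x \in D `\` N then s n x else 0); split=> [n|x].
    apply: (simple_map_comp2 (fun (b : bool) v => if b then v else 0) _ (ss n)).
    by apply: simple_map_set; exact: measurableD.
  by case: ifPn => [/set_mem[Dx Nx]|_]; [exact: cvN|exact: cvg_cst].
by move=> x Dx Nx; rewrite mem_set.
Qed.

End bochner.

Lemma cauchy_seq_cvg2 (R : realType) (E : completeNormedModType R)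
    (u : nat -> E) (a : nat -> R) :
  a n @[n --> \oo] --> (0 : R) ->
  (forall n k, `|u n - u k| <= a n + a k) -> cvgn u.
Proof.
move=> a0 ua; apply/cauchy_cvgP/cauchy_exP => eps eps0.
have e2 : 0 < eps / 2 by rewrite divr_gt0.
have /cvgrPdist_lt/(_ _ e2)[N _ HN] := a0.
exists (u N), N => // k /= Nk; rewrite -ball_normE/=.
apply: le_lt_trans (ua _ _) _.
have := HN N (leqnn N); have := HN k Nk; rewrite /= !sub0r !normrN => h1 h2.
by have := ler_norm (a N); have := ler_norm (a k); lra.
Qed.

Section bochner2.
Context d (X : measurableType d) (R : realType) (E : completeNormedModType R)
  (dot : {dot E for idfun}) (hdot : norm_of_dot dot)
  (mu : {finite_measure set X -> \bar R}).
Implicit Types (D : set X) (g : X -> E) (s : X -> E).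

Lemma strongly_measurable_rep D g : measurable D -> strongly_measurable mu D g ->
  exists N, [/\ measurable N, mu N = 0%E & exists2 g', limit_map g' &
    forall x, D x -> ~ N x -> g x = g' x].
Proof.
move=> mD [s [ss sg]]; have [N [mN N0 [g' [lg' _ gg']]]] := limit_map_rep mD ss sg.
by exists N; split=> //; exists g'.
Qed.

Lemma measurable_norm_sub g s : limit_map g -> simple_map s ->
  measurable_fun setT (fun x => (`|g x - s x|)%:E).
Proof.
move=> lg ss; apply/measurable_EFinP; apply: limit_map_measurable.
by apply: limit_map_norm; apply: limit_mapB => //; exact: limit_map_simple.
Qed.

(** The triangle inequality through [g], first replaced by a limit map because additivity of the
    integral needs measurable integrands. It yields both uniqueness of the Bochner integral and
    Cauchy estimates for approximating integrals. *)
Lemma simple_integral_dist D g s s' : measurable D -> strongly_measurable mu D g ->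
  simple_map s -> simple_map s' ->
  ((`|simple_integral mu D s - simple_integral mu D s'|)%:E <=
   \int[mu]_(x in D) (`|g x - s x|)%:E + \int[mu]_(x in D) (`|g x - s' x|)%:E)%E.
Proof.
move=> mD /(strongly_measurable_rep mD)[N [mN N0 [g' lg' gg']]] ss ss'.
have rep t : simple_map t ->
    (\int[mu]_(x in D) (`|g x - t x|)%:E = \int[mu]_(x in D) (`|g' x - t x|)%:E)%E.
  move=> st; apply: (ae_eq_lower_integral mD mN) => //.
  - exact: measurable_norm_sub.
  - by move=> x Dx Nx; rewrite gg'.
rewrite !rep// -(simple_integralB hdot)//.
have sss : simple_map (fun x => s x - s' x) by exact:
  (simple_map_comp2 (fun u v => u - v)).
have m t : simple_map t -> measurable_fun D (fun x => (`|g' x - t x|)%:E).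
  by move=> st; apply: (measurable_funS measurableT) => //; exact: measurable_norm_sub.
rewrite -ge0_integralD//; [|exact: m|exact: m].
apply: (@le_trans _ _ (\int[mu]_(x in D) (`|s x - s' x|)%:E)%E).
  apply: (@le_trans _ _ (\int[mu]_(x in D) `|s x - s' x|)%:E).
    by rewrite lee_fin; exact: (simple_integral_le hdot).
  rewrite /Rintegral fineK//; apply: integrable_fin_num => //.
  by apply: simple_map_integrable => //; exact: (simple_map_comp (fun y => `|y|) sss).
apply: ge0_le_integral => //.
- by apply/measurable_EFinP/simple_map_measurable;
  exact: (simple_map_comp (fun y => `|y|) sss).
- by apply: emeasurable_funD; exact: m.
- move=> x _; rewrite -EFinD lee_fin.
  have -> : s x - s' x = (s x - g' x) + (g' x - s' x) by rewrite addrA subrK.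
  by rewrite (le_trans (ler_normD _ _))// distrC.
Qed.

Lemma bochner_unique D g v v' : measurable D ->
  is_bochner_integral mu D g v -> is_bochner_integral mu D g v' -> v = v'.
Proof.
move=> mD [sg [s [ss s0 sv]]] [_ [s' [ss' s'0 sv']]].
apply/eqP; rewrite -subr_eq0 -normr_eq0 eq_le normr_ge0 andbT.
have h : (`|simple_integral mu D (s n) - simple_integral mu D (s' n)|)%:E @[n --> \oo] -->
  (`|v - v'|)%:E.
  apply: cvg_EFin; first by near=> n.
  by apply: cvg_norm; exact: cvgB.
suff : ((`|v - v'|)%:E <= 0)%E by rewrite lee_fin.
have := cvgeD _ s0 s'0; rewrite adde0 => /(_ _ isT) h0.
rewrite -(cvg_lim _ h)// -[leRHS](cvg_lim _ h0)//.
apply: lee_lim.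
- by apply/cvg_ex; eexists; exact: h.
- by apply/cvg_ex; eexists; exact: h0.
near=> n; apply: simple_integral_dist => //; [exact: (ss n).1|exact: (ss' n).1].
Unshelve. all: by end_near. Qed.

Lemma eq_bochner D g g' v : (forall x, D x -> g x = g' x) ->
  is_bochner_integral mu D g v -> is_bochner_integral mu D g' v.
Proof.
move=> gg' [[s0 [ss0 s0g]] [s [ss s1 sv]]]; split.
  exists s0; split=> //; apply: filterS s0g => x /= h Dx.
  by rewrite -gg'//; exact: h.
exists s; split=> //.
rewrite (_ : (fun n => _) = fun n => (\int[mu]_(x in D) (`|g x - s n x|)%:E)%E)//.
by apply/funext => n; apply: eq_integral => x /set_mem Dx; rewrite gg'.
Qed.

Section bounded_limit.
Context (D : set X) (g : X -> E) (s : nat -> X -> E) (K : R).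
Hypotheses (mD : measurable D) (ss : forall n, simple_map (s n))
  (sK : forall n x, `|s n x| <= K)
  (sg : {ae mu, forall x, D x -> s n x @[n --> \oo] --> g x}).

Lemma bounded_limit_L1 :
  (\int[mu]_(x in D) (`|g x - s n x|)%:E)%E @[n --> \oo] --> 0%E.
Proof.
have [N [mN N0 [g' [lg' sg' gg']]]] := limit_map_rep mD ss sg.
rewrite (_ : (fun n => _) = fun n => (\int[mu]_(x in D) (`|g' x - s n x|)%:E)%E);
  last first.
  apply/funext => n; apply: (ae_eq_lower_integral mD mN) => //.
    exact: measurable_norm_sub.
  by move=> x Dx Nx; rewrite gg'.
have g'K x : D x -> ~ N x -> `|g' x| <= K.
  move=> Dx Nx; have h : `|s n x| @[n --> \oo] --> `|g' x|.
    by rewrite -gg'//; apply: cvg_norm; exact: sg'.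
  rewrite -(cvg_lim _ h)//; apply: limr_le; first by apply/cvg_ex; exists `|g' x|.
  by near=> n.
have [|//||||_ _] := @dominated_convergence _ _ _ mu D mD
    (fun n x => (`|g' x - s n x|)%:E) (cst 0%E) (cst (K + K)%:E).
- by move=> n; apply: (measurable_funS measurableT) => //; exact: measurable_norm_sub.
- exists N; split=> // x /= h; apply: contrapT => Nx; apply: h => Dx.
  apply: cvg_EFin; first by near=> n.
  rewrite -(@normr0 _ E) -(subrr (g' x)); apply: cvg_norm; apply: cvgB;
    first exact: cvg_cst.
  by rewrite -gg'//; exact: sg'.
- by apply: (@bounded_integrable _ _ _ _ (cst (K + K)) _ `|K + K|) => //;
  exact: measurable_cst.
- exists N; split=> // x /= h; apply: contrapT => Nx; apply: h => n Dx.
  rewrite /= lee_fin ger0_norm// (le_trans (ler_normB _ _))// lerD//; exact: g'K.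
by rewrite integral0.
Unshelve. all: by end_near. Qed.

Lemma bounded_limit_bochner v : simple_integral mu D (s n) @[n --> \oo] --> v ->
  is_bochner_integral mu D g v.
Proof.
move=> sv; split; first by exists s.
exists s; split=> //; last exact: bounded_limit_L1.
move=> n; split=> // y _; rewrite -ge0_fin_numE// fin_num_measure//.
apply: measurableI => //; exact: (ss n).2.
Qed.

Lemma bounded_limit_cvg : cvgn (fun n => simple_integral mu D (s n)).
Proof.
have /fine_cvgP[[N _ HN] h] := bounded_limit_L1.
have /cvg_ex[v] : cvgn (fun n => simple_integral mu D (s (n + N)%N)).
  apply: (cauchy_seq_cvg2 (a := fun n => fine
    (\int[mu]_(x in D) (`|g x - s (n + N)%N x|)%:E)%E)).
    by move: h; rewrite -(cvg_shiftn N).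
  move=> n k; rewrite -lee_fin EFinD !fineK; [|exact/HN/leq_addl|exact/HN/leq_addl].
  by apply: simple_integral_dist => //; exists s.
rewrite (cvg_shiftn N (fun n => simple_integral mu D (s n))) => sv.
by apply/cvg_ex; exists v.
Qed.
End bounded_limit.
End bochner2.

(** * Mazur's lemma *)

Section mazur.
Context d (X : measurableType d) (R : realType).

(** Borel-Cantelli: the exceptional points form the limit superior of the sets, and the bounds on
    their measures are summable. *)
Lemma ae_eventually (mu : {measure set X -> \bar R}) (F : nat -> set X) :
  (forall n, measurable (F n)) -> (forall n, (mu (F n) <= (2^-1 ^+ n)%:E)%E) ->
  {ae mu, forall x, exists N, forall n, (N <= n)%N -> ~ F n x}.
Proof.
move=> mF muF; exists (lim_sup_set F); split.
- by apply: bigcap_measurable => // n _; apply: bigcup_measurable.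
- apply: lim_sup_set_cvg0 => //.
  apply: (@le_lt_trans _ _ (\sum_(n <oo) (0 + (2 / (2 ^ n.+1)%:R)%:E))%E).
    apply: lee_nneseries => // n _; rewrite add0e (le_trans (muF n))// lee_fin.
    by rewrite expnS natrM invfM mulrA divff// mul1r natrX exprVn.
  apply: (@le_lt_trans _ _ (\sum_(n <oo) 0 + 2%:E)%E).
    exact: (@epsilon_trick R (fun=> 0%E)).
  by rewrite eseries0// add0e ltry.
- move=> x /= h n _; apply: contrapT => hx; apply: h; exists n => k nk Fkx.
  by apply: hx; exists k.
Qed.

Context (E : completeNormedModType R)
  (dot : {dot E for idfun}) (hdot : norm_of_dot dot)
  (mu : {finite_measure set X -> \bar R}).

(** Midpoints replace general convex combinations: they are all that [minimizing_seq] asks for, and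
    bounds, simplicity and affine inequalities then pass from [g] to the hull by a plain
    induction. *)
Inductive mid_hull (S : set (X -> E)) : (X -> E) -> Prop :=
| mid_hull_sub s : S s -> mid_hull S s
| mid_hull_mid s s' : mid_hull S s -> mid_hull S s' ->
    mid_hull S (fun x => 2^-1 *: (s x + s' x)).

Definition tail (g : nat -> X -> E) n : set (X -> E) :=
  [set s | exists2 j, (n <= j)%N & s = g j].

Lemma mid_hull_tail g n (P : (X -> E) -> Prop) :
  (forall j, (n <= j)%N -> P (g j)) ->
  (forall s s', P s -> P s' -> P (fun x => 2^-1 *: (s x + s' x))) ->
  forall s, mid_hull (tail g n) s -> P s.
Proof. by move=> Pg Pm s; elim=> [_ [j nj ->]|t t' _ Pt _ Pt'];
  [exact: Pg|exact: Pm]. Qed.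

Lemma mid_hull_simple g n s : (forall n, simple_map (g n)) ->
  mid_hull (tail g n) s -> simple_map s.
Proof.
move=> sg; apply: (mid_hull_tail (P := @simple_map _ _ _)) => // t t' st st'.
exact: (simple_map_comp2 (fun u v => 2^-1 *: (u + v))).
Qed.

Lemma mid_hull_bounded g n s K : (forall n x, `|g n x| <= K) ->
  mid_hull (tail g n) s -> forall x, `|s x| <= K.
Proof.
move=> gK; apply: (mid_hull_tail (P := fun s => forall x, `|s x| <= K)) =>
  // t t' st st' x.
rewrite normrZ ger0_norm// ler_pdivrMl// (le_trans (ler_normD _ _))//.
by have := st x; have := st' x; lra.
Qed.

Lemma mid_hull_le g n k : (n <= k)%N -> mid_hull (tail g k) `<=` mid_hull (tail g n).
Proof.
move=> nk; apply: (mid_hull_tail (P := mid_hull (tail g n))) => [j kj|s s'];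
  last exact: mid_hull_mid.
by apply: mid_hull_sub; exists j => //; exact: leq_trans kj.
Qed.

Lemma simple_dot_integrable D (s s' : X -> E) : measurable D -> simple_map s ->
  simple_map s' ->
  mu.-integrable D (EFin \o (fun x => dot (s x) (s' x))).
Proof.
by move=> mD ss ss'; apply: simple_map_integrable => //;
  exact: (simple_map_comp2 (fun u v => dot u v)).
Qed.

Lemma chebyshev_sq (s : X -> E) (a : R) : simple_map s -> 0 < a ->
  a ^+ 2 * fine (mu [set x | a <= `|s x|]) <= \int[mu]_x dot (s x) (s x).
Proof.
move=> ss a0; set B := [set x | _].
have mB : measurable B.
  rewrite (_ : B = s @^-1` [set y | a <= `|y|])//; exact: simple_map_preimage.
rewrite -Rintegral_cst//.
apply: (@le_trans _ _ (\int[mu]_(x in B) dot (s x) (s x))).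
  apply: le_Rintegral => //.
  - by apply: simple_map_integrable => //; exact: simple_map_cst.
  - exact: simple_dot_integrable.
  - by move=> x Bx; rewrite -(normsq hdot) ler_pXn2r// nnegrE// ltW.
rewrite -(setUv B) Rintegral_setU//; last 3 first.
- exact: measurableC.
- by rewrite setUv; exact: simple_dot_integrable.
- by apply/disj_setPS => x [Bx]; apply.
by rewrite lerDl Rintegral_ge0// => x _; exact: dot_ge0.
Qed.

(* The squared L2 norm almost attains its infimum over the hulls of the tails;
   by the parallelogram identity such near minimisers are L2-Cauchy. *)
Lemma mazur (g : nat -> X -> E) K : (forall n, simple_map (g n)) ->
  (forall n x, `|g n x| <= K) ->
  exists c : nat -> X -> E, exists ginf : X -> E,
    (forall n, mid_hull (tail g n) (c n)) /\
    {ae mu, forall x, c n x @[n --> \oo] --> ginf x}.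
Proof.
move=> sg gK.
have intsq (s s' : X -> E) : simple_map s -> simple_map s' ->
    mu.-integrable setT (EFin \o (fun x => dot (s x) (s' x))).
  by move=> ss ss'; exact: simple_dot_integrable.
have simB (s s' : X -> E) : simple_map s -> simple_map s' ->
  simple_map (fun x => s x - s' x).
  by move=> ss ss'; exact: (simple_map_comp2 (fun u v : E => u - v)).
have simM (s s' : X -> E) : simple_map s -> simple_map s' ->
  simple_map (fun x => 2^-1 *: (s x + s' x)).
  by move=> ss ss'; exact: (simple_map_comp2 (fun u v : E => 2^-1 *: (u + v))).
(* With this tolerance, [2 * e n] and the factor [4^-1] bound the squared L2 distance of [c n] and
   [c n.+1] by [(2^-n)^3]. Chebyshev at threshold [2^-n] costs [(2^-n)^2] and leaves the summable
   bound [2^-n] for [F n]. *)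
have [] := @minimizing_seq R _ (fun n => mid_hull (tail g n))
  (fun s s' x => 2^-1 *: (s x + s' x)) (fun s => \int[mu]_x dot (s x) (s x))
  (fun s s' => 4^-1 * \int[mu]_x dot (s x - s' x) (s x - s' x)) 0
  (K ^+ 2 * fine (mu setT)) (fun n => 8^-1 * (2^-1 ^+ n) ^+ 3).
- exact: mid_hull_le.
- move=> n; exists (g n); first by apply: mid_hull_sub; exists n.
  rewrite -Rintegral_cst//; apply: le_Rintegral => //.
  + exact: intsq.
  + by apply: simple_map_integrable => //; exact: simple_map_cst.
  + move=> x _; rewrite -(normsq hdot) ler_pXn2r// nnegrE//.
    exact: le_trans (gK n x).
- by move=> s _; apply: Rintegral_ge0 => x _; exact: dot_ge0.
- by move=> n s s'; exact: mid_hull_mid.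
- move=> s s' /(mid_hull_simple sg) ss /(mid_hull_simple sg) ss'.
  rewrite -RintegralZl//; last by apply: intsq; exact: simB.
  rewrite -RintegralD//; last 2 first.
    by apply: intsq; exact: simM.
    apply: simple_map_integrable => //.
    exact: (simple_map_comp (fun u => 4^-1 * dot u u) (simB _ _ ss ss')).
  rewrite -RintegralD//; [|exact: intsq|exact: intsq].
  rewrite mulrC -RintegralZl//; last first.
    apply: simple_map_integrable => //.
    exact: (simple_map_comp2 (fun u v => dot u u + dot v v)).
  rewrite le_eqVlt; apply/orP; left; apply/eqP; apply: eq_Rintegral => x _.
  by rewrite !dotE (dotC _ (s' x) (s x)); field.
- by move=> n; rewrite mulr_gt0// exprn_gt0// half_expn_gt0.
- by move=> n k nk; rewrite ler_pM2l// -!exprM half_expn_le// leq_mul2r nk orbT.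
move=> c [cg dc _].
have sc n : simple_map (c n) by exact: mid_hull_simple (cg n).
exists c, (fun x => lim (c n x @[n --> \oo])); split=> //.
pose F n := [set x | 2^-1 ^+ n <= `|c n x - c n.+1 x|].
have mF n : measurable (F n).
  rewrite (_ : F n = (fun x => c n x - c n.+1 x) @^-1` [set y | 2^-1 ^+ n <= `|y|])//.
  by apply: simple_map_preimage; exact: simB.
have muF n : (mu (F n) <= (2^-1 ^+ n)%:E)%E.
  rewrite -[mu (F n)]fineK ?fin_num_measure// lee_fin.
  have h0 := half_expn_gt0 R n.
  have := chebyshev_sq (simB _ _ (sc n) (sc n.+1)) h0; have := dc _ _ (leqnSn n).
  rewrite -/(F n) => h1 h2; rewrite -(ler_pM2l (exprn_gt0 2 h0)).
  by move: h1 h2; set z := fine _; move: (2^-1 ^+ n) => y; lra.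
apply: filterS (ae_eventually mF muF) => x [N HN].
(* Outside the sets [F j] consecutive terms differ by less than [2^-j], and these bounds sum to the
   right-hand side. *)
have cN n k : (N <= n)%N -> (n <= k)%N -> `|c n x - c k x| <= 2 * (2^-1 ^+ n - 2^-1 ^+ k).
  move=> Nn; elim: k => [|k IH]; first by rewrite leqn0 => /eqP ->;
    rewrite !subrr normr0 mulr0.
  rewrite leq_eqVlt => /predU1P[->|]; first by rewrite !subrr normr0 mulr0.
  rewrite ltnS => nk; rewrite -(subrK (c k x) (c n x)) -addrA
    (le_trans (ler_normD _ _))//.
  have := IH nk; have /negP := HN _ (leq_trans Nn nk); rewrite /F /= -ltNge => /ltW.
  by rewrite exprS; lra.
have /cvg_ex[l cl] : cvgn (fun n => c (n + N)%N x).
  apply: (@cauchy_seq_cvg _ _ _ (fun n => 2 * 2^-1 ^+ n)).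
    by rewrite -[X in _ --> X](mulr0 2); apply: cvgM;
      [exact: cvg_cst|exact: half_expn_cvg0].
  move=> n k nk; rewrite (le_trans (cN _ _ _ _)) ?leq_addl ?leq_add2r//.
  have := half_expn_gt0 R (k + N); have := @half_expn_le R n (n + N) (leq_addr _ _).
  by move: (2^-1 ^+ _) (2^-1 ^+ _) (2^-1 ^+ _) => a b e; lra.
have cl' : c n x @[n --> \oo] --> l by rewrite -(cvg_shiftn N).
by rewrite (cvg_lim _ cl').
Qed.
End mazur.

(** * Dyadic partitions *)

Lemma itv_oc_split (R : realType) (a b c : R) : a <= b -> b <= c ->
  (`]a, c] = `]a, b] `|` `]b, c])%classic.
Proof.
move=> ab bc; apply/seteqP; split=> x /=; rewrite !in_itv/=.
  by move=> /andP[x0 xk]; have [xk'|xk'] := leP x b; [left; rewrite x0|right].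
move=> [/andP[-> xk]|/andP[kx ->]]; first by rewrite (le_trans xk).
by rewrite (le_lt_trans _ kx).
Qed.

Lemma itv_oc_disjoint (R : realType) (a b c : R) : [disjoint (`]a, b]%classic : set R) &
  `]b, c]%classic].
Proof.
apply/disj_setPS => x [] /=; rewrite !in_itv/= => /andP[_ xb] /andP[/(le_lt_trans xb)].
by rewrite ltxx.
Qed.

Section partition.
Context (R : realType) (T : R) (T0 : 0 < T).

Definition node (n k : nat) : R := T * (k%:R / 2 ^+ n).

(** Cells are open on the left and closed on the right, numbered by their right end, and [0] is
    alone in cell [0]. Clamping sends points outside [[0, T]] to the extreme cells, which makes the
    map simple on the whole line. *)
Definition cell (n : nat) (t : R) : nat := `|Num.ceil (clamp T t / T * 2 ^+ n)|%N.

(** The right end of the cell of [t]; right ends are the points that right continuity of [r] can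
    handle. *)
Definition theta (n : nat) (t : R) : R := node n (cell n t).

Lemma node0 n : node n 0 = 0. Proof. by rewrite /node mul0r mulr0. Qed.

Lemma node_last n : node n (2 ^ n) = T.
Proof. by rewrite /node natrX divff ?mulr1// expf_neq0. Qed.

Lemma nodeS n k : node n k.+1 = node n k + T * 2^-1 ^+ n.
Proof. by rewrite /node -natr1 mulrDl mulrDr mul1r exprVn. Qed.

Lemma node_ltS n k : node n k < node n k.+1.
Proof. by rewrite nodeS ltrDl mulr_gt0// half_expn_gt0. Qed.

Lemma node_le n k l : (k <= l)%N -> node n k <= node n l.
Proof. by move=> kl; rewrite /node ler_pM2l// ler_pM2r ?invr_gt0 ?exprn_gt0// ler_nat.
  Qed.

Lemma node_ge0 n k : 0 <= node n k.
Proof. by rewrite -(node0 n) node_le. Qed.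

Lemma node_leT n k : (k <= 2 ^ n)%N -> node n k <= T.
Proof. by move=> ?; rewrite -(node_last n) node_le. Qed.

Lemma node_refine m n k : (m <= n)%N -> node m k = node n (k * 2 ^ (n - m)).
Proof.
move=> mn; rewrite /node -{2}(subnK mn) natrM natrX exprD; congr (_ * _).
by rewrite invfM mulrA mulfK// expf_neq0.
Qed.

(** The adjunction between [cell] and [node], through which the ceiling is never unfolded again. *)
Lemma cell_le n t k : (cell n t <= k)%N = (clamp T t <= node n k).
Proof.
have /andP[c0 _] := clamp_itv t T0.
have c0' : 0 <= clamp T t / T * 2 ^+ n by rewrite mulr_ge0 ?exprn_ge0 ?divr_ge0 ?(ltW T0).
rewrite -lez_nat /cell gez0_abs ?ceil_ge0//; last by rewrite (lt_le_trans _ c0')// ltrN10.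
rewrite ceil_le_int /node /=.
by rewrite -ler_pdivlMr ?exprn_gt0// ler_pdivrMr// mulrC.
Qed.

Lemma cell_mono n s t : s <= t -> (cell n s <= cell n t)%N.
Proof.
by move=> st; rewrite cell_le (le_trans (clamp_le _ st))// -cell_le.
Qed.

Lemma cell_max n t : (cell n t <= 2 ^ n)%N.
Proof. by rewrite cell_le node_last; have /andP[] := clamp_itv t T0. Qed.

Lemma cell0 n : cell n 0 = 0%N.
Proof. by apply/eqP; rewrite -leqn0 cell_le clamp_id ?lexx ?(ltW T0)// node_ge0. Qed.

Lemma cell_node n k : (k <= 2 ^ n)%N -> cell n (node n k) = k.
Proof.
move=> kn; apply/eqP; rewrite eqn_leq cell_le clamp_id ?node_ge0 ?node_leT// lexx/=.
case: k kn => // k kn.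
by rewrite ltnNge cell_le clamp_id ?node_ge0 ?node_leT// -ltNge node_ltS.
Qed.

Lemma cellP n t k : 0 <= t <= T -> (cell n t == k.+1) = (node n k < t <= node n k.+1).
Proof.
by move=> tT; rewrite eqn_leq cell_le clamp_id// andbC ltnNge cell_le clamp_id// -ltNge.
Qed.

Lemma cell_eq0 n t : 0 <= t <= T -> (cell n t == 0%N) = (t == 0).
Proof.
by move=> /andP[t0 tT]; rewrite -leqn0 cell_le clamp_id ?t0// node0 eq_le t0 andbT.
Qed.

Lemma theta_ge n t : 0 <= t <= T -> t <= theta n t.
Proof. by move=> tT; rewrite -{1}(clamp_id tT) -cell_le. Qed.

Lemma theta_itv n t : 0 <= theta n t <= T.
Proof. by rewrite node_ge0 node_leT// cell_max. Qed.

Lemma theta_le n t : 0 <= t <= T -> theta n t <= t + T * 2^-1 ^+ n.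
Proof.
move=> tT; rewrite /theta; case E : (cell n t) => [|k].
  rewrite node0; case/andP: tT => t0 _.
  by rewrite addr_ge0// mulr_ge0 ?ltW// half_expn_gt0.
by move/eqP: E; rewrite cellP// nodeS => /andP[/ltW ? _]; rewrite lerD2r.
Qed.

Lemma theta_refine m n t : (m <= n)%N -> theta n (theta m t) = theta m t.
Proof.
move=> mn; rewrite /theta (node_refine _ mn) cell_node//.
by rewrite -[X in (_ <= 2 ^ X)%N](subnKC mn) expnD leq_mul2r cell_max orbT.
Qed.

Lemma thetaT n : theta n T = T.
Proof. by apply/eqP; rewrite eq_le theta_ge ?lexx ?(ltW T0)// andbT;
  have /andP[] := theta_itv n T. Qed.

(** The nodes [theta n t] approach [t] from the right, possibly with equality, so one-sided
    continuity is enough; at [T], where nothing is assumed, the sequence is constant. *)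
Lemma cvg_theta (V : normedModType R) (phi : R -> V) t :
  (forall t, 0 <= t < T -> phi s @[s --> t^'+] --> phi t) ->
  0 <= t <= T -> phi (theta n t) @[n --> \oo] --> phi t.
Proof.
move=> rc /andP[t0]; rewrite le_eqVlt => /predU1P[->|tT].
  by under eq_fun do rewrite thetaT; exact: cvg_cst.
have tT' : 0 <= t <= T by rewrite t0 ltW.
apply/cvgrPdist_lt => e e0.
have /cvgrPdist_lt/(_ _ e0) : phi s @[s --> t^'+] --> phi t by apply: rc; rewrite t0.
rewrite near_withinE => /nbhs_ballP[dl /= dl0 Hd].
have : T * 2^-1 ^+ n @[n --> \oo] --> (0 : R).
  by rewrite -[X in _ --> X](mulr0 T); apply: cvgM;
    [exact: cvg_cst|exact: half_expn_cvg0].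
move=> /cvgrPdist_lt/(_ _ dl0); apply: filterS => n; rewrite sub0r normrN => hn.
have := theta_ge n tT'; rewrite le_eqVlt => /predU1P[<-|tn];
  first by rewrite subrr normr0.
apply: Hd => //; rewrite /ball/= ltr0_norm ?subr_lt0// opprB.
by apply: le_lt_trans hn; rewrite lerBlDl (le_trans (theta_le n tT'))// lerD2l ler_norm.
Qed.

Lemma cell_simple n : simple_map (cell n : measurableTypeR R -> nat).
Proof.
split.
  apply: (@sub_finite_set _ _ `I_(2 ^ n).+1) => [_ [t _ <-]|]; last exact: finite_II.
  by rewrite /= ltnS cell_max.
have m k : measurable [set t : measurableTypeR R | (cell n t <= k)%N].
  have [kn|kn] := leqP k (2 ^ n); last first.
    rewrite (_ : [set _ | _] = setT)//; apply/seteqP; split=> // t _ /=.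
    exact: leq_trans (cell_max n t) (ltnW kn).
  (* The last cell also collects the points beyond [T], so for the last index the sublevel set is
     the whole line and not a ray. *)
  have [->|kn'] := eqVneq k (2 ^ n)%N.
    by rewrite (_ : [set _ | _] = setT)//; apply/seteqP; split=> // t _ /=;
      exact: cell_max.
  rewrite (_ : [set _ | _] = `]-oo, node n k]%classic); first exact: measurable_itv.
  apply/seteqP; split=> t /=; rewrite cell_le in_itv/=.
    rewrite /clamp ge_max => /andP[_]; rewrite ge_min => /orP[//|Tk].
    move: kn'; rewrite -{1}[k](cell_node kn) (_ : node n k = T) ?node_leT//.
      by rewrite -{1}(node_last n) cell_node// eqxx.
    by apply/eqP; rewrite eq_le Tk node_leT.
  by move=> tk; rewrite /clamp ge_max node_ge0/= ge_min tk.
move=> [|k].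
  rewrite (_ : _ @^-1` _ = [set t | (cell n t <= 0)%N]); first exact: m.
  by apply/seteqP; split=> t /=; rewrite leqn0 => /eqP.
rewrite (_ : _ @^-1` _ = [set t | (cell n t <= k.+1)%N] `\` [set t | (cell n t <= k)%N]).
  by apply: measurableD; exact: m.
apply/seteqP; split=> t /=; first by move=> ->; rewrite leqnn ltnn.
by case=> h1 /negP h2; apply/eqP; rewrite eqn_leq h1 ltnNge.
Qed.

End partition.

(** * The measure nu *)

Lemma measure0_of_integral_le0 d (X : measurableType d) (R : realType)
    (mu : {measure set X -> \bar R}) (B : set X) (f : X -> \bar R) :
  measurable B -> measurable_fun B f -> (forall x, B x -> 0 < f x)%E ->
  (\int[mu]_(x in B) f x <= 0)%E -> mu B = 0%E.
Proof.
move=> mB mf f0 If.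
have /(ae_eq_integral_abs mu mB mf) [N [mN N0 BN]] :
    (\int[mu]_(x in B) `|f x| = 0)%E.
  apply/eqP; rewrite eq_le integral_ge0// andbT (le_trans _ If)//.
  rewrite le_eqVlt; apply/orP; left; apply/eqP; apply: eq_integral => x /set_mem Bx.
  by rewrite gee0_abs// ltW// f0.
apply/eqP; rewrite eq_le measure_ge0 andbT -N0; apply: le_measure; rewrite ?inE// => x Bx.
by apply: BN => /= /(_ Bx) fx; have := f0 x Bx; rewrite fx ltxx.
Qed.

(** The distribution function of [nu]: on [[0, T]] its increments are the [nu]-measures of the
    intervals []s, t]]. *)
Definition mass (R : realType) (r : R -> R) (s : R) := s + r s.

Section nu.
Context (R : realType) (T : R) (T0 : 0 < T) (r : R -> R) (hr : stieltjes_function T r).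
Notation nu := (nu_I T0 hr).
Notation p := (density_lambda T0 hr).

Lemma lambda_I_itv (s t : R) :
  0 <= s -> s <= t -> t <= T -> lambda_I T `]s, t] = (t - s)%:E.
Proof.
move=> s0 st tT; rewrite /lambda_I /mfrestr /mrestr setIidl; last first.
  by apply: subset_itv; rewrite bnd_simp.
rewrite /lebesgue_stieltjes_measure /measure_extension measurable_mu_extE/=.
  by rewrite wlength_itv_bnd.
exact: is_ocitv.
Qed.

Lemma nu_I_mass (s t : R) : 0 <= s -> s <= t -> t <= T ->
  fine (nu `]s, t]) = mass r t - mass r s.
Proof.
move=> s0 st tT.
have h1 : lambda_I T `]s, t] = (t - s)%:E by exact: lambda_I_itv.
have h2 : dr_I T0 hr `]s, t] = (r t - r s)%:E by exact: dr_I_itv.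
transitivity (fine (lambda_I T `]s, t] + dr_I T0 hr `]s, t])%E).
  by congr fine; exact: measure_addE.
by rewrite h1 h2 /= /mass; ring.
Qed.

Lemma mass_le s t : 0 <= s -> s <= t -> t <= T -> mass r s <= mass r t.
Proof. by move=> s0 st tT; have [_ _ rm _] := hr; rewrite lerD// rm. Qed.

Lemma mass_right_continuous t : 0 <= t < T -> mass r s @[s --> t^'+] --> mass r t.
Proof.
have [_ _ _ rc] := hr => tT; apply: cvgD; last exact: rc.
by apply: cvg_at_right_filter; exact: cvg_id.
Qed.

Lemma mass_theta a : 0 <= a <= T -> mass r (theta T n a) @[n --> \oo] --> mass r a.
Proof. exact: (cvg_theta T0 mass_right_continuous). Qed.

Lemma nu_I_set0 : nu [set 0] = 0%E.
Proof.
rewrite /nu_I measure_addE /= dr_I_set0 adde0; apply/eqP.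
rewrite eq_le measure_ge0 andbT -(lebesgue_measure_set1 (0 : R)).
by rewrite /lambda_I /mfrestr /mrestr; apply: le_measure; rewrite ?inE//;
  exact: measurableI.
Qed.

Lemma nu_I_out (A : set (measurableTypeR R)) : A `<=` ~` `[0, T] -> nu A = 0%E.
Proof.
move=> A0; have AI : A `&` `[0, T] = set0 by apply/seteqP; split=> // t [/A0].
have h1 : lambda_I T A = 0%E by rewrite /lambda_I /mfrestr /mrestr AI measure0.
have h2 : dr_I T0 hr A = 0%E by rewrite /dr_I /mfrestr /mrestr AI measure0.
transitivity (lambda_I T A + dr_I T0 hr A)%E; first exact: measure_addE.
by rewrite h1 h2 adde0.
Qed.

Lemma measurable_density : measurable_fun setT p.
Proof.
rewrite /density_lambda; apply: measurableT_comp => //.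
by apply: (measurable_int nu); apply: Radon_Nikodym_integrable; exact: lambda_dominates.
Qed.

Lemma density_integral (A : set (measurableTypeR R)) : measurable A ->
  (\int[nu]_(t in A) (p t)%:E)%E = lambda_I T A.
Proof.
move=> mA; rewrite -[RHS]/(charge_of_finite_measure (lambda_I T) A).
rewrite (@Radon_Nikodym_integral _ _ _ _ nu)//; last exact: lambda_dominates.
apply: eq_integral => t _; rewrite fineK//.
by apply: Radon_Nikodym_fin_num; exact: lambda_dominates.
Qed.

Lemma density_integrable (A : set (measurableTypeR R)) : measurable A ->
  nu.-integrable A (EFin \o p).
Proof.
move=> mA; apply: (integrableS measurableT) => //.
rewrite (_ : _ \o _ = Radon_Nikodym (charge_of_finite_measure (lambda_I T)) nu).
  by apply: Radon_Nikodym_integrable; exact: lambda_dominates.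
apply/funext => t /=; rewrite fineK//.
by apply: Radon_Nikodym_fin_num; exact: lambda_dominates.
Qed.

Let mp_lt (a : R) : measurable [set t : measurableTypeR R | p t < a].
Proof.
rewrite (_ : [set _ | _] = setT `&` p @^-1` `]-oo, a[%classic).
  exact: measurable_density.
by rewrite setTI; apply/seteqP; split=> t /=; rewrite in_itv.
Qed.

Let mp_gt (a : R) : measurable [set t : measurableTypeR R | a < p t].
Proof.
rewrite (_ : [set _ | _] = setT `&` p @^-1` `]a, +oo[%classic).
  exact: measurable_density.
by rewrite setTI; apply/seteqP; split=> t /=; rewrite in_itv/= andbT.
Qed.

Let mpA (A : set (measurableTypeR R)) : measurable_fun A p.
Proof. exact: (measurable_funS measurableT _ measurable_density). Qed.

Lemma density_ge0 : {ae nu, forall t, 0 <= p t}.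
Proof.
exists [set t : measurableTypeR R | p t < 0]; split=> [//||t /= /negP];
  last by rewrite -ltNge.
apply: (@measure0_of_integral_le0 _ (measurableTypeR R) _ nu _
  (fun t => (cst 0 t)%:E - (p t)%:E)%E) => //.
- apply: emeasurable_funB; first exact/measurable_EFinP/measurable_cst.
  by apply/measurable_EFinP; exact: (@mpA _).
- by move=> t pt; rewrite -EFinB lte_fin subr_gt0.
- rewrite integralB_EFin//; last exact: density_integrable.
    rewrite [X in (X - _)%E]integral0_eq// sub0e oppe_le0 density_integral//.
  by apply: (@bounded_integrable _ _ _ _ (cst 0) _ `|0|);
    [exact: mp_lt|exact: measurable_cst|move=> x _ /=; exact: lexx].
Qed.

(** On the set where [p > 1], the integral of [p - 1] is [lambda - nu], which is not positive. The
    bound keeps [p t *: f t] below [M]. *)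
Lemma density_le1 : {ae nu, forall t, p t <= 1}.
Proof.
set B := [set t : measurableTypeR R | 1 < p t].
have mB : measurable B by exact: mp_gt.
exists B; split=> [//||t /= /negP]; last by rewrite -ltNge.
apply: (@measure0_of_integral_le0 _ (measurableTypeR R) _ nu _
  (fun t => (p t)%:E - (cst 1 t)%:E)%E) => //.
- apply: emeasurable_funB; last exact/measurable_EFinP/measurable_cst.
  by apply/measurable_EFinP; exact: (@mpA _).
- by move=> t pt; rewrite -EFinB lte_fin subr_gt0.
- rewrite integralB_EFin//; last 2 first.
  + exact: density_integrable.
  + by apply: (@bounded_integrable _ _ _ _ (cst 1) _ `|1|);
    [exact: mp_gt|exact: measurable_cst|move=> x _ /=; exact: lexx].
  rewrite density_integral// [X in (_ - X)%E](_ : _ = nu B).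
    rewrite sube_le0; apply: (@le_trans _ _ (lambda_I T B + dr_I T0 hr B)%E);
      first by rewrite leeDl.
    by rewrite le_eqVlt; apply/orP; left; apply/eqP; exact/esym/measure_addE.
  by rewrite (eq_integral (cst 1%E))// integral_cst// mul1e.
Qed.

(** Atoms of [dr] give [lambda]-null sets that [nu] charges and where nothing is known of the
    approximation of [f]; the product with the density is harmless there. *)
Lemma density_eq0 (Z : set (measurableTypeR R)) : measurable Z -> lambda_I T Z = 0%E ->
  {ae nu, forall t, Z t -> p t <= 0}.
Proof.
move=> mZ Z0; exists (Z `&` [set t : measurableTypeR R | 0 < p t]); split.
- exact: measurableI.
- apply: (@measure0_of_integral_le0 _ (measurableTypeR R) _ nu _ (fun t => (p t)%:E)) =>
  //.
  + exact: measurableI.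
  + by apply/measurable_EFinP; exact: (@mpA _).
  + by move=> t /= [_]; rewrite lte_fin.
  + rewrite density_integral; last exact: measurableI.
    by rewrite -Z0; apply: le_measure; rewrite ?inE//; exact: measurableI.
- by move=> t /= /not_implyP[Zt /negP]; rewrite -ltNge.
Qed.

Import HBSimple HBNNSimple.

Lemma density_scale_simple (E : normedModType R) (f : R -> E) :
  strongly_measurable (lambda_I T) `[0, T] f ->
  exists s : nat -> R -> E, (forall n, simple_map (s n : measurableTypeR R -> E)) /\
    {ae nu, forall t, 0 <= t <= T -> s n t @[n --> \oo] --> p t *: f t}.
Proof.
move=> [sf [ssf [N [mN N0 NN]]]].
(* The positive part is nonnegative everywhere, as the approximation by nonnegative simple functions
   requires, and agrees with [p] almost everywhere. *)
pose pp t := Num.max 0 (p t).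
have mpp : measurable_fun [set: measurableTypeR R] (EFin \o pp).
  apply/measurable_EFinP; apply: measurable_maxr => //.
pose q := nnsfun_approx measurableT mpp.
have cq t : q n t @[n --> \oo] --> pp t.
  have /fine_cvgP[_ //] : (q n t)%:E @[n --> \oo] --> (pp t)%:E.
  by apply: cvg_nnsfun_approx => // x _; rewrite lee_fin le_max lexx.
(* The approximations increase to [pp t], so they vanish exactly where it does: on the exceptional
   set of [f] the products are [0], whatever [sf n] does. *)
have q0 n t : pp t <= 0 -> q n t = 0.
  move=> pt; apply/eqP; rewrite eq_le; apply/andP; split; last by [].
  apply: le_trans pt; rewrite -(cvg_lim _ (cq t))//.
  apply: (nondecreasing_cvgn_le (u_ := fun n => q n t)) => //.
    move=> i j ij; have /lefP := nd_nnsfun_approx measurableT mpp ij; exact.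
  by apply/cvg_ex; exists (pp t).
exists (fun n t => q n t *: sf n t); split=> [n|].
  have sq : @simple_map _ (measurableTypeR R) R (q n).
    split; first exact: fimfunP.
    by move=> y; exact: measurable_sfunP.
  exact: (simple_map_comp2 (fun a v => a *: v) sq (ssf n)).
have FF : Filter (almost_everywhere nu) by exact: ae_filter_ringOfSetsType.
apply: filterS2 density_ge0 (density_eq0 mN N0) => t pt0 Nt tT.
have ppE : pp t = p t by exact/max_idPr.
have [/Nt pt|Nt'] := pselect (N t).
  have pp0 : pp t <= 0 by rewrite ppE.
  have -> : p t = 0 by apply/eqP; rewrite eq_le pt pt0.
  rewrite scale0r; under eq_fun do rewrite q0// scale0r.
  exact: cvg_cst.
rewrite -ppE; apply: cvgZ => //.
by apply: contrapT => h; apply: Nt'; apply: NN => /= /(_ _)/h; apply; rewrite in_itv.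
Qed.

End nu.

(** * Approximation by step maps *)

Section approximable.
Context (R : realType) (T : R) (T0 : 0 < T) (r : R -> R) (hr : stieltjes_function T r).
Notation nu := (nu_I T0 hr).
Notation mR := (measurableTypeR R).

(** Agreement, up to small [nu]-measure, with maps constant on the cells of level [n]. Asking it for
    all large [n] lets two approximable maps be approximated at a common level. *)
Definition approximable (V : Type) (s : mR -> V) : Prop :=
  simple_map s /\ forall e : R, 0 < e -> exists N, forall n, (N <= n)%N ->
    exists z : nat -> V, (nu [set t | s t <> z (cell T n t)] <= e%:E)%E.

Lemma measurable_neq_cell (V : Type) (s : mR -> V) (z : nat -> V) n :
  simple_map s -> measurable [set t : mR | s t <> z (cell T n t)].
Proof.
move=> ss; exact: (simple_map_preimage [set p : V * V | p.1 <> p.2]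
  (simple_map_pair ss (simple_map_comp z (cell_simple T0 n)))).
Qed.

Lemma approximable_comp2 (V W Z : Type) (phi : V -> W -> Z) (s : mR -> V) (s' : mR -> W) :
  approximable s -> approximable s' -> approximable (fun t => phi (s t) (s' t)).
Proof.
move=> [ss sa] [ss' sa']; have sss := simple_map_comp2 phi ss ss'; split=> // e e0.
have e2 : 0 < e / 2 by rewrite divr_gt0.
have [N HN] := sa _ e2; have [N' HN'] := sa' _ e2; exists (maxn N N') => n.
rewrite geq_max => /andP[/HN[z hz] /HN'[z' hz']].
exists (fun k => phi (z k) (z' k)).
apply: (@le_trans _ _ (nu ([set t : mR | s t <> z (cell T n t)]
  `|` [set t : mR | s' t <> z' (cell T n t)]))).
  apply: le_measure; rewrite ?inE.
  - exact: (measurable_neq_cell (fun k => phi (z k) (z' k)) n sss).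
  - by apply: measurableU; exact: measurable_neq_cell.
  - move=> t /= ht; apply: contrapT => /not_orP[/contrapT h1 /contrapT h2].
    by apply: ht; rewrite h1 h2.
apply: (le_trans (measureU2 _ _ _)).
- exact: measurable_neq_cell.
- exact: measurable_neq_cell.
- by rewrite (splitr e) EFinD leeD.
Qed.

Lemma approximable_cst (V : Type) (v : V) : approximable (fun=> v).
Proof.
split; first exact: simple_map_cst.
move=> e e0; exists 0%N => n _; exists (fun=> v).
rewrite (_ : [set _ | _] = set0) ?measure0 ?lee_fin ?ltW//.
by apply/seteqP; split=> t.
Qed.

Lemma approximable_close (V : Type) (s : mR -> V) : simple_map s ->
  (forall e : R, 0 < e -> exists2 s' : mR -> V, approximable s' &
    (nu [set t | s t <> s' t] <= e%:E)%E) -> approximable s.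
Proof.
move=> ss H; split=> // e e0; have e2 : 0 < e / 2 by rewrite divr_gt0.
have [s' [ss' /(_ _ e2)[N HN]] hs] := H _ e2; exists N => n /HN[z hz]; exists z.
apply: (@le_trans _ _ (nu ([set t : mR | s t <> s' t]
  `|` [set t : mR | s' t <> z (cell T n t)]))).
  apply: le_measure; rewrite ?inE.
  - exact: measurable_neq_cell.
  - apply: measurableU; last exact: measurable_neq_cell.
    exact: (simple_map_preimage [set p : V * V | p.1 <> p.2] (simple_map_pair ss ss')).
  - move=> t /= ht; apply: contrapT => /not_orP[/contrapT h1 /contrapT h2].
    by apply: ht; rewrite h1 h2.
apply: (le_trans (measureU2 _ _ _)).
- exact: (simple_map_preimage [set p : V * V | p.1 <> p.2] (simple_map_pair ss ss')).
- exact: measurable_neq_cell.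
- by rewrite (splitr e) EFinD leeD.
Qed.

Lemma nu_theta_small (a : R) : 0 <= a <= T ->
  fine (nu `]a, theta T n a]) @[n --> \oo] --> (0 : R).
Proof.
move=> aT; rewrite -(subrr (mass r a)).
rewrite (_ : (fun n => _) = fun n => mass r (theta T n a) - mass r a).
  by apply: cvgB; [exact: mass_theta|exact: cvg_cst].
apply/funext => n; rewrite nu_I_mass//; first by case/andP: aT.
  exact: theta_ge.
by have /andP[] := theta_itv T0 n a.
Qed.

(** Inside [[0, T]] the indicator differs from the condition [cell n a < cell n t] only on []a,
    theta n a]], whose measure tends to [0] by right continuity of [mass]. *)
Lemma approximable_ray (a : R) : approximable (fun t : mR => t \in `]a, +oo[%classic).
Proof.
have mray : measurable (`]a, +oo[%classic : set mR) by exact: measurable_itv.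
have sray := simple_map_set mray.
have out (b : bool) : (forall t, 0 <= t <= T -> (a < t) = b) ->
    approximable (fun t : mR => t \in `]a, +oo[%classic).
  move=> H; apply: approximable_close => // e e0; exists (fun=> b).
    exact: approximable_cst.
  rewrite nu_I_out ?lee_fin ?ltW// => t /= ht; apply: contra_not ht.
  rewrite in_itv/= => /H <-; apply/idP/idP.
    by move=> /set_mem; rewrite /= in_itv/= andbT.
  by move=> h; apply/mem_set; rewrite /= in_itv/= andbT.
have [a0|a0] := ltP a 0.
  by apply: (out true) => t /andP[t0 _]; exact: lt_le_trans a0 t0.
have [Ta|aT] := leP T a.
  by apply: (out false) => t /andP[_ tT]; apply/negbTE; rewrite -leNgt;
    exact: le_trans tT Ta.
have aT' : 0 <= a <= T by rewrite a0 ltW.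
split=> // e e0; have /cvgrPdist_le/(_ _ e0)[N _ HN] := nu_theta_small aT'.
exists N => n Nn; exists (fun k => (cell T n a < k)%N).
have := HN n Nn; rewrite /= sub0r normrN ger0_norm ?fine_ge0// => hN.
set B := [set t | _].
have mB : measurable B by exact: measurable_neq_cell.
apply: (@le_trans _ _ (nu (`]a, theta T n a] `|` ~` `[0, T]))).
  apply: le_measure; rewrite ?inE//.
    by apply: measurableU; [exact: measurable_itv|apply: measurableC;
      exact: measurable_I].
  move=> t /= ht; apply: contrapT => /not_orP[h1 /contrapT]; rewrite in_itv/= => tT.
  apply: ht; apply/idP/idP.
    move=> /set_mem; rewrite /= in_itv/= andbT => at_.
    rewrite ltnNge (cell_le T0) (clamp_id tT); apply/negP => h.
    by apply: h1; rewrite /= in_itv/= at_.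
  move=> h; apply/mem_set; rewrite /= in_itv/= andbT; rewrite ltNge.
  by apply/negP => ta; move: h; rewrite ltnNge (cell_mono T0).
apply: (le_trans (measureU2 _ _ _)).
- exact: measurable_itv.
- by apply: measurableC; exact: measurable_I.
- rewrite [X in (_ + X)%E](nu_I_out T0 hr (@subset_refl _ _)) adde0.
  rewrite -[X in (X <= _)%E]fineK ?lee_fin// fin_num_measure//; exact: measurable_itv.
Qed.

(** The sets with approximable indicator form a sigma-algebra containing the rays; countable unions
    are handled by continuity of the measure from below. *)
Lemma approximable_set (B : set mR) : measurable B -> approximable (fun t => t \in B).
Proof.
move=> mB; pose D := [set B : set mR | measurable B /\ approximable (fun t => t \in B)].
suff [] : D B by [].
have DU (F : nat -> set mR) : (forall n, D (F n)) -> D (\bigcup_n F n).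
  move=> DF; have mF n : measurable (F n) by exact: (DF n).1.
  have mU : measurable (\bigcup_n F n) by exact: bigcupT_measurable.
  split=> //; apply: approximable_close; first exact: simple_map_set.
  pose G n := \big[setU/set0]_(i < n) F i.
  have aG n : approximable (fun t => t \in G n).
    elim: n => [|n IH].
      rewrite (_ : (fun _ => _) = fun=> false); first exact: approximable_cst.
      by apply/funext => t; rewrite /G big_ord0 in_set0.
    rewrite (_ : (fun _ => _) = fun t => (t \in G n) || (t \in F n)).
      by apply: (approximable_comp2 orb); [|exact: (DF n).2].
    by apply/funext => t; rewrite /G big_ord_recr/= in_setU.
  have mG n : measurable (G n) by exact: bigsetU_measurable.
  have UG : \bigcup_n G n = \bigcup_n F n.
    apply/seteqP; split=> t [n _]; first exact: bigsetU_bigcup.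
    by move=> Ft; exists n.+1 => //; rewrite /G big_ord_recr; right.
  have cG : nu (G n) @[n --> \oo] --> nu (\bigcup_n F n).
    rewrite -UG; apply: nondecreasing_cvg_mu => //; first by rewrite UG.
    by move=> n m nm; apply/subsetPset; exact: subset_bigsetU.
  move=> e e0.
  have fU : nu (\bigcup_n F n) \is a fin_num by rewrite fin_num_measure.
  have /fine_cvgP[_ /cvgrPdist_le/(_ _ e0)[N _ HN]] :
      nu (G n) @[n --> \oo] --> (fine (nu (\bigcup_n F n)))%:E by rewrite fineK.
  exists (fun t => t \in G N); first exact: aG.
  have GU : G N `<=` \bigcup_n F n by rewrite -UG => t Gt; exists N.
  have -> : [set t : mR | (t \in \bigcup_n F n) <> (t \in G N)] = (\bigcup_n F n) `\` G N.
    apply/seteqP; split=> t /=.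
      move=> ht; apply: contrapT => h; apply: ht; apply/idP/idP => /set_mem ht;
        apply/mem_set.
        by apply: contrapT => ht'; apply: h.
      exact: GU.
    by move=> [h1 h2]; rewrite (mem_set h1) (memNset h2).
  rewrite measureD//; last by rewrite ltey_eq fU.
  have -> : \bigcup_n F n `&` G N = G N by apply/setIidPr.
  have fG : nu (G N) \is a fin_num by rewrite fin_num_measure.
  suff : (nu (\bigcup_n F n) - nu (G N) <= e%:E)%E by [].
  rewrite -(fineK fU) -(fineK fG) -EFinB lee_fin.
  exact: le_trans (ler_norm _) (HN N (leqnn N)).
have DC A : D A -> D (~` A).
  move=> [mA aA]; split; first exact: measurableC.
  rewrite (_ : (fun _ => _) = fun t => ~~ (t \in A)).
    exact: (approximable_comp2 (fun a _ => ~~ a) aA aA).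
  by apply/funext => t; rewrite in_setC.
move: mB; rewrite RGenOInfty.measurableE; apply: smallest_sub.
  split=> //.
  - split=> //; rewrite (_ : (fun _ => _) = fun=> false); first exact: approximable_cst.
    by apply/funext => t; rewrite in_set0.
  - by move=> A DA; rewrite setTD; exact: DC.
move=> _ [a ->]; split; first exact: measurable_itv.
exact: approximable_ray.
Qed.

Lemma approximable_simple (V : choiceType) (s : mR -> V) : simple_map s -> approximable s.
Proof.
move=> ss; have fs : finite_set (range s) by case: ss.
pose F l := foldr (fun y (g : mR -> V) t => if t \in s @^-1` [set y] then y else g t)
  (fun=> s 0) l.
have aF l : approximable (F l).
  elim: l => [|y l IH] /=; first exact: approximable_cst.
  apply: (approximable_comp2 (fun (b : bool) v => if b then y else v)) => //.
  by apply: approximable_set; exact: ss.2.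
rewrite (_ : s = F (enum_fset (fset_set (range s))))//.
apply/funext => t; have : s t \in enum_fset (fset_set (range s)).
  by rewrite in_fset_set//; apply: mem_set; exists t.
elim: (enum_fset _) => // y l IH; rewrite inE /= => /orP[/eqP sty|/IH <-].
  by rewrite mem_set.
by case: ifPn => // /set_mem.
Qed.

(** Each [s n] is matched at some level with a map constant on cells, up to measure [2^-n]; by
    Borel-Cantelli the two agree eventually at almost every point. *)
Lemma step_approximation (E : completeNormedModType R) (h : R -> E) (M : R)
    (s : nat -> mR -> E) : 0 <= M ->
  (forall n, simple_map (s n)) ->
  {ae nu, forall t, 0 <= t <= T -> s n t @[n --> \oo] --> h t} ->
  {ae nu, forall t, 0 <= t <= T -> `|h t| <= M} ->
  exists (m : nat -> nat) (z : nat -> nat -> E),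
    [/\ forall n, (n <= m n)%N, forall n k, `|z n k| <= M + 1 &
    {ae nu, forall t, 0 <= t <= T -> z n (cell T (m n) t) @[n --> \oo] --> h t}].
Proof.
move=> M0 ss sh hM.
have H n : exists mz : nat * (nat -> E), (n <= mz.1)%N /\
    (nu [set t : mR | s n t <> mz.2 (cell T mz.1 t)] <= (2^-1 ^+ n)%:E)%E.
  have [N HN] := (approximable_simple (ss n)).2 _ (half_expn_gt0 R n).
  have [z hz] := HN (maxn n N) (leq_maxr _ _).
  by exists (maxn n N, z); rewrite leq_maxl.
have [mz Hmz] := choice H.
(* Values above [M + 1] are cut to [0]. Where the maps converge to [h], of norm at most [M], the
   margin 1 makes the cut eventually inactive. *)
exists (fun n => (mz n).1), (fun n k => if `|(mz n).2 k| <= M + 1 then (mz n).2 k else 0).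
split=> [n|n k|]; first exact: (Hmz n).1.
  by case: ifPn => // _; rewrite normr0 addr_ge0.
pose F n := [set t : mR | s n t <> (mz n).2 (cell T (mz n).1 t)].
have mF n : measurable (F n) by exact: measurable_neq_cell.
have FF : Filter (almost_everywhere nu) by exact: ae_filter_ringOfSetsType.
have Fev := ae_eventually mF (fun n => (Hmz n).2).
apply: filterS3 sh hM Fev => t sht hMt [N HN] tT.
have E1 : \forall n \near \oo, s n t = (mz n).2 (cell T (mz n).1 t).
  by exists N => // n /= Nn; apply: contrapT; exact: HN.
have cz : (mz n).2 (cell T (mz n).1 t) @[n --> \oo] --> h t.
  by apply: cvg_trans (sht tT); apply: near_eq_cvg; apply: filterS E1 => n ->.
apply: cvg_trans cz; apply: near_eq_cvg.
have := sht tT => /cvgrPdist_lt/(_ _ ltr01); apply: filterS2 E1 => n e1 e2.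
rewrite -e1 ifT// -(subrK (h t) (s n t)) (le_trans (ler_normD _ _))// addrC lerD//.
  exact: hMt.
by rewrite distrC ltW.
Qed.
End approximable.

(** * The implicit Euler scheme *)

Section euler.
Context (R : realType) (E : completeNormedModType R) (dot : {dot E for idfun})
  (hdot : norm_of_dot dot) (T : R) (T0 : 0 < T) (A : R -> E -> set E)
  (hA : forall t, 0 <= t <= T -> maximal_monotone dot (A t))
  (r : R -> R) (hr : stieltjes_function T r)
  (H1 : forall s t, 0 <= s -> s <= t -> t <= T ->
    (dis dot (A t) (A s) <= (r t - r s)%:E)%E)
  (c : R) (c0 : 0 <= c)
  (H2 : forall t x, 0 <= t <= T -> dom (A t) x ->
    `|min_section (A t) x| <= c * (1 + `|x|)).

Lemma dis_dot_le s t x y x' y' : 0 <= s -> s <= t -> t <= T ->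
  A t x y -> A s x' y' ->
  dot (y - y') (x' - x) <= (r t - r s) * (1 + `|y| + `|y'|).
Proof.
move=> s0 st tT Axy Axy'; have := H1 s0 st tT.
move=> /(le_trans _) h; have {h} := h (dot (y - y') (x' - x) / (1 + `|y| + `|y'|))%:E.
have p0 : 0 < 1 + `|y| + `|y'| by rewrite ltr_wpDr// ltr_wpDr.
rewrite lee_fin ler_pdivrMr//.
by apply; apply: ereal_sup_ubound; exists x, y, x', y'.
Qed.

(** The part [(1 + c) * (1 + M) + 1] bounds the selected element of [A]; the last [M] accounts for
    adding the forcing term [z]. *)
Definition euler_cst (M : R) := (1 + c) * (1 + M) + 1 + M.

Lemma euler_cst_ge1 M : 0 <= M -> 1 <= euler_cst M.
Proof. by move=> M0; rewrite /euler_cst; rewrite mulrDl mul1r mulrDr mulr1;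
  have := mulr_ge0 c0 M0; move: c0 M0 => ? ?; lra. Qed.

(** The pseudo-distance is tested with the element [y0] of least norm at the previous point. Since
    [x' - x = dl *: (y + z)] and the increment of [r] is at most [dl], the step cancels:
    [dot (y - y0) (y + z) <= 1 + |y| + |y0|], which is quadratic in [|y|] on the left and linear on
    the right. *)
Lemma euler_step_bound (s t dl M : R) (x x' z : E) : 0 <= s -> s <= t -> t <= T ->
  0 < dl -> r t - r s <= dl -> 0 <= M -> `|z| <= M -> dom (A s) x' ->
  A t x (- (dl^-1 *: (x - x')) - z) ->
  `|dl^-1 *: (x - x')| <= euler_cst M * (1 + `|x'|) /\
  `|- (dl^-1 *: (x - x')) - z| <= euler_cst M * (1 + `|x'|).
Proof.
move=> s0 st tT dl0 rdl M0 zM dx' Axy; set y := - _ - z in Axy *.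
have sT : 0 <= s <= T by rewrite s0 (le_trans st).
have Ay0 := min_section_in hdot (hA sT) dx'; have hb := H2 sT dx'.
move: hb Ay0; set y0 := min_section (A s) x' => hb Ay0.
have := dis_dot_le s0 st tT Axy Ay0.
have xE : x' - x = dl *: (y + z).
  by rewrite /y subrK scalerN scalerA divff ?gt_eqF// scale1r opprB.
have gE : dl^-1 *: (x - x') = - (y + z) by rewrite /y subrK opprK.
clearbody y; rewrite xE dotZr.
have y1 : 0 <= 1 + `|y| + `|y0| by rewrite !addr_ge0.
move=> /le_trans/(_ (ler_wpM2r y1 rdl)); rewrite ler_pM2l//.
rewrite dotBl !dotDr -(normsq hdot) => h.
have d1 : - (`|y| * M) <= dot y z.
  rewrite lerNl -dotNr; apply: le_trans (dot_le hdot _ _) _.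
  by rewrite normrN ler_wpM2l.
have d2 := dot_le hdot y0 y; have d3 : dot y0 z <= `|y0| * M.
  by apply: le_trans (dot_le hdot _ _) _; rewrite ler_wpM2l.
have ny0 : 0 <= `|y| by []. have ny00 : 0 <= `|y0| by []. have nx0 : 0 <= `|x'| by [].
have yb : `|y| <= (1 + `|y0|) * (1 + M) + 1.
  move: h d1 d2 d3 ny0 ny00 M0; move: (dot y z) (dot y0 y) (dot y0 z) => p q s1.
  move: `|y| `|y0| => a b h d1 d2 d3 a0 b0 M0.
  have abM : 0 <= a * (b * M) by rewrite !mulr_ge0.
  (* If [a] exceeded the bound, [a^2] would exceed [a] times the bound, hence all the terms linear
     in [a] together with the constants. *)
  rewrite leNgt; apply/negP => hy.
  have : a * ((1 + b) * (1 + M) + 1) < a * a.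
    rewrite ltr_pM2l//; apply: le_lt_trans hy.
    by rewrite addr_ge0// mulr_ge0// addr_ge0.
  by move: h hy; rewrite expr2; lra.
have yb' : `|y| <= ((1 + c) * (1 + M) + 1) * (1 + `|x'|).
  apply: (le_trans yb).
  have : (1 + `|y0|) * (1 + M) <= (1 + c * (1 + `|x'|)) * (1 + M).
    by rewrite ler_wpM2r ?addr_ge0// lerD2l.
  have : 0 <= `|x'| * M by rewrite mulr_ge0.
  by move: (`|x'|) (`|y0|) nx0 => a b a0; lra.
rewrite gE normrN; split.
  apply: (le_trans (ler_normD _ _)); rewrite /euler_cst.
  have : 0 <= M * `|x'| by rewrite mulr_ge0.
  by move: yb' zM; move: `|y| `|z| `|x'| => a b e; lra.
apply: (le_trans yb'); rewrite /euler_cst ler_wpM2r ?addr_ge0//.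
by rewrite lerDl.
Qed.

Lemma euler_scheme (n : nat) (z : nat -> E) (M : R) (u0 : E) : 0 <= M ->
  (forall k, `|z k| <= M) ->
  dom (A 0) u0 ->
  exists U G : nat -> E,
    [/\ U 0%N = u0,
        forall k, (k <= 2 ^ n)%N -> dom (A (node T n k)) (U k) /\
          `|U k| <= expR (euler_cst M * mass r T) * (1 + `|u0|),
        forall k, (k < 2 ^ n)%N -> [/\ A (node T n k.+1) (U k.+1) (- G k.+1 - z k.+1),
          U k.+1 - U k = (mass r (node T n k.+1) - mass r (node T n k)) *: G k.+1 &
          `|- G k.+1 - z k.+1| <= euler_cst M *
            (expR (euler_cst M * mass r T) * (1 + `|u0|))] &
        forall k, `|G k| <= euler_cst M * (expR (euler_cst M * mass r T) * (1 + `|u0|))].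
Proof.
move=> M0 zM du0; set C := euler_cst M; set L := expR _ * _;
  have C1 : 1 <= C by exact: euler_cst_ge1.
pose t k := node T n k; pose dl k := mass r (t k.+1) - mass r (t k).
have [r0 rp rm _] := hr.
have tk0 k : 0 <= t k by exact: node_ge0.
have tkS k : t k <= t k.+1 by exact/ltW/node_ltS.
have tkT k : (k < 2 ^ n)%N -> t k.+1 <= T by exact: node_leT.
(* Positivity comes from the identity part of [mass], so the division by [dl k] is legitimate even
   where [r] is constant. *)
have rdl k : (k < 2 ^ n)%N -> r (t k.+1) - r (t k) <= dl k /\ 0 < dl k.
  move=> kn; have : t k < t k.+1 by exact: node_ltS.
  have := rm _ _ (tk0 k) (tkS k) (tkT k kn); rewrite /dl /mass.
  by move: (r _) (r _) => a b; split; lra.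
pose next k x := xget x [set x' | A (t k.+1) x' (- ((dl k)^-1 *: (x' - x)) - z k.+1)].
pose U := fix U k := if k is k'.+1 then next k' (U k') else u0.
have AU k : (k < 2 ^ n)%N -> A (t k.+1) (U k.+1)
  (- ((dl k)^-1 *: (U k.+1 - U k)) - z k.+1).
  move=> kn /=; rewrite /next; case: xgetP => [x -> //|/= nx].
  have tT : 0 <= t k.+1 <= T by rewrite tk0 tkT.
  have [_ dl0] := rdl k kn.
  (* The resolvent at the shifted point [U k - dl k *: z k.+1] solves the implicit equation, so
     [next] does not take its default value. *)
  have [x Ax] := resolvent_ex hdot (U k - dl k *: z k.+1) (hA tT) dl0.
  exfalso; apply: (nx x); move: Ax; congr (A _ _ _).
  by rewrite addrAC scalerBr scalerA mulVf ?gt_eqF// scale1r -scalerN opprB.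
have dU k : (k <= 2 ^ n)%N -> dom (A (t k)) (U k).
  case: k => [_|k kn]; first by rewrite /t node0.
  by eexists; exact: AU.
have bnd k : (k < 2 ^ n)%N -> `|(dl k)^-1 *: (U k.+1 - U k)| <= C * (1 + `|U k|) /\
    `|- ((dl k)^-1 *: (U k.+1 - U k)) - z k.+1| <= C * (1 + `|U k|).
  move=> kn; have [h1 h2] := rdl k kn.
  by apply: (euler_step_bound (tk0 k) (tkS k) (tkT k kn)) => //;
    [exact/dU/ltnW|exact: AU].
have VT k : (k <= 2 ^ n)%N -> mass r (t k) <= mass r T by move=> kn;
  apply: (mass_le hr) => //; exact: node_leT.
(* Discrete Gronwall: for [1 + |U k|] the recursion is homogeneous with factor [1 + C * dl k], at
   most [expR (C * dl k)], and the exponents add up to the mass. *)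
have gron k : (k <= 2 ^ n)%N -> 1 + `|U k| <= expR (C * mass r (t k)) * (1 + `|u0|).
  elim: k => [_|k IH kn].
    by rewrite /t node0 /mass r0 addr0 mulr0 expR0 mul1r.
  have [_ dl0] := rdl k kn; have [h1 _] := bnd k kn.
  have hU : `|U k.+1| <= `|U k| + dl k * (C * (1 + `|U k|)).
    rewrite -(subrK (U k) (U k.+1)) addrC (le_trans (ler_normD _ _))// lerD2l.
    by move: h1; rewrite normrZ gtr0_norm ?invr_gt0// ler_pdivrMl.
  have -> : C * mass r (t k.+1) = C * dl k + C * mass r (t k) by rewrite /dl; ring.
  rewrite expRD -mulrA.
  apply: (@le_trans _ _ ((1 + C * dl k) * (1 + `|U k|))); first by move: hU; lra.
  apply: ler_pM.
  - by rewrite addr_ge0// mulr_ge0 ?ltW// (lt_le_trans _ C1).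
  - by rewrite addr_ge0.
  - exact: expR_ge1Dx.
  - by apply: IH; exact: ltnW.
have UL k : (k <= 2 ^ n)%N -> 1 + `|U k| <= L.
  move=> kn; apply: (le_trans (gron k kn)); rewrite ler_wpM2r ?addr_ge0// ler_expR.
  by rewrite ler_wpM2l ?(le_trans ler01 C1)// VT.
have L0 : 0 <= L by rewrite mulr_ge0 ?expR_ge0// addr_ge0.
(* The slopes are set to [0] outside the indices of the scheme, so that their bound holds for every
   [k]. *)
exists U, (fun k => if (k == 0%N) || (2 ^ n < k)%N then 0 else (dl k.-1)^-1 *:
  (U k - U k.-1)).
split=> // [k kn|k kn|k].
- by split; [exact: dU|by have := UL k kn; lra].
- have -> : (k.+1 == 0%N) || (2 ^ n < k.+1)%N = false by rewrite /= ltnNge kn.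
  have [_ dl0] := rdl k kn; have [_ h2] := bnd k kn.
  split; first exact: AU.
    by rewrite scalerA divff ?gt_eqF// scale1r.
  apply: (le_trans h2); rewrite ler_wpM2l ?(le_trans ler01 C1)//.
  by apply: UL; exact: ltnW.
- case: k => [|k]/=; first by rewrite normr0 mulr_ge0// (le_trans ler01 C1).
  case: ifPn => [_|]; first by rewrite normr0 mulr_ge0// (le_trans ler01 C1).
  rewrite -leqNgt => kn; have [h1 _] := bnd k kn.
  apply: (le_trans h1); rewrite ler_wpM2l ?(le_trans ler01 C1)//.
  by apply: UL; exact: ltnW.
Qed.

End euler.

(** * Compactness: from an ultrafilter limit to a convergent subsequence *)

Lemma ultra_cvg_compact (I : Type) (X : topologicalType) (G : set_system I) (C : set X)
  (f : I -> X) :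
  UltraFilter G -> compact C -> (forall i, C (f i)) -> exists x : X, f @ G --> x.
Proof.
move=> UG cC Cf.
have PG : ProperFilter G by exact: ultra_proper.
have [x [_ clx]] : C `&` cluster (f @ G) !=set0 by apply: cC; exact: (filterE _ Cf).
exists x => U Ux; have [//|GU] := in_ultra_setVsetC (f @^-1` U) UG.
have GU' : (f @ G) (~` U) by [].
by have [y []] := clx _ _ GU' Ux.
Qed.

Section subsequence.
Context (R : realType) (T : R) (T0 : 0 < T) (r : R -> R) (hr : stieltjes_function T r).
Notation nu := (nu_I T0 hr).

(** The ultrafilter produces [u t] for all of the uncountably many [t] at once. A subsequence is
    then needed for dominated convergence; closeness on finitely many nodes suffices to select it,
    because the Lipschitz bounds carry it to every [t]. *)
Lemma subsequence (E : normedModType R) (v : nat -> R -> E) (m : nat -> nat)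
    (C : set E) (K : R) : 0 <= K -> compact C ->
  (forall j, (j <= m j)%N) -> (forall j t, 0 <= t <= T -> C (v j t)) ->
  (forall j s t, 0 <= s -> s <= t -> t <= T ->
    `|v j t - v j s| <= K * (mass r (theta T (m j) t) - mass r (theta T (m j) s))) ->
  exists (u : R -> E) (phi : nat -> nat), [/\ forall n, (n <= phi n)%N,
    forall t, 0 <= t <= T -> v (phi n) t @[n --> \oo] --> u t &
    forall s t, 0 <= s -> s <= t -> t <= T -> `|u t - u s| <= K * (mass r t - mass r s)].
Proof.
move=> K0 cC mj vC vK.
have [G [UG ooG]] := @ultraFilterLemma nat \oo _.
have PG : ProperFilter G by exact: ultra_proper.
have H (t : R) : exists ut : E, 0 <= t <= T -> v j t @[j --> G] --> ut.
  have [tT|tT] := boolP (0 <= t <= T); last by exists 0.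
  have [ut ?] := ultra_cvg_compact UG cC (fun j => vC j t tT).
  by exists ut.
have [u Hu] := choice H.
have mG t : 0 <= t <= T -> mass r (theta T (m j) t) @[j --> G] --> mass r t.
  move=> tT; have h : mass r (theta T (m j) t) @[j --> \oo] --> mass r t.
    apply/cvgrPdist_lt => e e0.
    have /cvgrPdist_lt/(_ _ e0)[N _ HN] := mass_theta T0 hr tT.
    by exists N => // j /= Nj; apply: HN; exact: leq_trans (mj j).
  by move=> B /h; exact: ooG.
have uK s t : 0 <= s -> s <= t -> t <= T -> `|u t - u s| <= K * (mass r t - mass r s).
  move=> s0 st tT; have sT : 0 <= s <= T by rewrite s0 (le_trans st).
  have tT' : 0 <= t <= T by rewrite tT (le_trans s0).
  have c1 : `|v j t - v j s| @[j --> G] --> `|u t - u s|.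
    by apply: cvg_norm; apply: cvgB; exact: Hu.
  have c2 : K * (mass r (theta T (m j) t) - mass r (theta T (m j) s)) @[j --> G] --> K *
    (mass r t - mass r s).
    by apply: cvgM; [exact: cvg_cst|apply: cvgB; exact: mG].
  by apply: (ler_cvg_to c1 c2); apply: filterE => j; exact: vK.
have nodeT n k : (k <= 2 ^ n)%N -> 0 <= node T n k <= T.
  by move=> kn; rewrite node_ge0// node_leT.
(* Closeness at the finitely many nodes of level [n] holds for [G]-many [j], and some of these
   exceed [n] since [G] refines the filter at infinity. *)
have Hphi n : exists j, (n <= j)%N /\
    forall k, (k <= 2 ^ n)%N -> `|u (node T n k) - v j (node T n k)| < 2^-1 ^+ n.
  suff : \forall j \near G, (n <= j)%N /\
      forall k, (k <= 2 ^ n)%N -> `|u (node T n k) - v j (node T n k)| < 2^-1 ^+ n.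
    by move/filter_ex.
  apply: filterI; first by apply: ooG; exists n.
  have HK N : (N <= (2 ^ n).+1)%N -> \forall j \near G,
      forall k, (k < N)%N -> `|u (node T n k) - v j (node T n k)| < 2^-1 ^+ n.
    elim: N => [_|N IH Nn]; first by apply: filterE.
    have hN : 0 <= node T n N <= T by exact: nodeT.
    have /cvgrPdist_lt/(_ _ (half_expn_gt0 R n)) := Hu _ hN.
    apply: filterS2 (IH (ltnW Nn)) => j h1 h2 k.
    by rewrite ltnS leq_eqVlt => /predU1P[->//|]; exact: h1.
  by apply: filterS (HK _ (leqnn _)) => j h k kn; apply: h; rewrite ltnS.
have [phi Pphi] := choice Hphi.
exists u, phi; split=> // [n|t tT]; first exact: (Pphi n).1.
have /andP[t0 tT'] := tT.
apply/cvgrPdist_le => e e0.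
have h : K * (mass r (theta T n t) - mass r t) + K * (mass r (theta T n t) - mass r t) +
  2^-1 ^+ n @[n --> \oo] --> (0 : R).
  have -> : (0 : R) = K * (mass r t - mass r t) + K * (mass r t - mass r t) + 0
    by rewrite subrr mulr0 !addr0.
  apply: cvgD; last exact: half_expn_cvg0.
  by apply: cvgD; apply: cvgM; try exact: cvg_cst; apply: cvgB; try exact: cvg_cst;
    exact: (mass_theta T0 hr).
have /cvgrPdist_le/(_ _ e0)[N _ HN] := h; exists N => // n /HN /=.
rewrite sub0r normrN => /(le_trans (ler_norm _)); apply: le_trans.
have /andP[th0 thT] := theta_itv T0 n t; have tht := theta_ge T0 n tT.
have nm : (n <= m (phi n))%N by exact: leq_trans (Pphi n).1 (mj _).
(* Comparison through the node [theta n t]. As partitions are nested, it is also a node of the finer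
   level [m (phi n)], so the step map moves between [t] and it by at most [K] times the mass
   increment. *)
have -> : u t - v (phi n) t = (u t - u (theta T n t)) +
  (v (phi n) (theta T n t) - v (phi n) t) +
   (u (theta T n t) - v (phi n) (theta T n t)).
  by rewrite [RHS]addrAC [X in _ = X + _]addrA subrK [RHS]addrA subrK.
rewrite (le_trans (ler_normD _ _))// lerD//; last by apply/ltW/(Pphi n).2/cell_max.
rewrite (le_trans (ler_normD _ _))// lerD//; first by rewrite distrC uK.
apply: le_trans (vK _ _ _ t0 tht thT) _; rewrite ler_wpM2l//.
rewrite (theta_refine T0 _ nm) lerD2l lerN2; apply: (mass_le hr) => //.
  exact: theta_ge.
by have /andP[] := theta_itv T0 (m (phi n)) t.
Qed.

End subsequence.

(** * Step maps, their discrete densities and Lipschitz bounds with respect to [nu] *)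

Section mass_lipschitz.
Context (R : realType) (T : R) (T0 : 0 < T) (r : R -> R) (hr : stieltjes_function T r).
Notation nu := (nu_I T0 hr).
Notation mR := (measurableTypeR R).

Lemma bvrc_mass_lipschitz (W : normedModType R) (w : R -> W) (K : R) :
  (forall s t, 0 <= s -> s <= t -> t <= T -> `|w t - w s| <= K * (mass r t - mass r s)) ->
  bvrc T w.
Proof.
move=> wK; split.
  exists (K * (mass r T - mass r 0)) => _ [s /= ps <-]; rewrite /vvariation.
  apply: (@le_trans _ _ (\sum_(0 <= n < size s)
     (K * mass r (nth T (0 :: s) n.+1) - K * mass r (nth T (0 :: s) n)))).
    rewrite !big_nat; apply: ler_sum => k; rewrite leq0n/= => ks; rewrite -mulrBr.
    apply: wK.
    - by apply: itv_partition_nth_ge ps; rewrite ltnS ltnW.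
    - have inc : {in `[0, T] &, nondecreasing_fun (id : R -> R)} by [].
      exact: (nondecreasing_fun_itv_partition inc ps ks).
    - by have := @itv_partition_nth_le _ _ 0 T s k.+1 ks ps.
  rewrite telescope_sumr//= -mulrBr.
  by have := itv_partition_nth_size T ps => /= ->.
move=> t tT; have /andP[t0 tT'] := tT.
apply/cvgrPdist_le => e e0.
have h : K * (mass r s - mass r t) @[s --> t^'+] --> (0 : R).
  have -> : (0 : R) = K * (mass r t - mass r t) by rewrite subrr mulr0.
  apply: cvgM; first exact: cvg_cst.
  by apply: cvgB; [exact: mass_right_continuous hr _ tT|exact: cvg_cst].
near=> s.
have ts : t < s by near: s; exact: nbhs_right_gt.
have sT : s < T by near: s; exact: nbhs_right_lt.
have : `|0 - K * (mass r s - mass r t)| <= e.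
  by near: s; move: e e0; apply/cvgrPdist_le.
rewrite sub0r normrN => /(le_trans (ler_norm _)); apply: le_trans.
by rewrite distrC; apply: wK => //; exact: ltW.
Unshelve. all: by end_near. Qed.

Context (E : completeNormedModType R) (dot : {dot E for idfun}) (hdot : norm_of_dot dot).

Section steps.
Context (n : nat) (U G : nat -> E) (K : R).
Hypothesis UG : forall k, (k < 2 ^ n)%N ->
  U k.+1 - U k = (mass r (node T n k.+1) - mass r (node T n k)) *: G k.+1.
Hypothesis GK : forall k, `|G k| <= K.

Lemma step_simple (V : Type) (z : nat -> V) : simple_map (fun t : mR => z (cell T n t)).
Proof. exact: (simple_map_comp z (cell_simple T0 n)). Qed.

Lemma node_mass_le k : (k < 2 ^ n)%N -> mass r (node T n k) <= mass r (node T n k.+1).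
Proof.
move=> kn; apply: (mass_le hr); [exact: node_ge0|exact/ltW/node_ltS|exact: node_leT].
Qed.

Lemma step_node_lipschitz k l : (k <= l)%N -> (l <= 2 ^ n)%N ->
  `|U l - U k| <= K * (mass r (node T n l) - mass r (node T n k)).
Proof.
elim: l => [|l IH]; first by rewrite leqn0 => /eqP -> _; rewrite !subrr normr0 mulr0.
rewrite leq_eqVlt => /predU1P[-> _|]; first by rewrite !subrr normr0 mulr0.
rewrite ltnS => kl ln; have h := IH kl (ltnW ln).
have -> : U l.+1 - U k = (U l.+1 - U l) + (U l - U k) by rewrite addrA subrK.
apply: (le_trans (ler_normD _ _)); rewrite UG// normrZ ger0_norm ?subr_ge0
  ?node_mass_le//.
have := ler_wpM2l (_ : 0 <= mass r (node T n l.+1) - mass r (node T n l)) (GK l.+1).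
rewrite subr_ge0 node_mass_le// => /(_ isT).
by move: h; lra.
Qed.

Lemma step_lipschitz s t : s <= t ->
  `|U (cell T n t) - U (cell T n s)| <= K * (mass r (theta T n t) - mass r (theta T n s)).
Proof. by move=> st; apply: step_node_lipschitz; [exact: cell_mono|exact: cell_max]. Qed.

Lemma step_integral_node k : (k <= 2 ^ n)%N ->
  simple_integral nu `]0, node T n k] (fun t : mR => G (cell T n t)) = U k - U 0%N.
Proof.
have mI a b : measurable (`]a, b] : set mR) by exact: measurable_itv.
elim: k => [_|k IH kn].
  rewrite subrr (simple_integral_cst_on hdot nu (v := 0))//; last 2 first.
  - exact: step_simple.
  - by rewrite node0 => x /=; rewrite in_itv/= => /andP[x0 /(lt_le_trans x0)];
    rewrite ltxx.
  by rewrite scaler0.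
have kk : node T n k <= node T n k.+1 by exact/ltW/node_ltS.
have kT : node T n k.+1 <= T by exact: node_leT.
rewrite (itv_oc_split (node_ge0 T0 n k) kk) (simple_integral_setU hdot)//; last 2 first.
- exact: step_simple.
- exact: itv_oc_disjoint.
rewrite IH 1?ltnW// (simple_integral_cst_on hdot nu (v := G k.+1))//; last 2 first.
- exact: step_simple.
- move=> x /=; rewrite in_itv/= => xk; congr G; apply/eqP; rewrite cellP//.
  case/andP: xk => kx xk.
  by rewrite (le_trans (node_ge0 T0 n k) (ltW kx)) (le_trans xk).
rewrite nu_I_mass//; last exact: node_ge0.
by rewrite -UG// addrC addrA subrK.
Qed.

(** At nodes the integral of the slopes is exact; elsewhere the error is the integral over []t,
    theta n t]]. *)
Lemma step_integral_dist t : 0 <= t <= T ->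
  `|simple_integral nu `]0, t] (fun s : mR => G (cell T n s)) -
    (U (cell T n t) - U 0%N)| <=
  K * (mass r (theta T n t) - mass r t).
Proof.
move=> tT; have /andP[t0 tT'] := tT.
have mI a b : measurable (`]a, b] : set mR) by exact: measurable_itv.
have tth : t <= theta T n t by exact: theta_ge.
have thT : theta T n t <= T by have /andP[] := theta_itv T0 n t.
rewrite -step_integral_node; last exact: cell_max.
rewrite -/(theta T n t) (itv_oc_split t0 tth) (simple_integral_setU hdot)//; last 2 first.
- exact: step_simple.
- exact: itv_oc_disjoint.
rewrite opprD addrA subrr sub0r normrN -(nu_I_mass T0 hr)//.
by apply: (simple_integral_le_cst hdot) => //; exact: step_simple.
Qed.

End steps.
End mass_lipschitz.

(** * Existence *)

Section existence.
Context (R : realType) (E : completeNormedModType R) (dot : {dot E for idfun})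
  (hdot : norm_of_dot dot) (T : R) (T0 : 0 < T) (A : R -> E -> set E)
  (hA : forall t, 0 <= t <= T -> maximal_monotone dot (A t))
  (r : R -> R) (hr : stieltjes_function T r)
  (H1 : forall s t, 0 <= s -> s <= t -> t <= T ->
    (dis dot (A t) (A s) <= (r t - r s)%:E)%E).
Notation nu := (nu_I T0 hr).
Notation mR := (measurableTypeR R).

(** A substitute for monotonicity when the two graph points belong to operators at different times:
    (H1) costs the increment of [r], and replacing [w] by its limit [u] costs [|u - w|]. *)
Lemma inclusion_error (t th K : R) (a b w y u : E) : 0 <= t -> t <= th -> th <= T ->
  A t a b -> A th w y -> `|y| <= K ->
  - ((r th - r t) * (1 + K + `|b|) + (K + `|b|) * `|u - w|) <= dot (y - b) (u - a).
Proof.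
move=> t0 tth thT Aab Awy yK; have := dis_dot_le H1 t0 tth thT Awy Aab.
have -> : dot (y - b) (u - a) = dot (y - b) (u - w) - dot (y - b) (a - w).
  by rewrite -dotBr opprB addrA subrK.
have h1 : - (`|y - b| * `|u - w|) <= dot (y - b) (u - w).
  by have := normr_dot_le hdot (y - b) (u - w); rewrite ler_norml => /andP[].
have h2 : `|y - b| * `|u - w| <= (K + `|b|) * `|u - w|.
  by rewrite ler_wpM2r// (le_trans (ler_normB _ _))// lerD2r.
have h3 : (r th - r t) * (1 + `|y| + `|b|) <= (r th - r t) * (1 + K + `|b|).
  have [_ _ rm _] := hr.
  by rewrite ler_wpM2l ?subr_ge0 ?rm// lerD2r lerD2l.
move: h1 h2 h3; lra.
Qed.

Lemma cvg_inclusion_error (t K b : R) (th : nat -> R) (u : E) (w : nat -> E) :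
  r (th n) @[n --> \oo] --> r t -> w n @[n --> \oo] --> u ->
  (r (th n) - r t) * (1 + K + b) + (K + b) * `|u - w n| @[n --> \oo] --> (0 : R).
Proof.
move=> rth wu.
have -> : (0 : R) = (r t - r t) * (1 + K + b) + (K + b) * `|u - u|.
  by rewrite !subrr normr0 mul0r mulr0 addr0.
apply: cvgD; apply: cvgM; try exact: cvg_cst.
  by apply: cvgB => //; exact: cvg_cst.
by apply: cvg_norm; apply: cvgB => //; exact: cvg_cst.
Qed.

Section limit_point.
Context (t K : R) (th : nat -> R) (u : E) (w y : nat -> E).
Hypotheses (tT : 0 <= t <= T) (tth : forall n, t <= th n <= T)
  (Awy : forall n, A (th n) (w n) (y n)) (yK : forall n, `|y n| <= K)
  (rth : r (th n) @[n --> \oo] --> r t) (wu : w n @[n --> \oo] --> u).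

(** For a Yosida pair [(z, b)] one has [u - z = l *: b]. In the limit, [inclusion_error] reads
    [|b|^2 <= K |b|], so the Yosida approximations at [u] are bounded by [K]. *)
Lemma dom_limit : dom (A t) u.
Proof.
apply: (@dom_of_yosida_bounded _ _ _ hdot (A t) u K (hA tT)) => l z l0;
  set b := l^-1 *: _ => Azb.
have uz : u - z = l *: b by rewrite /b scalerA divff ?gt_eqF// scale1r.
have K0 : 0 <= K by exact: le_trans (yK 0%N).
have h : 0 <= l * (K * `|b| - `|b| ^+ 2).
  apply: (@cvg_ge0 _ (fun n => l * (K * `|b| - `|b| ^+ 2) +
     ((r (th n) - r t) * (1 + K + `|b|) + (K + `|b|) * `|u - w n|))).
    rewrite -[X in _ --> X]addr0; apply: cvgD; first exact: cvg_cst.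
    exact: cvg_inclusion_error.
  move=> n; have /andP[t0 _] := tT; have /andP[h1 h2] := tth n.
  have := inclusion_error u t0 h1 h2 Azb (Awy n) (yK n).
  rewrite uz dotZr dotBl -(normsq hdot).
  have : l * dot (y n) b <= l * (K * `|b|).
    rewrite ler_pM2l// (le_trans (dot_le hdot _ _))// ler_wpM2r//.
  lra.
move: h; rewrite pmulr_rge0// subr_ge0.
have [->|b0] := eqVneq b 0; first by rewrite normr0.
by rewrite expr2 ler_pM2r// normr_gt0.
Qed.

End limit_point.

(** Beyond some index all integrals lie in a ball around [v], and a ball is stable under
    midpoints. *)
Lemma hull_simple_integral (D : set mR) (g c : nat -> mR -> E) (v : E) : measurable D ->
  (forall n, simple_map (g n)) -> (forall n, mid_hull (tail g n) (c n)) ->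
  simple_integral nu D (g n) @[n --> \oo] --> v ->
  simple_integral nu D (c n) @[n --> \oo] --> v.
Proof.
move=> mD sg cg gv; apply/cvgrPdist_le => e e0.
have /cvgrPdist_le/(_ _ e0)[N _ HN] := gv.
exists N => // n /= Nn.
suff [] : simple_map (c n) /\ `|v - simple_integral nu D (c n)| <= e by [].
move: (mid_hull_le Nn (cg n)); apply: (mid_hull_tail
  (P := fun s => simple_map s /\ `|v - simple_integral nu D s| <= e)) =>
    [j Nj|s s' [ss hs] [ss' hs']].
  by split=> //; exact: HN.
split; first exact: (simple_map_comp2 (fun u v : E => 2^-1 *: (u + v))).
rewrite (_ : (fun _ => _) = fun x => 2^-1 *: s x + 2^-1 *: s' x); last first.
  by apply/funext => x; rewrite scalerDr.
rewrite (simple_integral_lin hdot)//.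
have -> : v - (2^-1 *: simple_integral nu D s + 2^-1 *: simple_integral nu D s') =
    2^-1 *: (v - simple_integral nu D s) + 2^-1 *: (v - simple_integral nu D s').
  rewrite [in LHS]opprD !scalerBr addrACA -scalerDl (_ : 2^-1 + 2^-1 = 1 :> R) ?scale1r//.
  by field.
rewrite (le_trans (ler_normD _ _))// !normrZ !ger0_norm//.
by move: hs hs'; lra.
Qed.

Lemma hull_dot_ge (g c : nat -> mR -> E) (t : R) (ginf h b u a : E) (e : nat -> R) :
  (forall n, mid_hull (tail g n) (c n)) ->
  c n t @[n --> \oo] --> ginf -> e n @[n --> \oo] --> (0 : R) ->
  (forall n, - e n <= dot (- g n t - h - b) (u - a)) ->
  0 <= dot (- ginf - h - b) (u - a).
Proof.
move=> cg cgi e0 ge; apply/ler_addgt0Pr => eps eps0.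
have /cvgrPdist_le/(_ _ eps0)[N _ HN] := e0.
apply: (@cvg_ge0 _ (fun n => dot (- c (n + N)%N t - h - b) (u - a) + eps)).
  apply: cvgD; last exact: cvg_cst.
  apply: (cvg_dot hdot); last exact: cvg_cst.
  apply: cvgB; last exact: cvg_cst.
  apply: cvgB; last exact: cvg_cst.
  by apply: cvgN; rewrite (cvg_shiftn N (fun n => c n t)).
move=> n; rewrite -lerBlDr sub0r.
move: (mid_hull_le (leq_addl n N) (cg (n + N)%N)); apply: (mid_hull_tail
  (P := fun s : mR -> E => - eps <= dot (- s t - h - b) (u - a))) => [j Nj|s s' hs hs'].
  apply: le_trans (ge j); rewrite lerN2.
  by have := HN j Nj; rewrite /= sub0r normrN; apply: le_trans; exact: ler_norm.
by move: hs hs'; rewrite !dotE; lra.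
Qed.

Context (f : R -> E) (M : R) (M0 : 0 <= M)
  (hf : strongly_measurable (lambda_I T) `[0, T] f)
  (hfM : forall t, 0 <= t <= T -> `|f t| <= M)
  (c : R) (c0 : 0 <= c)
  (H2 : forall t x, 0 <= t <= T -> dom (A t) x ->
    `|min_section (A t) x| <= c * (1 + `|x|))
  (H3 : ball_compact (\bigcup_(t in `[0, T]) dom (A t)))
  (x0 u0 : E) (hu0 : dom (A 0) u0).
Notation p := (density_lambda T0 hr).

Lemma solution_exists : exists x u g : R -> E, exists K : R,
  [/\ is_solution T nu p A f x0 u0 x u g, 0 < K &
    {ae nu, forall t, 0 <= t <= T -> `|g t| <= K}].
Proof.
have FF : Filter (almost_everywhere nu) by exact: ae_filter_ringOfSetsType.
have [_ _ _ rc] := hr.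
have [sf [ssf sfh]] := density_scale_simple T0 hr hf.
have hM : {ae nu, forall t, 0 <= t <= T -> `|p t *: f t| <= M}.
  apply: filterS2 (density_ge0 T0 hr) (density_le1 T0 hr) => t p0 p1 tT.
  rewrite normrZ ger0_norm// (le_trans _ (hfM tT))// -[leRHS]mul1r.
  by rewrite ler_wpM2r.
have [m0 [z0 [m0n z0M z0h]]] := step_approximation M0 ssf sfh hM.
have M10 : 0 <= M + 1 by rewrite addr_ge0.
(* The forcing bound is [M + 1] because of the truncation in [step_approximation]; [L] bounds the
   states and [K] the slopes. *)
pose L := expR (euler_cst c (M + 1) * mass r T) * (1 + `|u0|).
pose K := euler_cst c (M + 1) * L.
have L0 : 0 < L by rewrite mulr_gt0 ?expR_gt0// ltr_pwDl.
have K0 : 0 < K by rewrite mulr_gt0// (lt_le_trans ltr01)// euler_cst_ge1.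
have /choice[UG0 HUG0] : forall j, exists UG : (nat -> E) * (nat -> E),
    [/\ UG.1 0%N = u0,
        forall k, (k <= 2 ^ m0 j)%N -> dom (A (node T (m0 j) k)) (UG.1 k) /\ `|UG.1 k| <=
          L,
        forall k, (k < 2 ^ m0 j)%N -> [/\ A (node T (m0 j) k.+1) (UG.1 k.+1)
          (- UG.2 k.+1 - z0 j k.+1),
          UG.1 k.+1 - UG.1 k = (mass r (node T (m0 j) k.+1) - mass r (node T (m0 j) k)) *:
            UG.2 k.+1 &
          `|- UG.2 k.+1 - z0 j k.+1| <= K] &
        forall k, `|UG.2 k| <= K].
  move=> j.
  have [U [G UGP]] := euler_scheme hdot T0 hA hr H1 c0 H2 (m0 j) M10 (z0M j) hu0.
  by exists (U, G).
have cC : compact ((\bigcup_(t in `[0, T]) dom (A t)) `&` closed_ball (0 : E) L)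
  by exact: H3.
have [] := @subsequence R T T0 r hr E (fun j t => (UG0 j).1 (cell T (m0 j) t)) m0
    _ K (ltW K0) cC m0n.
- move=> j t tT; have [_ /(_ _ (cell_max T0 (m0 j) t))[dU UL] _ _] := HUG0 j; split.
    by exists (theta T (m0 j) t) => //=; rewrite in_itv/=; exact: theta_itv.
  by rewrite closed_ballE// /closed_ball_/= sub0r normrN.
- move=> j s t s0 st tT; have [_ _ HU HG] := HUG0 j.
  by apply: step_lipschitz => // k /HU[].
move=> u [phi [phin vu uK]].
pose m n := m0 (phi n); pose z n := z0 (phi n).
pose U n := (UG0 (phi n)).1; pose G n := (UG0 (phi n)).2.
have mn n : (n <= m n)%N by exact: leq_trans (phin n) (m0n _).
have zh : {ae nu, forall t, 0 <= t <= T -> z n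
  (cell T (m n) t) @[n --> \oo] --> p t *: f t}.
  apply: filterS z0h => t ht /ht; apply: cvg_trans => B [N _ HN].
  by exists N => // n /= Nn; apply: HN; exact: leq_trans (phin n).
have HU0 n : U n 0%N = u0 by have [] := HUG0 (phi n).
have HUL n k : (k <= 2 ^ m n)%N -> `|U n k| <= L.
  by have [_ h _ _] := HUG0 (phi n) => /h[].
have HUA n k : (k < 2 ^ m n)%N -> A (node T (m n) k.+1) (U n k.+1)
  (- G n k.+1 - z n k.+1).
  by have [_ _ h _] := HUG0 (phi n) => /h[].
have HUG n k : (k < 2 ^ m n)%N -> U n k.+1 - U n k =
  (mass r (node T (m n) k.+1) - mass r (node T (m n) k)) *: G n k.+1.
  by have [_ _ h _] := HUG0 (phi n) => /h[].
have HyK n k : (k < 2 ^ m n)%N -> `|- G n k.+1 - z n k.+1| <= K.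
  by have [_ _ h _] := HUG0 (phi n) => /h[].
have HGK n k : `|G n k| <= K by have [_ _ _ h] := HUG0 (phi n); exact: h.
pose v n (t : mR) := U n (cell T (m n) t); pose g n (t : mR) := G n (cell T (m n) t).
have sv n : simple_map (v n) by exact: step_simple.
have sg n : simple_map (g n) by exact: step_simple.
have gK n t : `|g n t| <= K by exact: HGK.
have vL n t : `|v n t| <= L by apply: HUL; exact: cell_max.
have {}vu t : 0 <= t <= T -> v n t @[n --> \oo] --> u t by exact: vu.
have cvg_m (W : topologicalType) (F : nat -> W) (l : W) :
    F n @[n --> \oo] --> l -> F (m n) @[n --> \oo] --> l.
  move=> Fl; apply: cvg_trans Fl => B [N _ HN].
  by exists N => // n /= Nn; apply: HN; exact: leq_trans (mn n).
have u00 : u 0 = u0.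
  have h0 : 0 <= (0 : R) <= T by rewrite lexx ltW.
  have := vu 0 h0; rewrite (_ : (fun n => _) = fun=> u0); last first.
    by apply/funext => n; rewrite /v cell0.
  by move=> h; exact: (cvg_unique (@norm_hausdorff _ E) h (cvg_cst u0)).
have mI a b : measurable (`]a, b] : set mR) by exact: measurable_itv.
have rth t : 0 <= t <= T -> r (theta T (m n) t) @[n --> \oo] --> r t.
  by move=> tT; apply: (cvg_m _ (fun n => r (theta T n t))); exact: cvg_theta.
have thP t : 0 <= t <= T -> forall n, t <= theta T (m n) t <= T.
  by move=> tT n; rewrite theta_ge//; have /andP[] := theta_itv T0 (m n) t.
(* The point [0] is excluded: cell [0] carries the initial value, which was not produced by a
   resolvent step. *)
have Ayk t n : 0 < t <= T -> A (theta T (m n) t) (v n t)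
  (- g n t - z n (cell T (m n) t)) /\
    `|- g n t - z n (cell T (m n) t)| <= K.
  move=> /andP[t0 tT]; rewrite /v /g /theta.
  have := cell_max T0 (m n) t; case E1 : (cell T (m n) t) => [|k] kn.
    have tT' : 0 <= t <= T by rewrite ltW.
    have := cell_eq0 T0 (m n) tT'; rewrite E1 eqxx => /esym/eqP t00.
    by rewrite t00 ltxx in t0.
  by split; [exact: HUA|exact: HyK].
have Ig t : 0 <= t <= T -> simple_integral nu `]0, t] (g n) @[n --> \oo] --> u t - u 0.
  move=> tT; apply/subr_cvg0; apply/norm_cvg0P.
  have h : K * (mass r (theta T (m n) t) - mass r t) +
    `|v n t - u t| @[n --> \oo] --> (0 : R).
    have -> : (0 : R) = K * (mass r t - mass r t) + `|u t - u t|
      by rewrite !subrr normr0 mulr0 addr0.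
    apply: cvgD.
      apply: cvgM; first exact: cvg_cst.
      apply: cvgB; last exact: cvg_cst.
      by apply: (cvg_m _ (fun n => mass r (theta T n t))); exact: mass_theta hr _ tT.
    by apply: cvg_norm; apply: cvgB; [exact: vu|exact: cvg_cst].
  apply: (@squeeze_cvgr _ _ _ _ (fun=> 0) _ _ _ _ _ h); last exact: cvg_cst.
  near=> n; rewrite normr_ge0/=.
  have -> : simple_integral nu `]0, t] (g n) - (u t - u 0) =
     (simple_integral nu `]0, t] (g n) - (U n (cell T (m n) t) - U n 0%N)) +
       (v n t - u t).
    by rewrite HU0 u00 /v !opprB -[RHS]addrA; congr (_ + _); rewrite addrA subrK.
  rewrite (le_trans (ler_normD _ _))// lerD2r.
  exact: (step_integral_dist T0 hr hdot (HUG n) (HGK n) tT).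
have [c1 [ginf [c1g c1i]]] := mazur hdot nu sg gK.
have sc1 n : simple_map (c1 n) by exact: mid_hull_simple (c1g n).
have c1K n t : `|c1 n t| <= K by exact: (mid_hull_bounded gK (c1g n)).
(* The position [x] is the limit of the integrals of the step maps [v n], which exists by dominated
   convergence. *)
have /choice[xi Hxi] : forall t, exists xit : E,
    0 <= t <= T -> simple_integral nu `]0, t] (v n) @[n --> \oo] --> xit.
  move=> t; have [tT|tT] := boolP (0 <= t <= T); last by exists 0.
  have /cvg_ex[l hl] : cvgn (fun n => simple_integral nu `]0, t] (v n)).
    apply: (@bounded_limit_cvg _ _ _ _ _ hdot nu _ u v L) => //.
    apply: aeW => s /=; rewrite in_itv/= => /andP[s0 st]; apply: vu.
    by case/andP: tT => _ tT; rewrite ltW//= (le_trans st).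
  by exists l.
exists (fun t => x0 + xi t), u, ginf, K; split=> //; last first.
  apply: filterS c1i => t cg _.
  rewrite -(cvg_lim _ (cvg_norm cg))//; apply: limr_le; first by apply/cvg_ex; eexists;
    exact: cvg_norm cg.
  by near=> n.
have xiL s t : 0 <= s -> s <= t -> t <= T -> `|xi t - xi s| <= L * (mass r t - mass r s).
  move=> s0 st tT; have sT : 0 <= s <= T by rewrite s0 (le_trans st).
  have tT' : 0 <= t <= T by rewrite tT (le_trans s0).
  have h : `|simple_integral nu `]0, t] (v n) - simple_integral nu `]0, s]
    (v n)| @[n --> \oo] --> `|xi t - xi s|.
    by apply: cvg_norm; apply: cvgB; exact: Hxi.
  rewrite -(cvg_lim _ h)//; apply: limr_le; first by apply/cvg_ex; eexists; exact: h.
  near=> n.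
  rewrite (itv_oc_split s0 st) (simple_integral_setU hdot)//; last exact: itv_oc_disjoint.
  rewrite addrAC subrr add0r -(nu_I_mass T0 hr)//.
  by apply: (simple_integral_le_cst hdot).
split=> //.
(* The norm of a pair is the maximum, and [x] and [u] have Lipschitz constants [L] and [K]; their
   sum serves for both. *)
- apply: (@bvrc_mass_lipschitz _ _ _ hr _ _ (L + K)) => s t s0 st tT.
  have m0' : 0 <= mass r t - mass r s by rewrite subr_ge0 (mass_le hr).
  rewrite prod_normE /= ge_max; apply/andP; split.
    rewrite opprD addrACA subrr add0r (le_trans (xiL _ _ s0 st tT))//.
    by rewrite ler_wpM2r// lerDl ltW.
  by rewrite (le_trans (uK _ _ s0 st tT))// ler_wpM2r// lerDr ltW.
- move=> t tT; have /andP[t0 tT'] := tT.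
  apply: (bounded_limit_bochner (s := v) (K := L)) => //; last first.
    by rewrite addrC addKr; exact: Hxi.
  by apply: aeW => s /=; rewrite in_itv/= => /andP[s0 st]; apply: vu;
    rewrite ltW//= (le_trans st).
- move=> t tT.
  move: (tT) => /andP[]; rewrite le_eqVlt => /predU1P[<- _|t0 tT']; first by rewrite u00.
  have t0T : 0 < t <= T by rewrite t0.
  exact: (dom_limit tT (thP t tT) (fun n => (Ayk t n t0T).1) (fun n => (Ayk t n t0T).2)
    (rth t tT) (vu t tT)).
- split.
    move=> t tT; have /andP[t0 tT'] := tT.
    apply: (bounded_limit_bochner (s := c1) (K := K)) => //.
      by apply: filterS c1i => s cs _.
    by apply: (hull_simple_integral (g := g)) => //; exact: Ig.
  (* Neither [lambda] nor [dr] has an atom at [0], so the inclusion missing at [0] does not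
     matter. *)
  have ae0 : {ae nu, forall t, t != 0}.
    by exists [set 0]; split=> //; [exact: nu_I_set0|move=> t /= /negP;
      rewrite negbK => /eqP].
  apply: filterS3 ae0 zh c1i => t t0' zt ct tT.
  have t0 : 0 < t by rewrite lt_neqAle eq_sym t0'; case/andP: tT.
  exists (- ginf t - p t *: f t); last by rewrite subrK.
  apply: (maximal_monotoneP (hA tT)) => a b Aab.
  have tT0 : 0 < t <= T by rewrite t0; case/andP: tT.
  (* The error of [inclusion_error], plus the cost of replacing the step value of [z n] by
     [p t *: f t]. *)
  pose e n := (r (theta T (m n) t) - r t) * (1 + K + `|b|) + (K + `|b|) * `|u t - v n t| +
     `|z n (cell T (m n) t) - p t *: f t| * `|u t - a|.
  apply: (@hull_dot_ge g c1 t _ _ _ _ _ e) => //.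
  - have h : e n @[n --> \oo] --> (0 + `|p t *: f t - p t *: f t| * `|u t - a| : R).
      apply: cvgD; first by apply: cvg_inclusion_error; [exact: rth|exact: vu].
      apply: cvgM; last exact: cvg_cst.
      by apply: cvg_norm; apply: cvgB; [exact: zt|exact: cvg_cst].
    by rewrite subrr normr0 mul0r addr0 in h.
  move=> n; have [Ay yK] := Ayk t n tT0; have /andP[h1 h2] := thP t tT n.
  have := inclusion_error (u t) (ltW t0) h1 h2 Aab Ay yK.
  have := normr_dot_le hdot (z n (cell T (m n) t) - p t *: f t) (u t - a).
  rewrite ler_norml => /andP[+ _]; rewrite /e.
  rewrite !dotBl dotNl; lra.
Unshelve. all: by end_near. Qed.

End existence.

(** * Uniqueness *)

Section bochner_dist.
Context d (X : measurableType d) (R : realType) (E : completeNormedModType R)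
  (dot : {dot E for idfun}) (hdot : norm_of_dot dot)
  (mu : {finite_measure set X -> \bar R}).

(** The limit of [simple_integral_dist] along a sequence defining the Bochner integral; the
    right-hand side may be infinite, which is treated apart. *)
Lemma bochner_dist (D : set X) (g s : X -> E) (v : E) : measurable D ->
  is_bochner_integral mu D g v -> simple_map s ->
  ((`|simple_integral mu D s - v|)%:E <= \int[mu]_(x in D) (`|g x - s x|)%:E)%E.
Proof.
move=> mD [sg [s' [ss' s'0 sv]]] ss.
have h : (`|simple_integral mu D s - simple_integral mu D (s' n)|)%:E @[n --> \oo] -->
    (`|simple_integral mu D s - v|)%:E.
  apply: cvg_EFin; first by near=> n.
  by apply: cvg_norm; apply: cvgB => //; exact: cvg_cst.
have [fin|] := boolP ((\int[mu]_(x in D) (`|g x - s x|)%:E)%E \is a fin_num); last first.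
  rewrite ge0_fin_numE ?integral_ge0// ltey negbK => /eqP ->; exact: leey.
have h' : (\int[mu]_(x in D) (`|g x - s x|)%:E + \int[mu]_(x in D) (`|g x - s' n x|)%:E)%E
    @[n --> \oo] --> (\int[mu]_(x in D) (`|g x - s x|)%:E)%E.
  rewrite -[X in _ --> X]adde0; apply: cvgeD => //; last exact: cvg_cst.
  exact: fin_num_adde_defr.
rewrite -(cvg_lim _ h)// -(cvg_lim _ h')//; apply: lee_lim.
- by apply/cvg_ex; eexists; exact: h.
- by apply/cvg_ex; eexists; exact: h'.
near=> n; apply: (simple_integral_dist hdot) => //; exact: (ss' n).1.
Unshelve. all: by end_near. Qed.

End bochner_dist.

Section uniqueness.
Context (R : realType) (E : completeNormedModType R) (dot : {dot E for idfun})
  (hdot : norm_of_dot dot) (T : R) (T0 : 0 < T)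
  (r : R -> R) (hr : stieltjes_function T r).
Notation nu := (nu_I T0 hr).
Notation mR := (measurableTypeR R).

Let mI (a b : R) : measurable (`]a, b] : set mR).
Proof. exact: measurable_itv. Qed.

Lemma simple_map_norm_bounded (s : mR -> E) : simple_map s ->
  exists2 K, 0 <= K & forall x, `|s x| <= K.
Proof.
move=> ss; have [K HK] := simple_map_bounded (simple_map_comp (fun y : E => `|y|) ss).
exists K; first by apply: le_trans (HK 0).
by move=> x; have := HK x; rewrite /= normr_id.
Qed.

Section chain.
Context (s : mR -> E) (ss : simple_map s).
Let W (t : R) := simple_integral nu `]0, t] s.

Lemma primitive_split a b : 0 <= a -> a <= b -> W b = W a + simple_integral nu `]a, b] s.
Proof.
move=> a0 ab; rewrite /W (itv_oc_split a0 ab) (simple_integral_setU hdot)//.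
exact: itv_oc_disjoint.
Qed.

Lemma primitive_lipschitz K a b : (forall x, `|s x| <= K) -> 0 <= a -> a <= b -> b <= T ->
  `|W b - W a| <= K * (mass r b - mass r a).
Proof.
move=> sK a0 ab bT; rewrite (primitive_split a0 ab) addrAC subrr add0r
  -(nu_I_mass T0 hr)//.
exact: (simple_integral_le_cst hdot).
Qed.

Lemma primitive0 : W 0 = 0.
Proof.
rewrite /W (simple_integral_cst_on hdot nu (v := 0))// ?scaler0//.
by move=> x /=; rewrite in_itv/= => /andP[x0 /(lt_le_trans x0)]; rewrite ltxx.
Qed.

(* |a|^2 - |b|^2 <= 2 <a, a - b>, summed over a partition of ]0, t]. *)
Lemma chain_step t n : 0 < t <= T ->
  dot (W t) (W t) <= 2 * \int[nu]_(x in `]0, t]) dot (W (theta t n x)) (s x).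
Proof.
move=> /andP[t0 tT].
have int D : measurable D -> nu.-integrable D
  (EFin \o (fun x => dot (W (theta t n x)) (s x))).
  move=> mD; apply: simple_dot_integrable => //.
  exact: (simple_map_comp (fun k => W (node t n k)) (cell_simple t0 n)).
suff H k : (k <= 2 ^ n)%N -> dot (W (node t n k)) (W (node t n k)) <=
    2 * \int[nu]_(x in `]0, node t n k]) dot (W (theta t n x)) (s x).
  by have := H _ (leqnn _); rewrite node_last.
elim: k => [_|k IH kn].
  rewrite node0 primitive0 dot0l (_ : `]0, 0]%classic = set0) ?Rintegral_set0 ?mulr0//.
  by apply/seteqP; split=> x //=; rewrite in_itv/= => /andP[x0 /(lt_le_trans x0)];
    rewrite ltxx.
have k0 : 0 <= node t n k by exact: node_ge0.
have kk : node t n k <= node t n k.+1 by exact/ltW/node_ltS.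
have kt : node t n k.+1 <= t by exact: node_leT.
rewrite [in leRHS](itv_oc_split k0 kk) Rintegral_setU//; last 2 first.
- by apply: int; exact: measurableU.
- exact: itv_oc_disjoint.
(* On this cell [W (theta t n x)] is constantly the value at the right end, so the integral is the
   increment of [W] paired with its new value; the square of the increment is what the inequality
   drops. *)
have -> : \int[nu]_(x in `]node t n k, node t n k.+1]) dot (W (theta t n x)) (s x) =
    dot (W (node t n k.+1) - W (node t n k)) (W (node t n k.+1)).
  rewrite [X in _ = dot (X - _) _](primitive_split k0 kk) addrAC subrr add0r
    (dot_simple_integral dot)//.
  apply: eq_Rintegral => x /set_mem; rewrite /= in_itv/= => xk.
  have /eqP E1 : cell t n x == k.+1.
    rewrite (cellP t0)//; case/andP: xk => kx xk.
    by rewrite (le_trans k0 (ltW kx)) (le_trans xk).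
  by rewrite /theta E1 dotC.
have := IH (ltnW kn); have := dot_ge0 dot (W (node t n k.+1) - W (node t n k)).
by rewrite !dotE (dotC _ (W (node t n k)) (W (node t n k.+1))); lra.
Qed.

Lemma primitive_theta t x : 0 < t <= T -> 0 <= x <= t ->
  W (theta t n x) @[n --> \oo] --> W x.
Proof.
move=> /andP[t0 tT] xt; have [K K0 sK] := simple_map_norm_bounded ss.
apply: (cvg_theta t0) => // y /andP[y0 yt].
have [_] : bvrc T W by apply: (bvrc_mass_lipschitz hr (K := K)) => *;
  exact: primitive_lipschitz.
by apply; rewrite y0 (lt_le_trans yt).
Qed.

Lemma primitive_bounded t : 0 <= t <= T -> `|W t| <= \int[nu]_(x in `]0, T]) `|s x|.
Proof.
move=> /andP[t0 tT]; apply: (le_trans (simple_integral_le hdot nu (mI 0 t) ss)).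
rewrite (itv_oc_split t0 tT) Rintegral_setU//.
- by rewrite lerDl Rintegral_ge0.
- by apply: simple_map_integrable; [exact: measurableU|exact:
  (simple_map_comp (fun y => `|y|))].
- exact: itv_oc_disjoint.
Qed.

Lemma measurable_primitive_dot t : 0 < t <= T ->
  measurable_fun (`]0, t] : set mR) (fun x => dot (W x) (s x)).
Proof.
move=> tT; have /andP[t0 _] := tT.
apply: (measurable_fun_cvg (h := fun n x => dot (W (theta t n x)) (s x))) => [n|x].
  apply: simple_map_measurable; apply: (simple_map_comp2 (fun u v => dot u v)) => //.
  exact: (simple_map_comp (fun k => W (node t n k)) (cell_simple t0 n)).
rewrite /= in_itv/= => /andP[x0 xt].
apply: (cvg_dot hdot); last exact: cvg_cst.
by apply: primitive_theta => //; rewrite ltW.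
Qed.

(** Dominated convergence in [chain_step]: the primitive of a simple map is right continuous, hence
    [W (theta t n x)] tends to [W x]. *)
Lemma chain_simple t : 0 < t <= T ->
  dot (W t) (W t) <= 2 * \int[nu]_(x in `]0, t]) dot (W x) (s x).
Proof.
move=> tT; have /andP[t0 tT'] := tT.
have [K K0 sK] := simple_map_norm_bounded ss.
set B := \int[nu]_(x in `]0, T]) `|s x|.
have WB x : 0 <= x <= T -> `|W x| <= B by exact: primitive_bounded.
have [|||||_ _ h] := @dominated_convergence _ _ _ nu `]0, t] (mI 0 t)
    (fun n x => (dot (W (theta t n x)) (s x))%:E) (fun x => (dot (W x) (s x))%:E)
      (cst (B * K)%:E).
- move=> n; apply/measurable_EFinP.
  apply: simple_map_measurable; apply: (simple_map_comp2 (fun u v => dot u v)) => //.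
  exact: (simple_map_comp (fun k => W (node t n k)) (cell_simple t0 n)).
- by apply/measurable_EFinP; apply: measurable_primitive_dot.
- apply: aeW => x; rewrite /= in_itv/= => /andP[x0 xt].
  apply: cvg_EFin; first by near=> n.
  apply: (cvg_dot hdot); last exact: cvg_cst.
  by apply: primitive_theta => //; rewrite ltW.
- apply: (@bounded_integrable _ _ _ _ (cst (B * K)) _ `|B * K|) => //;
  exact: measurable_cst.
- apply: aeW => x n _ /=; rewrite lee_fin (le_trans (normr_dot_le hdot _ _))//.
  apply: ler_pM => //; apply: WB; have := tT'.
  by have /andP[-> h] := theta_itv t0 n x; move=> /(le_trans h).
have hf : 2 * \int[nu]_(x in `]0, t]) dot (W (theta t n x)) (s x) @[n --> \oo] -->
    2 * \int[nu]_(x in `]0, t]) dot (W x) (s x).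
  apply: cvgM; first exact: cvg_cst.
  apply: fine_cvg; rewrite fineK; first exact: h.
  apply: integrable_fin_num => //; apply: (@bounded_integrable _ _ _ _ _ _ (B * K)) => //.
    exact: measurable_primitive_dot.
  move=> x; rewrite /= in_itv/= => /andP[x0 xt].
  rewrite (le_trans (normr_dot_le hdot _ _))//; apply: ler_pM => //; apply: WB.
  by rewrite ltW//= (le_trans xt).
rewrite -(cvg_lim _ hf)//; apply: limr_ge; first by apply/cvg_ex; eexists; exact: hf.
by near=> n; exact: chain_step.
Unshelve. all: by end_near. Qed.

End chain.

Lemma measurable_norm (g : mR -> E) (D : set mR) : limit_map g ->
  measurable_fun D (fun x => `|g x|).
Proof.
move=> lg; apply: (measurable_funS measurableT) => //.
by apply: limit_map_measurable; exact: limit_map_norm.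
Qed.

(** The energy inequality is available only for simple densities. It is applied to [s n - s' n],
    whose primitive is uniformly within [e n] of [w], and the sign condition on
    [dot (g x - g' x) (w x)] is used up to errors that vanish in L1. *)
Lemma uniqueness_core (w : R -> E) (g g' : mR -> E) (s s' : nat -> mR -> E) :
  limit_map g -> limit_map g' ->
  (forall n, simple_map (s n)) -> (forall n, simple_map (s' n)) ->
  (\int[nu]_(x in `]0%R, T]) (`|g x - s n x| + `|g' x - s' n x|)%:E)%E
    @[n --> \oo] --> 0%E ->
  (forall n t, 0 <= t <= T ->
    ((`|simple_integral nu `]0, t] (fun x => s n x - s' n x) - w t|)%:E <=
     \int[nu]_(x in `]0%R, T]) (`|g x - s n x| + `|g' x - s' n x|)%:E)%E) ->
  {ae nu, forall x, 0 < x <= T -> dot (g x - g' x) (w x) <= 0} ->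
  forall t, 0 < t <= T -> w t = 0.
Proof.
move=> lg lg' ss ss' hd hw hG t tT; have /andP[t0 tT'] := tT.
pose d n (x : mR) := `|g x - s n x| + `|g' x - s' n x|.
pose b (x : mR) := `|g x| + `|g' x|.
pose sg n (x : mR) := s n x - s' n x.
have ssg n : simple_map (sg n) by exact: (simple_map_comp2 (fun u v => u - v)).
have d0 n x : 0 <= d n x by rewrite addr_ge0.
have b0 x : 0 <= b x by rewrite addr_ge0.
have ld n : limit_map (fun x => g x - s n x) by apply: limit_mapB => //;
  exact: limit_map_simple.
have ld' n : limit_map (fun x => g' x - s' n x) by apply: limit_mapB => //;
  exact: limit_map_simple.
have md (D : set mR) n : measurable_fun D (EFin \o d n).
  by apply/measurable_EFinP; apply: measurable_funD; exact: measurable_norm.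
have mb (D : set mR) : measurable_fun D (EFin \o b).
  by apply/measurable_EFinP; apply: measurable_funD; exact: measurable_norm.
have /fine_cvgP[[N _ HN] he] := hd.
pose e n := fine (\int[nu]_(x in `]0%R, T]) (d n x)%:E)%E.
have eE n : (N <= n)%N -> (\int[nu]_(x in `]0%R, T]) (d n x)%:E)%E = (e n)%:E.
  by move=> Nn; rewrite /e fineK//; exact: HN.
have e0 n : 0 <= e n by rewrite fine_ge0// integral_ge0// => x _; rewrite lee_fin.
have int_sg n : (\int[nu]_(x in `]0%R, T]) (`|sg n x|)%:E)%E = (\int[nu]_(x in `]0, T])
  `|sg n x|)%:E.
  rewrite /Rintegral fineK//; apply: integrable_fin_num => //.
  by apply: simple_map_integrable => //; exact: (simple_map_comp (fun y => `|y|) (ssg n)).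
(* Integrability of [|g| + |g'|] follows from finiteness of the L1 error at the single index [N],
   the simple maps being integrable. *)
have [B BE] : exists B : R, (\int[nu]_(x in `]0%R, T]) (b x)%:E)%E = B%:E.
  exists (fine (\int[nu]_(x in `]0%R, T]) (b x)%:E)%E); rewrite fineK//.
  rewrite ge0_fin_numE; last by apply: integral_ge0 => x _; rewrite lee_fin.
  pose q (x : mR) := `|s N x| + `|s' N x|.
  have sq : simple_map q by exact: (simple_map_comp2 (fun u v => `|u| + `|v|)).
  apply: (@le_lt_trans _ _ (\int[nu]_(x in `]0%R, T]) ((d N x)%:E + (q x)%:E))%E).
    apply: ge0_le_integral => //.
    - by move=> x _; rewrite lee_fin.
    - by apply: emeasurable_funD; [exact (md _ _)|apply/measurable_EFinP;
      exact: simple_map_measurable].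
    - move=> x _; rewrite -EFinD lee_fin /b /d /q addrACA lerD//.
        by rewrite -{1}(subrK (s N x) (g x)) ler_normD.
      by rewrite -{1}(subrK (s' N x) (g' x)) ler_normD.
  rewrite ge0_integralD//; last 4 first.
  - by move=> x _; rewrite lee_fin.
  - exact (md _ _).
  - by move=> x _; rewrite lee_fin addr_ge0.
  - by apply/measurable_EFinP; exact: simple_map_measurable.
  rewrite eE// lte_add_pinfty ?ltry// ltey_eq.
  by apply/orP; left; apply: integrable_fin_num => //; exact: simple_map_integrable.
have B0 : 0 <= B by rewrite -lee_fin -BE integral_ge0// => x _; rewrite lee_fin.
have bound n : (N <= n)%N -> dot (simple_integral nu `]0, t] (sg n))
  (simple_integral nu `]0, t] (sg n)) <=
    2 * ((B + e n) * e n + e n * B).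
  move=> Nn; apply: (le_trans (chain_simple (ssg n) tT)); rewrite ler_pM2l//.
  set W := fun x => simple_integral nu `]0, x] (sg n).
  have sgB : \int[nu]_(x in `]0, T]) `|sg n x| <= B + e n.
    rewrite -lee_fin -int_sg EFinD -BE -eE// -ge0_integralD//; last 3 first.
    - by move=> x _; rewrite lee_fin.
    - by move=> x _; rewrite lee_fin.
    - exact (md _ _).
    apply: ge0_le_integral => //.
    - by apply/measurable_EFinP; apply: simple_map_measurable;
      exact: (simple_map_comp (fun y => `|y|) (ssg n)).
    - by apply: emeasurable_funD; [exact (mb _)|exact (md _ _)].
    - move=> x _; rewrite -EFinD lee_fin /b /d addrACA.
      rewrite (le_trans (ler_normB _ _))// lerD//.
        by rewrite -{1}(subKr (g x) (s n x)) ler_normB.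
      by rewrite -{1}(subKr (g' x) (s' n x)) ler_normB.
  have WB x : 0 <= x <= T -> `|W x| <= B + e n.
    by move=> xT; apply: le_trans sgB; exact: primitive_bounded.
  have Ww x : 0 <= x <= T -> `|W x - w x| <= e n.
    by move=> xT; rewrite -lee_fin -eE//; exact: hw.
  (* The two terms bound the errors of replacing [sg n] by [g - g'] and then [W] by [w]. *)
  pose psi x := (B + e n) * d n x + e n * b x.
  have psiE x : (psi x)%:E = ((B + e n)%:E * (d n x)%:E + (e n)%:E * (b x)%:E)%E by [].
  have psi0 x : (0 <= (psi x)%:E)%E by rewrite lee_fin addr_ge0// mulr_ge0// addr_ge0.
  have mpsi D : measurable_fun D (EFin \o psi).
    apply/measurable_EFinP; apply: measurable_funD; apply: measurable_funM => //.
    + by apply/measurable_EFinP; exact (md _ _).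
    + by apply/measurable_EFinP; exact (mb _).
  have mphi := measurable_primitive_dot (ssg n) tT.
  have [K K0 sK] := simple_map_norm_bounded (ssg n).
  have phiK x : (`]0, t]%classic : set mR) x -> `|dot (W x) (sg n x)| <= (B + e n) * K.
    rewrite /= in_itv/= => /andP[x0 xt]; apply: (le_trans (normr_dot_le hdot _ _)).
    by apply: ler_pM => //; apply: WB; rewrite ltW//= (le_trans xt).
  have mmax : measurable_fun (`]0, t] : set mR) (fun x => Num.max (dot (W x) (sg n x)) 0).
    by apply: measurable_maxr => //; exact: measurable_cst.
  have imax : nu.-integrable `]0, t] (EFin \o (fun x => Num.max (dot (W x) (sg n x)) 0)).
    apply: (@bounded_integrable _ _ _ _ _ _ ((B + e n) * K)) => // x /phiK.
    apply: le_trans; rewrite [leLHS]ger0_norm; last by rewrite le_max lexx orbT.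
    by rewrite ge_max ler_norm normr_ge0.
  (* The positive part is taken because the almost everywhere comparison of integrals is for
     nonnegative integrands; [psi] is nonnegative and still dominates it. *)
  apply: (@le_trans _ _ (\int[nu]_(x in `]0, t]) Num.max (dot (W x) (sg n x)) 0)).
    apply: le_Rintegral => //.
    - exact: (@bounded_integrable _ _ _ _ _ _ ((B + e n) * K)).
    - by move=> x _; rewrite le_max lexx.
  rewrite -lee_fin /Rintegral fineK; last by apply: integrable_fin_num.
  apply: (@le_trans _ _ (\int[nu]_(x in `]0%R, t]) (psi x)%:E)%E).
    apply: ae_ge0_le_integral => //.
    - by move=> x _; rewrite lee_fin le_max lexx orbT.
    - by apply/measurable_EFinP; apply: measurable_maxr => //; exact: measurable_cst.
    - have FF : Filter (almost_everywhere nu) by exact: ae_filter_ringOfSetsType.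
      apply: filterS hG => x hx; rewrite /= in_itv/= => /andP[x0 xt].
      have xT : x <= T by exact: le_trans xt tT'.
      rewrite lee_fin ge_max; apply/andP; split; last by rewrite -lee_fin.
      have -> : dot (W x) (sg n x) = dot (W x) (sg n x - (g x - g' x)) +
         dot (W x - w x) (g x - g' x) + dot (g x - g' x) (w x).
        move: (sg n x) (g x - g' x) (W x) (w x) => y1 y2 y3 y4.
        by rewrite !dotE (dotC _ y2 y4); ring.
      have x0T : 0 <= x <= T by rewrite ltW.
      have h1 : dot (W x) (sg n x - (g x - g' x)) <= (B + e n) * d n x.
        apply: (le_trans (dot_le hdot _ _)); apply: ler_pM => //; first exact: WB.
        have -> : sg n x - (g x - g' x) = - (g x - s n x) + (g' x - s' n x).
          by rewrite /sg !opprB [LHS]addrACA [RHS]addrACA; congr (_ + _); rewrite addrC.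
        by rewrite /d (le_trans (ler_normD _ _))// normrN.
      have h2 : dot (W x - w x) (g x - g' x) <= e n * b x.
        apply: (le_trans (dot_le hdot _ _)); apply: ler_pM => //; first exact: Ww.
        exact: ler_normB.
      have := hx; rewrite x0 xT => /(_ isT) h3.
      by rewrite /psi; move: h1 h2 h3; lra.
  apply: (@le_trans _ _ (\int[nu]_(x in `]0%R, T]) (psi x)%:E)%E).
    apply: ge0_subset_integral => //.
    by apply: subset_itvl; rewrite bnd_simp.
  under eq_integral do rewrite psiE.
  rewrite ge0_integralD//; last 4 first.
  - by move=> x _; rewrite mule_ge0 ?lee_fin// addr_ge0.
  - by apply: measurable_funeM; exact (md _ _).
  - by move=> x _; rewrite mule_ge0 ?lee_fin.
  - by apply: measurable_funeM; exact (mb _).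
  rewrite !ge0_integralZl//; first by rewrite eE// BE.
  - by move=> x _; rewrite lee_fin.
  - by rewrite lee_fin.
  - exact (md _ _).
  - by move=> x _; rewrite lee_fin.
  - by rewrite lee_fin addr_ge0.
have ce : e n @[n --> \oo] --> (0 : R) by exact: he.
have cW : simple_integral nu `]0, t] (sg n) @[n --> \oo] --> w t.
  apply/subr_cvg0; apply/norm_cvg0P.
  apply: (@squeeze_cvgr _ _ _ _ (fun=> 0) _ _ _ _ _ ce); last exact: cvg_cst.
  exists N => // n /= Nn; rewrite normr_ge0/= -lee_fin -eE//; apply: hw.
  by rewrite ltW.
have cb : 2 * ((B + e n) * e n + e n * B) @[n --> \oo] --> (0 : R).
  have -> : (0 : R) = 2 * ((B + 0) * 0 + 0 * B) by rewrite !mulr0 mul0r addr0 mulr0.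
  apply: cvgM; first exact: cvg_cst.
  apply: cvgD; apply: cvgM => //; try exact: cvg_cst.
  by apply: cvgD => //; exact: cvg_cst.
apply/eqP; rewrite -normr_eq0 -sqrf_eq0 (normsq hdot) eq_le dot_ge0 andbT.
by apply: (ler_cvg_to (cvg_dot hdot cW cW) cb); exists N => // n; exact: bound.
Qed.

Lemma bochner_fine_dist (t : R) (N : set mR) (g g' s : mR -> E) (v : E) :
  0 <= t <= T -> measurable N -> nu N = 0%E -> limit_map g' ->
  (forall x, `]0, T]%classic x -> ~ N x -> g x = g' x) -> simple_map s ->
  is_bochner_integral nu `]0, t] g v ->
  ((`|simple_integral nu `]0, t] s - v|)%:E <= \int[nu]_(x in `]0%R, T])
    (`|g' x - s x|)%:E)%E.
Proof.
move=> /andP[t0 tT] mN N0 lg' gg' ss bg.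
apply: (le_trans (bochner_dist hdot (mI 0 t) bg ss)).
have sub : (`]0, t]%classic : set mR) `<=` `]0, T] by apply: subset_itvl;
  rewrite bnd_simp.
rewrite (ae_eq_lower_integral (mI 0 t) mN N0 (g := fun x => (`|g' x - s x|)%:E))//.
- apply: ge0_subset_integral => //.
  by apply: (measurable_funS measurableT) => //; exact: measurable_norm_sub.
- exact: measurable_norm_sub.
- by move=> x xt Nx; rewrite gg'//; exact: sub.
Qed.

Context (A : R -> E -> set E) (f : R -> E) (p : R -> R) (x0 u0 : E)
  (hA : forall t, 0 <= t <= T -> maximal_monotone dot (A t)).

Lemma solution_unique (x u g x' u' g' : R -> E) :
  is_solution T nu p A f x0 u0 x u g -> is_solution T nu p A f x0 u0 x' u' g' ->
  forall t, 0 <= t <= T -> x' t = x t /\ u' t = u t.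
Proof.
move=> [_ xE u0E dA [du Ag]] [_ xE' u0E' dA' [du' Ag']].
have FF : Filter (almost_everywhere nu) by exact: ae_filter_ringOfSetsType.
have TT : 0 <= T <= T by rewrite lexx ltW.
have [sg [s [ss hs _]]] := du _ TT; have [sg' [s' [ss' hs' _]]] := du' _ TT.
have [N [mN N0 [gl lg gg]]] := strongly_measurable_rep (mI 0 T) sg.
have [N' [mN' N0' [gl' lg' gg']]] := strongly_measurable_rep (mI 0 T) sg'.
have sss n : simple_map (s n) by exact: (ss n).1.
have sss' n : simple_map (s' n) by exact: (ss' n).1.
have intD n : (\int[nu]_(x in `]0%R, T]) (`|gl x - s n x| + `|gl' x - s' n x|)%:E =
    \int[nu]_(x in `]0%R, T]) (`|gl x - s n x|)%:E + \int[nu]_(x in `]0%R, T])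
      (`|gl' x - s' n x|)%:E)%E.
  rewrite -ge0_integralD//.
  - by apply: (measurable_funS measurableT) => //; exact: measurable_norm_sub.
  - by apply: (measurable_funS measurableT) => //; exact: measurable_norm_sub.
have rep (h hl : mR -> E) (M : set mR) (q : mR -> E) : measurable M -> nu M = 0%E ->
  limit_map hl ->
    (forall x, `]0, T]%classic x -> ~ M x -> h x = hl x) -> simple_map q ->
    (\int[nu]_(x in `]0%R, T]) (`|h x - q x|)%:E = \int[nu]_(x in `]0%R, T])
      (`|hl x - q x|)%:E)%E.
  move=> mM M0 lh hh sq; apply: (ae_eq_lower_integral (mI 0 T) mM M0) => //.
    exact: measurable_norm_sub.
  by move=> y yT My; rewrite hh.
have u_eq t : 0 <= t <= T -> u' t = u t.
  move=> /andP[]; rewrite le_eqVlt => /predU1P[<- _|t0 tT]; first by rewrite u0E u0E'.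
  apply/esym/eqP; rewrite -subr_eq0; apply/eqP.
  apply: (@uniqueness_core (fun t => u t - u' t) gl gl' s s') => //; last by rewrite t0.
  - rewrite (_ : (fun n => _) = fun n => (\int[nu]_(x in `]0%R, T]) (`|g x - s n x|)%:E +
        \int[nu]_(x in `]0%R, T]) (`|g' x - s' n x|)%:E)%E); last first.
      by apply/funext => n; rewrite intD (rep _ _ _ _ mN N0 lg gg)//
        (rep _ _ _ _ mN' N0' lg' gg').
    by rewrite -[X in _ --> X]adde0; apply: cvgeD.
  - move=> n y yT; rewrite intD (simple_integralB hdot)//.
    apply: (@le_trans _ _ ((`|simple_integral nu `]0, y] (s n) - (u y - u 0)|)%:E +
       (`|simple_integral nu `]0, y] (s' n) - (u' y - u' 0)|)%:E)%E).
      rewrite -EFinD lee_fin (le_trans _ (ler_normB _ _))//.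
      rewrite u0E u0E' le_eqVlt; apply/orP; left; apply/eqP; congr (`|_|).
      have assoc (a c e : E) : a - (c - e) = a - c + e by rewrite opprB addrA addrAC.
      rewrite (assoc (simple_integral _ _ (s n)))
        (assoc (simple_integral _ _ (s' n))) [in RHS]opprD [RHS]addrACA subrr addr0.
      by rewrite !opprB [LHS]addrACA [RHS]addrACA; congr (_ + _); exact: addrC.
    apply: leeD.
    + exact: (bochner_fine_dist yT mN N0 lg gg (sss n) (du y yT)).
    + exact: (bochner_fine_dist yT mN' N0' lg' gg' (sss' n) (du' y yT)).
  - have aN : {ae nu, forall y, ~ N y} by exists N; split=> // y /= /contrapT.
    have aN' : {ae nu, forall y, ~ N' y} by exists N'; split=> // y /= /contrapT.
    apply: filterS2 (filterI Ag Ag') (filterI aN aN') => y [Ay Ay'] [Ny Ny'] yT.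
    have yT' : 0 <= y <= T by case/andP: yT => y0 ->; rewrite ltW.
    have [a Aa ag] := Ay yT'; have [a' Aa' ag'] := Ay' yT'.
    have yI : `]0, T]%classic y by rewrite /= in_itv.
    rewrite -gg// -gg'//.
    have := (hA yT').1 _ _ _ _ Aa Aa'.
    (* The forcing terms cancel, both inclusions involving the same [p] and [f], and monotonicity of
       [A y] gives the sign. *)
    have -> : a - a' = - (g y - g' y).
      have -> : a = - g y - p y *: f y by rewrite -ag addrK.
      have -> : a' = - g' y - p y *: f y by rewrite -ag' addrK.
      by rewrite [in LHS]opprB addrA subrK opprK opprB addrC.
    by rewrite dotNl oppr_ge0.
move=> t tT; split; last exact: u_eq.
(* Once [u' = u] on []0, t]], both positions are Bochner integrals of the same map. *)
have h : is_bochner_integral nu `]0, t] u (x' t - x0).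
  apply: eq_bochner (xE' t tT) => y /=; rewrite in_itv/= => /andP[y0 yt].
  by apply: u_eq; rewrite ltW//= (le_trans yt)//; case/andP: tT.
exact: addIr (bochner_unique hdot (mI 0 t) h (xE t tT)).
Qed.

End uniqueness.

Theorem theorem3p2 (R : realType) (E : completeNormedModType R)
  (dot : {dot E for idfun}) (hdot : norm_of_dot dot) (hsep : separable E)
  (T : R) (T0 : 0 < T)
  (f : R -> E) (M : R) (M0 : 0 <= M)
  (hf : strongly_measurable (lambda_I T) `[0, T] f)
  (hfM : forall t, 0 <= t <= T -> `|f t| <= M)
  (A : R -> E -> set E)
  (hA : forall t, 0 <= t <= T -> maximal_monotone dot (A t))
  (r : R -> R) (hr : stieltjes_function T r)
  (H1 : forall s t, 0 <= s -> s <= t -> t <= T ->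
    (dis dot (A t) (A s) <= (r t - r s)%:E)%E)
  (c : R) (c0 : 0 <= c)
  (H2 : forall t x, 0 <= t <= T -> dom (A t) x ->
    `|min_section (A t) x| <= c * (1 + `|x|))
  (H3 : ball_compact (\bigcup_(t in `[0, T]) dom (A t)))
  (x0 u0 : E) (hu0 : dom (A 0) u0) :
  let nu := nu_I T0 hr in
  let p := density_lambda T0 hr in
  exists x u g : R -> E, exists K : R,
    [/\ is_solution T nu p A f x0 u0 x u g,
        0 < K,
        {ae nu, forall t, 0 <= t <= T -> `|g t| <= K} &
        forall x' u' g' : R -> E, is_solution T nu p A f x0 u0 x' u' g' ->
          forall t, 0 <= t <= T -> x' t = x t /\ u' t = u t].
Proof.
move=> nu p.
have [x [u [g [K [sol K0 gK]]]]] :=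
  solution_exists hdot T0 hA hr H1 M0 hf hfM c0 H2 H3 x0 hu0.
exists x, u, g, K; split=> // x' u' g' sol'.
exact: (solution_unique hdot hA sol sol').
Qed.
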